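(* Let $0<\alpha<1$, let $U\subset\mathbb{C}$ be a bounded open set, and let $b\in\partial U$ be a boundary point of $U$. Suppose the algebra $A=A_\alpha(U)$ admits a nonzero continuous point derivation at $b$, and let $\partial:A\to\mathbb{C}$ be the normalised (continuous) point derivation at $b$. Then there exists a set $E\subset U$, having full area density at $b$, such that for each $f\in A$, $$\lim_{E\ni z\to b}\frac{f(z)-f(b)}{z-b}=\partial f.$$
   Context: $A_\alpha(U)$ denotes the algebra of functions $f:U\to\mathbb{C}$ that are holomorphic on $U$ and satisfy the little-lip condition with exponent $\alpha$ on $U$, i.e. $\kappa(f):=\sup_{z\ne w}\frac{|f(z)-f(w)|}{|z-w|^\alpha}<\infty$ and $\sup\left\{\frac{|f(z)-f(w)|}{|z-w|^\alpha}: z,w\in U,\ 0<|z-w|<\delta\right\}\to0$ as $\delta\downarrow0$. It is a Banach algebra under pointwise operations with norm $\|f\|=\sup|f|+\kappa(f)$ (up to equivalence of norms). Each $f\in A_\alpha(U)$ extends uniquely to a continuous function on the closure of $U$; $f(b)$ denotes the value of this extension at $b$. A point derivation at $b$ is a linear functional $\partial:A\to\mathbb{C}$ with $\partial(fg)=f(b)\,\partial g+g(b)\,\partial f$ for all $f,g\in A$; it is continuous if it is bounded for the norm of $A$, and normalised if $\partial(z)=1$, where $z$ denotes the coordinate function. A set $E\subset\mathbb{C}$ has full area density at $b$ if $\lim_{r\downarrow0}\frac{\mathcal{L}^2(E\cap\mathbb{B}(b,r))}{\pi r^2}=1$, where $\mathcal{L}^2$ is two-dimensional Lebesgue measure and $\mathbb{B}(b,r)$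 is the closed disc of centre $b$ and radius $r$. *)

(* Defs.v *)
From mathcomp Require Import all_boot all_order all_algebra complex.
From mathcomp Require Import all_classical all_reals all_analysis.

Set Implicit Arguments.
Unset Strict Implicit.
Unset Printing Implicit Defensive.

Import Order.TTheory GRing.Theory Num.Theory.
Import numFieldNormedType.Exports.

Local Open Scope classical_set_scope.
Local Open Scope ring_scope.

(* Packaging R[i] as a numFieldType gives it the norm topology of
   numFieldNormedType; [derivable] at this type is complex differentiability. *)
Definition C (R : realType) : numFieldType := R[i].

(* The norm `|z| takes its values in C itself; this is the real-valued one. *)
Definition cabs (R : realType) (z : C R) : R := Normc.normc z.

Section LittleLip.
Context {R : realType}.
Implicit Types (U : set (C R)) (alpha : R) (b : C R) (f g : C R -> C R).

Definition boundary U : set (C R) := closure U `\` U°.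

Definition holomorphic_on U f : Prop := forall z, U z -> derivable f z 1.

Definition lip_quotient alpha f (z w : C R) : R :=
  cabs (f z - f w) / cabs (z - w) `^ alpha.

Definition kappa U alpha f : \bar R :=
  ereal_sup [set q | exists z w,
    [/\ U z, U w, z != w & q = (lip_quotient alpha f z w)%:E]].

Definition local_kappa U alpha f (delta : R) : \bar R :=
  ereal_sup [set q | exists z w,
    [/\ U z, U w, 0 < cabs (z - w) < delta &
        q = (lip_quotient alpha f z w)%:E]].

(* A function on U is represented by a total function on C whose values outside
   U are irrelevant. *)
Definition A_ U alpha : set (C R -> C R) :=
  [set f | [/\ holomorphic_on U f, (kappa U alpha f < +oo)%E &
               local_kappa U alpha f delta @[delta --> 0^'+] --> 0%E]].

Definition A_norm U alpha f : \bar R :=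
  (ereal_sup [set (cabs (f z))%:E | z in U] + kappa U alpha f)%E.

(* The value at b, a point of the closure of U, of the continuous extension. *)
Definition ext_value U b f : C R := lim (f z @[z --> within U (nbhs b)]).

(* The first clause says that d depends only on the restrictions to U; the
   values of d outside A_ U alpha are irrelevant. *)
Definition point_derivation U alpha b (d : (C R -> C R) -> C R) : Prop :=
  [/\ forall f g, A_ U alpha f -> A_ U alpha g ->
        (forall z, U z -> f z = g z) -> d f = d g,
      forall (c : C R) f g, A_ U alpha f -> A_ U alpha g ->
        d (fun z => c * f z + g z) = c * d f + d g &
      forall f g, A_ U alpha f -> A_ U alpha g ->
        d (fun z => f z * g z) = ext_value U b f * d g + ext_value U b g * d f].

Definition continuous_functional U alpha (d : (C R -> C R) -> C R) : Prop :=
  exists M : R, forall f, A_ U alpha f ->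
    ((cabs (d f))%:E <= M%:E * A_norm U alpha f)%E.

Definition nonzero_functional U alpha (d : (C R -> C R) -> C R) : Prop :=
  exists2 f, A_ U alpha f & d f != 0.

Definition normalised (d : (C R -> C R) -> C R) : Prop := d (fun z => z) = 1.

(* The product measure lives on R * R, so subsets of C are transported there. *)
Definition in_plane (E : set (C R)) : set (R * R) :=
  [set p | E (p.1 +i* p.2)%C].

Definition area (E : set (C R)) : \bar R :=
  (@lebesgue_measure R \x @lebesgue_measure R)%E (in_plane E).

Definition closed_disc b (r : R) : set (C R) := [set z | cabs (z - b) <= r].

Definition full_area_density b (E : set (C R)) : Prop :=
  (area (E `&` closed_disc b r) * ((pi * r ^+ 2)^-1)%:E)%E @[r --> 0^'+]
    --> 1%E.

End LittleLip.

(* Main.v *)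
Require Import Defs.
From mathcomp Require Import all_boot all_order all_algebra complex.
From mathcomp Require Import all_classical all_reals all_analysis.
From mathcomp Require Import ring lra.

(** The derivation [d] measures its own failure to be a derivative. For [a] in [U] write
    [f = f a + (z - a) g]; the quotient [g] belongs to the algebra, and applying [d] gives
    [(f a - f b) / (a - b) - d f = (a - b) d g] ([quotient_error]). So the theorem follows
    if, outside a set of density zero at [b], the functions [(a - b) g] have small image
    under [d], uniformly for [f] in the unit ball. The singularity of [g] at [a] is
    removed by Cauchy's formula on a square, itself obtained from Goursat's theorem
    ([goursat], [cauchy_formula], [local_quotient]).

    A single function [(a - b) g] may have a large Lipschitz constant, but its increments
    are bounded by the potentials [|a - b| / |z - a|], whose averages over [a] in a disc of
    radius [r] are bounded independently of [z] and [r]. Suppose then that at arbitrarily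
    small scales [r] the points [a] with [|(a - b) d g| > del] for some [f] in the unit ball
    fill a fixed proportion of the disc. Averaging over them the functions [(a - b) g],
    rotated to make [d] positive, yields [h] with [d h >= del] and a Lipschitz constant
    independent of [r], which moreover hardly varies far from [b] compared to [r]
    ([hump]). Near [b] it hardly varies either, because it satisfies the little condition.
    So sums of such functions over rapidly decreasing scales keep a bounded Lipschitz
    constant while [d] grows linearly, against the continuity of [d] ([bad_density]).

    The complement of [U] has density zero at [b] as well ([complement_area]). For its part
    [K] in the disc of radius [r], the function [\int_K (a - b)^2 / (z - a)] of [z] belongs
    to the algebra and has norm [O(r^(3 - alpha))], whereas [d] maps it to minus the area of
    [K], so that this area is [O(r^(3 - alpha))], hence [o(r^2)].

    Finally one set of full density is extracted which avoids the exceptional sets for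
    [del = 1/(n+1)], all [n], near [b] ([avoid_zero_density]).

    Both averages are finite sums: a bounded set is replaced by finitely many weighted points
    that imitate area above a given scale ([discretize_C], [potential_bound]). For the
    complement of [U], whose points cannot be separated from the domain, the limit of such
    sums along an ultrafilter is taken ([area_functional]). *)

Set Implicit Arguments.
Unset Strict Implicit.
Unset Printing Implicit Defensive.

Import Order.TTheory GRing.Theory Num.Theory.
Import numFieldNormedType.Exports.
Local Open Scope classical_set_scope.
Local Open Scope ring_scope.

Local Notation Re := complex.Re.
Local Notation Im := complex.Im.

(** * The complex plane with real-valued norm *)

Section ComplexBasics.
Context {R : realType}.
Implicit Types (z w : C R).

(** The embedding of the reals, typed in [C R] so that unification does not leave
    this structure for that of [R[i]]. *)
Definition rc (x : R) : C R := x%:C%C.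

Lemma normE z : `|z| = rc (cabs z).
Proof. by []. Qed.

Lemma cabs_ge0 z : 0 <= cabs z.
Proof. by have := normr_ge0 z; rewrite normE /rc ler0c. Qed.

Lemma cabs0 : cabs (0 : C R) = 0.
Proof. exact: Normc.normc0. Qed.

Lemma cabs1 : cabs (1 : C R) = 1.
Proof. exact: Normc.normc1. Qed.

Lemma cabs_eq0 z : (cabs z == 0) = (z == 0).
Proof.
apply/eqP/eqP => [/Normc.eq0_normc//|->]; exact: cabs0.
Qed.

Lemma cabs_gt0 z : (0 < cabs z) = (z != 0).
Proof. by rewrite lt_neqAle cabs_ge0 andbT eq_sym cabs_eq0. Qed.

Lemma cabsM z w : cabs (z * w) = cabs z * cabs w.
Proof. exact: Normc.normcM. Qed.

Lemma cabsV z : cabs z^-1 = (cabs z)^-1.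
Proof. exact: Normc.normcV. Qed.

Lemma cabsf z w : cabs (z / w) = cabs z / cabs w.
Proof. by rewrite cabsM cabsV. Qed.

Lemma cabsN z : cabs (- z) = cabs z.
Proof. exact: normcN. Qed.

Lemma cabsX z n : cabs (z ^+ n) = cabs z ^+ n.
Proof. by elim: n => [|n IH]; rewrite ?expr0 ?cabs1 // !exprS cabsM IH. Qed.

Lemma cabsD z w : cabs (z + w) <= cabs z + cabs w.
Proof. exact: le_normcD. Qed.

Lemma cabsB z w : cabs (z - w) <= cabs z + cabs w.
Proof. by rewrite -(cabsN w) cabsD. Qed.

Lemma cdistC z w : cabs (z - w) = cabs (w - z).
Proof. by rewrite -cabsN opprB. Qed.

Lemma cdistD w z v : cabs (z - v) <= cabs (z - w) + cabs (w - v).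
Proof. by rewrite -[z - v](subrKA w) cabsD. Qed.

Lemma cabs_sum (I : Type) (s : seq I) (P : pred I) (F : I -> C R) :
  cabs (\sum_(i <- s | P i) F i) <= \sum_(i <- s | P i) cabs (F i).
Proof.
elim/big_ind2 : _ => //; first by rewrite cabs0.
by move=> x1 x2 y1 y2 h1 h2; exact: le_trans (cabsD _ _) (lerD h1 h2).
Qed.

Lemma cabs_rc (x : R) : cabs (rc x) = `|x|.
Proof. by rewrite /cabs /= expr0n addr0 sqrtr_sqr. Qed.

Lemma rc_sum (I : Type) (s : seq I) (P : pred I) (F : I -> R) :
  rc (\sum_(i <- s | P i) F i) = \sum_(i <- s | P i) rc (F i).
Proof. exact: (rmorph_sum (real_complex R)). Qed.

Lemma Re_le_cabs z : `|Re z| <= cabs z.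
Proof. by case: z => x y; rewrite /cabs /= -sqrtr_sqr ler_wsqrtr// lerDl sqr_ge0. Qed.

Lemma Im_le_cabs z : `|Im z| <= cabs z.
Proof. by case: z => x y; rewrite /cabs /= -sqrtr_sqr ler_wsqrtr// lerDr sqr_ge0. Qed.

Lemma cabs_le_ReIm z : cabs z <= `|Re z| + `|Im z|.
Proof.
case: z => x y; rewrite /cabs /= -(@ler_pXn2r _ 2) ?nnegrE ?sqrtr_ge0 ?addr_ge0//.
rewrite sqr_sqrtr ?addr_ge0 ?sqr_ge0// sqrrD !real_normK ?num_real//.
by rewrite addrAC lerDl mulrn_wge0// mulr_ge0.
Qed.

Lemma cabs_sqr z : cabs z ^+ 2 = Re z ^+ 2 + Im z ^+ 2.
Proof. by case: z => x y; rewrite /cabs /= sqr_sqrtr// addr_ge0// sqr_ge0. Qed.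

Lemma ReD z w : Re (z + w) = Re z + Re w.
Proof. by case: z; case: w. Qed.

Lemma ImD z w : Im (z + w) = Im z + Im w.
Proof. by case: z; case: w. Qed.

Lemma ReN z : Re (- z) = - Re z.
Proof. by case: z. Qed.

Lemma ImN z : Im (- z) = - Im z.
Proof. by case: z. Qed.

Lemma Re_sum (I : Type) (s : seq I) (P : pred I) (F : I -> C R) :
  Re (\sum_(i <- s | P i) F i) = \sum_(i <- s | P i) Re (F i).
Proof. by elim/big_rec2 : _ => // i y1 y2 _ <-; rewrite ReD. Qed.

Lemma cpos_rc (e : C R) : 0 < e -> e = rc (Re e) /\ 0 < Re e.
Proof.
by case: e => x y; rewrite ltcE /=; case/andP => /eqP -> x0; split.
Qed.

(** Balls of [C R] have their radii in [C R] itself. The lemmas that follow restate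
    neighbourhoods, limits and openness with real radii. *)
Lemma nbhs_cP z (A : set (C R)) :
  nbhs z A <-> exists2 e : R, 0 < e & forall w, cabs (w - z) < e -> A w.
Proof.
split=> [/nbhs_ballP[e/= /cpos_rc[-> e0] sA]|[e e0 sA]].
  exists (Re e) => // w wz; apply: sA; rewrite -ball_normE /ball_ /=.
  by rewrite normE ltcR cdistC.
apply/nbhs_ballP; exists (rc e); first by rewrite /= /rc ltcR.
by move=> w; rewrite -ball_normE /ball_ /= normE ltcR cdistC => /sA.
Qed.

Lemma cvg_cP (T : Type) (F : set_system T) (FF : Filter F) (f : T -> C R) (l : C R) :
  f @ F --> l <-> forall e : R, 0 < e -> F [set t | cabs (f t - l) < e].
Proof.
split=> [fl e e0|H].
  by apply: (fl [set w | cabs (w - l) < e]); apply/nbhs_cP; exists e.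
move=> A /nbhs_cP[e e0 sA]; apply: (@filterS _ F FF _ (f @^-1` A) _ (H e e0)) => t; exact: sA.
Qed.

Lemma open_cP (U : set (C R)) : open U <->
  forall z, U z -> exists2 e : R, 0 < e & forall w, cabs (w - z) < e -> U w.
Proof.
rewrite openE; split=> H z Uz; first by apply/nbhs_cP; exact: H.
by apply/nbhs_cP; exact: H.
Qed.

Lemma bounded_cP (U : set (C R)) : bounded_set U ->
  exists2 T : R, 0 < T & forall z, U z -> cabs z <= T.
Proof.
move=> [M [Mr HM]]; have [x Mx] : exists x, M = rc x.
  by move/complex_realP : Mr => [k ->]; exists k.
exists (`|x| + 1); first by rewrite ltr_wpDl.
move=> z Uz; have : M < rc (`|x| + 1).
  by rewrite Mx ltcR (le_lt_trans (ler_norm x))// ltrDl.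
by move=> /HM /(_ z Uz); rewrite /= normE lecR.
Qed.

(** With the derivative as an argument, this is an inequality between real numbers
    that can be integrated and passed to limits. *)
Definition cdiff (f : C R -> C R) z c : Prop :=
  forall e : R, 0 < e -> exists2 del : R, 0 < del &
    forall w, cabs (w - z) < del ->
      cabs (f w - f z - c * (w - z)) <= e * cabs (w - z).

Lemma derivable_cP f z : derivable f z 1 <-> exists c, cdiff f z c.
Proof.
split.
  move=> /cvg_ex[c /cvg_cP H]; exists c => e e0.
  have /nbhs_cP[del del0 Hd] := H e e0; exists del => // w wz.
  have [->|nwz] := eqVneq w z; first by rewrite !subrr mulr0 subr0 cabs0 mulr0.
  have nz : w - z != 0 by rewrite subr_eq0.
  have := Hd (w - z); rewrite subr0 => /(_ wz nz)/=.
  rewrite [_%R *: 1](_ : _ = w - z); last by rewrite -[RHS]mulr1.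
  rewrite subrK => /ltW h.
  have -> : f w - f z - c * (w - z) = (w - z) * ((w - z)^-1 *: (f w - f z) - c).
    rewrite [_ *: _](_ : _ = (w - z)^-1 * (f w - f z)) //.
    by rewrite [RHS]mulrBr [(w - z) * (_ * _)]mulrA divff// mul1r [c * _]mulrC.
  by rewrite cabsM mulrC ler_wpM2r// cabs_ge0.
move=> [c H]; apply/cvg_ex; exists c; apply/cvg_cP => e e0.
have [del del0 Hd] := H (e / 2) (divr_gt0 e0 (ltr0n _ 2)).
apply/nbhs_cP; exists del => // h; rewrite subr0 => hd hn0 /=.
have hz : h *: (1 : C R) + z = z + h by rewrite [_ *: _]mulr1 addrC.
have := Hd (z + h); rewrite [z + h - z]addrC addKr => /(_ hd) H1.
rewrite hz.
have -> : h^-1 *: (f (z + h) - f z) - c = h^-1 * (f (z + h) - f z - c * h).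
  rewrite [_ *: _](_ : _ = h^-1 * (f (z + h) - f z)) //.
  by rewrite [RHS]mulrBr [c * h]mulrC [h^-1 * (h * c)]mulrA mulVf// mul1r.
rewrite cabsM cabsV ltr_pdivrMl ?cabs_gt0// (le_lt_trans H1)//.
by rewrite mulrC ltr_pM2l ?cabs_gt0// ltr_pdivrMr// ltr_pMr// ltr1n.
Qed.

Lemma derivable_addc (f g : C R -> C R) z : derivable f z 1 -> derivable g z 1 ->
  derivable (fun u => f u + g u) z 1.
Proof. exact: derivableD. Qed.

Lemma derivable_mulc (f g : C R -> C R) z : derivable f z 1 -> derivable g z 1 ->
  derivable (fun u => f u * g u) z 1.
Proof. exact: derivableM. Qed.

Lemma derivable_invc (f : C R -> C R) z : f z != 0 -> derivable f z 1 ->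
  derivable (fun u => (f u)^-1) z 1.
Proof. exact: derivableV. Qed.

Lemma derivable_constc (c : C R) z : derivable ((fun _ => c) : C R -> C R) z 1.
Proof. exact: derivable_cst. Qed.

Lemma derivable_idc z : derivable (fun u : C R => u) z 1.
Proof. exact: derivable_id. Qed.

Lemma derivable_addcst (f : C R -> C R) c z : derivable f z 1 ->
  derivable (fun u => f u + c) z 1.
Proof. by move=> df; exact: (derivable_addc df (@derivable_constc c z)). Qed.

End ComplexBasics.

(** * Integrals over segments and rectangles *)

Section RectangleIntegral.
Context {R : realType}.
Implicit Types (a b m x y : R) (phi : R -> C R) (f g : C R -> C R) (D : set (C R)).
Local Notation mu := (@lebesgue_measure R).

Definition seg_integral a b phi : C R :=
  ((\int[mu]_(x in `[a, b]) Re (phi x)) +i* (\int[mu]_(x in `[a, b]) Im (phi x)))%C.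

(** Continuity relative to the segment: nothing is assumed outside it. *)
Definition scont a b phi := forall x, a <= x <= b -> forall e : R, 0 < e ->
  exists2 d : R, 0 < d & forall y, a <= y <= b -> `|y - x| < d ->
    cabs (phi y - phi x) <= e.

Lemma scont_Re a b phi : scont a b phi ->
  mu.-integrable `[a, b] (EFin \o (fun x => Re (phi x))).
Proof.
move=> cf; apply: continuous_compact_integrable; first exact: segment_compact.
apply/subspace_continuousP => x; rewrite /= in_itv/= => xab.
apply/cvgrPdist_le => e e0; have [d d0 H] := cf _ xab e e0.
apply/nbhs_ballP; exists d => // y; rewrite /ball/= distrC in_itv/= => yx yab.
by rewrite -ReN -ReD (le_trans (Re_le_cabs _))// cdistC H.
Qed.

Lemma scont_Im a b phi : scont a b phi ->
  mu.-integrable `[a, b] (EFin \o (fun x => Im (phi x))).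
Proof.
move=> cf; apply: continuous_compact_integrable; first exact: segment_compact.
apply/subspace_continuousP => x; rewrite /= in_itv/= => xab.
apply/cvgrPdist_le => e e0; have [d d0 H] := cf _ xab e e0.
apply/nbhs_ballP; exists d => // y; rewrite /ball/= distrC in_itv/= => yx yab.
by rewrite -ImN -ImD (le_trans (Im_le_cabs _))// cdistC H.
Qed.

Lemma scontD a b phi psi : scont a b phi -> scont a b psi ->
  scont a b (fun x => phi x + psi x).
Proof.
move=> h1 h2 x xab e e0; have e2 : 0 < e / 2 by rewrite divr_gt0.
have [d1 d10 H1] := h1 x xab _ e2; have [d2 d20 H2] := h2 x xab _ e2.
exists (Num.min d1 d2); first by rewrite lt_min d10.
move=> y yab; rewrite lt_min => /andP[y1 y2].
rewrite opprD addrACA (le_trans (cabsD _ _))// (splitr e) lerD//; first exact: H1.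
exact: H2.
Qed.

Lemma scontZ a b c phi : scont a b phi -> scont a b (fun x => c * phi x).
Proof.
move=> h x xab e e0; have c1 : 0 < cabs c + 1 by rewrite ltr_wpDl ?cabs_ge0.
have [d d0 H] := h x xab _ (divr_gt0 e0 c1); exists d => // y yab yx.
rewrite -mulrBr cabsM (le_trans (ler_wpM2l (cabs_ge0 _) (H y yab yx)))//.
by rewrite mulrCA ger_pMr// ler_pdivrMr// mul1r lerDl.
Qed.

Lemma seg_integralD a b phi psi : scont a b phi -> scont a b psi ->
  seg_integral a b (fun x => phi x + psi x) = seg_integral a b phi + seg_integral a b psi.
Proof.
move=> h1 h2; rewrite /seg_integral.
under eq_Rintegral do rewrite ReD.
under [X in (_ +i* X)%C]eq_Rintegral do rewrite ImD.
by rewrite !RintegralD//; [exact: scont_Im|exact: scont_Im|exact: scont_Re|exact: scont_Re].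
Qed.

Lemma seg_integralZ a b c phi : scont a b phi ->
  seg_integral a b (fun x => c * phi x) = c * seg_integral a b phi.
Proof.
move=> h; rewrite /seg_integral; case: c => c1 c2.
have RM z : Re ((c1 +i* c2)%C * z : C R) = c1 * Re z + (- c2) * Im z.
  by case: z => u v /=; rewrite mulNr.
have IM z : Im ((c1 +i* c2)%C * z : C R) = c1 * Im z + c2 * Re z.
  by case: z => u v /=.
have iZ (k : R) (u : R -> R) : mu.-integrable `[a, b] (EFin \o u) ->
    mu.-integrable `[a, b] (EFin \o (fun x => k * u x)).
  by move=> iu; apply: eq_integrable (integrableZl _ k iu).
have iR := scont_Re h; have iI := scont_Im h.
under eq_Rintegral do rewrite RM.
under [X in (_ +i* X)%C]eq_Rintegral do rewrite IM.
rewrite !RintegralD//; try exact: iZ.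
rewrite !RintegralZl//=.
by rewrite mulNr.
Qed.

Lemma eq_seg_integral a b phi psi : (forall x, a <= x <= b -> phi x = psi x) ->
  seg_integral a b phi = seg_integral a b psi.
Proof.
move=> h; rewrite /seg_integral; congr Complex; apply: eq_Rintegral => x;
  by rewrite inE/= in_itv/= => /h ->.
Qed.

Lemma Rint_seg_cst a b (r : R) : a <= b -> \int[mu]_(x in `[a, b]) r = r * (b - a).
Proof.
move=> ab; rewrite Rintegral_cst//= lebesgue_measure_itv/= lte_fin.
by case: ltP => // ba; rewrite (le_anti (introT andP (conj ab ba))) subrr.
Qed.

Lemma seg_integral_cst a b c : a <= b -> seg_integral a b (fun _ => c) = c * rc (b - a).
Proof.
by move=> ab; rewrite /seg_integral !Rint_seg_cst//; case: c => u v /=; simpc.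
Qed.

Lemma seg_integral_bound a b phi (M : R) : a <= b -> scont a b phi ->
  (forall x, a <= x <= b -> cabs (phi x) <= M) ->
  cabs (seg_integral a b phi) <= 2 * M * (b - a).
Proof.
move=> ab cf fM; rewrite (le_trans (cabs_le_ReIm _))// -mulrA mulr_natl mulr2n.
have bnd (u : R -> R) : mu.-integrable `[a, b] (EFin \o u) ->
    (forall x, a <= x <= b -> `|u x| <= M) ->
    `|\int[mu]_(x in `[a, b]) u x| <= M * (b - a).
  move=> iu uM; rewrite (le_trans (le_normr_Rintegral _ iu))// -Rint_seg_cst//.
  apply: le_Rintegral => //.
  - exact: (integrable_abse iu).
  - apply: continuous_compact_integrable; first exact: segment_compact.
    by apply: continuous_subspaceT => x; exact: cvg_cst.
apply: lerD; (apply: bnd; [by [exact: scont_Re|exact: scont_Im]|]).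
  by move=> x xab; rewrite (le_trans (Re_le_cabs _))// fM.
by move=> x xab; rewrite (le_trans (Im_le_cabs _))// fM.
Qed.

Lemma Re_seg_integral_ge a b phi (k : R) : a <= b -> scont a b phi ->
  (forall x, a <= x <= b -> k <= Re (phi x)) -> k * (b - a) <= Re (seg_integral a b phi).
Proof.
move=> ab cf fk; rewrite -Rint_seg_cst//=; apply: le_Rintegral => //.
- apply: continuous_compact_integrable; first exact: segment_compact.
  by apply: continuous_subspaceT => x; exact: cvg_cst.
- exact: scont_Re.
Qed.

Lemma Im_seg_integral_ge a b phi (k : R) : a <= b -> scont a b phi ->
  (forall x, a <= x <= b -> k <= Im (phi x)) -> k * (b - a) <= Im (seg_integral a b phi).
Proof.
move=> ab cf fk; rewrite -Rint_seg_cst//=; apply: le_Rintegral => //.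
- apply: continuous_compact_integrable; first exact: segment_compact.
  by apply: continuous_subspaceT => x; exact: cvg_cst.
- exact: scont_Im.
Qed.

Lemma seg_integral_cut a m b phi : a <= m -> m <= b -> scont a b phi ->
  seg_integral a b phi = seg_integral a m phi + seg_integral m b phi.
Proof.
move=> am mb cf.
have cut (u : R -> R) : mu.-integrable `[a, b] (EFin \o u) ->
    \int[mu]_(x in `[a, b]) u x =
    \int[mu]_(x in `[a, m]) u x + \int[mu]_(x in `[m, b]) u x.
  move=> iu; apply/eqP; rewrite addrC -subr_eq; apply/eqP.
  rewrite Rintegral_itvB ?bnd_simp// Rintegral_itv_obnd_cbnd//.
  apply: integrableS iu => //; apply: subset_itv => //; by rewrite bnd_simp.
rewrite /seg_integral !cut//; [exact: scont_Im|exact: scont_Re].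
Qed.

Definition ccont_on D f := forall z, D z -> forall e : R, 0 < e ->
  exists2 d : R, 0 < d & forall w, D w -> cabs (w - z) < d -> cabs (f w - f z) <= e.

Lemma ccont_onS D D' f : D' `<=` D -> ccont_on D f -> ccont_on D' f.
Proof.
move=> sD cf z D'z e e0; have [d d0 H] := cf z (sD _ D'z) e e0; exists d => // w.
by move=> /sD; exact: H.
Qed.

Lemma ccont_onD D f g : ccont_on D f -> ccont_on D g -> ccont_on D (fun z => f z + g z).
Proof.
move=> h1 h2 x Dx e e0; have e2 : 0 < e / 2 by rewrite divr_gt0.
have [d1 d10 H1] := h1 x Dx _ e2; have [d2 d20 H2] := h2 x Dx _ e2.
exists (Num.min d1 d2); first by rewrite lt_min d10.
move=> y yab; rewrite lt_min => /andP[y1 y2].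
rewrite opprD addrACA (le_trans (cabsD _ _))// (splitr e) lerD//; first exact: H1.
exact: H2.
Qed.

Lemma ccont_onM D f g : ccont_on D f -> ccont_on D g -> ccont_on D (fun z => f z * g z).
Proof.
move=> h1 h2 x Dx e e0.
pose A := cabs (f x) + cabs (g x) + 2.
have A0 : 0 < A by rewrite ltr_wpDl ?addr_ge0 ?cabs_ge0.
pose k := Num.min 1 (e / A).
have k0 : 0 < k by rewrite lt_min ltr01 divr_gt0.
have [d1 d10 H1] := h1 x Dx _ k0; have [d2 d20 H2] := h2 x Dx _ k0.
exists (Num.min d1 d2); first by rewrite lt_min d10.
move=> y Dy; rewrite lt_min => /andP[y1 y2].
have -> : f y * g y - f x * g x =
  (f y - f x) * (g y - g x) + (f y - f x) * g x + f x * (g y - g x) by ring.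
have k1 : k <= 1 by rewrite ge_min lexx.
have kA : k * A <= e by rewrite -ler_pdivlMr// ge_min lexx orbT.
have {}H1 := H1 y Dy y1; have {}H2 := H2 y Dy y2.
apply: le_trans kA; rewrite (le_trans (cabsD _ _))//.
have a1 : cabs ((f y - f x) * (g y - g x)) <= k.
  by rewrite cabsM -[leRHS]mulr1 ler_pM ?cabs_ge0// (le_trans H2).
have a2 : cabs ((f y - f x) * g x) <= k * cabs (g x).
  by rewrite cabsM ler_wpM2r ?cabs_ge0.
have a3 : cabs (f x * (g y - g x)) <= k * cabs (f x).
  by rewrite cabsM mulrC ler_wpM2r ?cabs_ge0.
have a4 := cabsD ((f y - f x) * (g y - g x)) ((f y - f x) * g x).
have : 0 <= k by exact: ltW.
rewrite /A; lra.
Qed.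

Lemma ccont_on_cst D c : ccont_on D (fun _ => c).
Proof. by move=> z _ e e0; exists 1 => // w _ _; rewrite subrr cabs0 ltW. Qed.

Lemma ccont_on_id D : ccont_on D (fun z => z).
Proof. by move=> z _ e e0; exists e => // w _ /ltW. Qed.

Lemma ccont_onV D f : ccont_on D f -> (forall z, D z -> f z != 0) ->
  ccont_on D (fun z => (f z)^-1).
Proof.
move=> h n0 x Dx e e0; have fx := n0 x Dx; have fx0 : 0 < cabs (f x) by rewrite cabs_gt0.
pose k := Num.min (cabs (f x) / 2) (e * (cabs (f x) ^+ 2 / 2)).
have k0 : 0 < k by rewrite lt_min !divr_gt0 ?mulr_gt0 ?divr_gt0 ?exprn_gt0.
have [d d0 H] := h x Dx _ k0; exists d => // y Dy yx.
have fy := n0 y Dy; have {}H := H y Dy yx.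
have -> : (f y)^-1 - (f x)^-1 = (f x - f y) / (f x * f y).
  by field; rewrite fx fy.
rewrite cabsf cabsM [cabs (_ - f y)]cdistC.
have fy2 : cabs (f x) / 2 <= cabs (f y).
  have := cdistD (f y) (f x) 0; rewrite !subr0 [cabs (f x - f y)]cdistC.
  have : k <= cabs (f x) / 2 by rewrite ge_min lexx.
  by move: H; lra.
have fy0 : 0 < cabs (f y) by rewrite cabs_gt0.
rewrite ler_pdivrMr ?mulr_gt0// (le_trans H)// (@le_trans _ _ (e * (cabs (f x) ^+ 2 / 2)))//.
  by rewrite ge_min lexx orbT.
by rewrite ler_pM2l// expr2 -mulrA ler_pM2l.
Qed.

Lemma cdiff_cont_on D f : (forall z, D z -> exists c, cdiff f z c) -> ccont_on D f.
Proof.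
move=> H z Dz e e0; have [c cd] := H z Dz; have [d d0 Hd] := cd 1 ltr01.
pose k := cabs c + 1; have k0 : 0 < k by rewrite ltr_wpDl ?cabs_ge0.
exists (Num.min d (e / k)) => [|w Dw]; first by rewrite lt_min d0 divr_gt0.
rewrite lt_min => /andP[wd wk]; have := Hd w wd.
have := cabsD (f w - f z - c * (w - z)) (c * (w - z)); rewrite subrK cabsM.
move: wk; rewrite ltr_pdivlMr// /k; lra.
Qed.

Definition rect x1 x2 y1 y2 : set (C R) :=
  [set z | (x1 <= Re z <= x2) && (y1 <= Im z <= y2)].

Definition rect_boundary x1 x2 y1 y2 : set (C R) :=
  [set z | rect x1 x2 y1 y2 z /\
    [|| Re z == x1, Re z == x2, Im z == y1 | Im z == y2]].

(** The integral of [f dz] along the boundary, counterclockwise; opposite sides are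
    paired, so that the integrals of affine functions reduce to those of constants. *)
Definition rect_integral x1 x2 y1 y2 f : C R :=
  seg_integral x1 x2 (fun x => f (x +i* y1)%C - f (x +i* y2)%C) +
  (0 +i* 1)%C * seg_integral y1 y2 (fun y => f (x2 +i* y)%C - f (x1 +i* y)%C).

Lemma cabs_hor (x x' y : R) : cabs ((x +i* y)%C - (x' +i* y)%C : C R) = `|x - x'|.
Proof. by rewrite /cabs /= subrr expr0n addr0 sqrtr_sqr. Qed.

Lemma cabs_ver (x y y' : R) : cabs ((x +i* y)%C - (x +i* y')%C : C R) = `|y - y'|.
Proof. by rewrite /cabs /= subrr expr0n add0r sqrtr_sqr. Qed.

Lemma scont_hor D f a b y : ccont_on D f ->
  (forall x, a <= x <= b -> D (x +i* y)%C) -> scont a b (fun x => f (x +i* y)%C).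
Proof.
move=> cf sD x xab e e0; have [d d0 H] := cf _ (sD x xab) e e0.
by exists d => // x' x'ab x'x; apply: H; [exact: sD|rewrite cabs_hor].
Qed.

Lemma scont_ver D f a b x : ccont_on D f ->
  (forall y, a <= y <= b -> D (x +i* y)%C) -> scont a b (fun y => f (x +i* y)%C).
Proof.
move=> cf sD y yab e e0; have [d d0 H] := cf _ (sD y yab) e e0.
by exists d => // y' y'ab y'y; apply: H; [exact: sD|rewrite cabs_ver].
Qed.

Lemma scontB a b phi psi : scont a b phi -> scont a b psi ->
  scont a b (fun x => phi x - psi x).
Proof.
move=> h1 h2; have := scontD h1 (scontZ (-1) h2).
by congr scont; apply/funext => x; rewrite mulN1r.
Qed.

Lemma seg_integralB a b phi psi : scont a b phi -> scont a b psi ->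
  seg_integral a b (fun x => phi x - psi x) = seg_integral a b phi - seg_integral a b psi.
Proof.
move=> h1 h2; have := seg_integralD h1 (scontZ (-1) h2).
rewrite seg_integralZ// mulN1r => <-.
by congr seg_integral; apply/funext => x; rewrite mulN1r.
Qed.

End RectangleIntegral.

(** * Goursat's theorem *)

Section Goursat.
Context {R : realType}.
Implicit Types (x y : R) (f g : C R -> C R).

Definition imu : C R := (0 +i* 1)%C.

Lemma cabs_imu : cabs imu = 1.
Proof. by rewrite /cabs /imu /= expr0n expr1n add0r sqrtr1. Qed.

Lemma rect_integral_scont x1 x2 y1 y2 f : x1 <= x2 -> y1 <= y2 ->
  ccont_on (rect_boundary x1 x2 y1 y2) f ->
  [/\ scont x1 x2 (fun x => f (x +i* y1)%C), scont x1 x2 (fun x => f (x +i* y2)%C),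
      scont y1 y2 (fun y => f (x1 +i* y)%C) & scont y1 y2 (fun y => f (x2 +i* y)%C)].
Proof.
move=> x12 y12 cf; split.
- by apply: scont_hor cf _ => x xab; split => /=; rewrite /rect/= ?xab ?lexx ?y12 ?eqxx ?orbT.
- by apply: scont_hor cf _ => x xab; split => /=; rewrite /rect/= ?xab ?lexx ?y12 ?eqxx ?orbT.
- by apply: scont_ver cf _ => x xab; split => /=; rewrite /rect/= ?xab ?lexx ?x12 ?eqxx ?orbT.
- by apply: scont_ver cf _ => x xab; split => /=; rewrite /rect/= ?xab ?lexx ?x12 ?eqxx ?orbT.
Qed.

Lemma rect_integralD x1 x2 y1 y2 f g : x1 <= x2 -> y1 <= y2 ->
  ccont_on (rect_boundary x1 x2 y1 y2) f -> ccont_on (rect_boundary x1 x2 y1 y2) g ->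
  rect_integral x1 x2 y1 y2 (fun z => f z + g z) =
    rect_integral x1 x2 y1 y2 f + rect_integral x1 x2 y1 y2 g.
Proof.
move=> x12 y12 /(rect_integral_scont x12 y12)[f1 f2 f3 f4]
  /(rect_integral_scont x12 y12)[g1 g2 g3 g4].
rewrite /rect_integral !seg_integralB// ?seg_integralD//; try exact: scontD.
by ring.
Qed.

Lemma rect_integralZ x1 x2 y1 y2 c f : x1 <= x2 -> y1 <= y2 ->
  ccont_on (rect_boundary x1 x2 y1 y2) f ->
  rect_integral x1 x2 y1 y2 (fun z => c * f z) = c * rect_integral x1 x2 y1 y2 f.
Proof.
move=> x12 y12 /(rect_integral_scont x12 y12)[f1 f2 f3 f4].
rewrite /rect_integral !seg_integralB// ?seg_integralZ//; try exact: scontZ.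
by ring.
Qed.

Lemma eq_rect_integral x1 x2 y1 y2 f g : x1 <= x2 -> y1 <= y2 ->
  (forall z, rect_boundary x1 x2 y1 y2 z -> f z = g z) ->
  rect_integral x1 x2 y1 y2 f = rect_integral x1 x2 y1 y2 g.
Proof.
move=> x12 y12 fg; rewrite /rect_integral; congr (_ + _ * _); apply: eq_seg_integral => t tab.
  by rewrite !fg//; split => /=; rewrite /rect/= ?tab ?lexx ?y12 ?eqxx ?orbT.
by rewrite !fg//; split => /=; rewrite /rect/= ?tab ?lexx ?x12 ?eqxx ?orbT.
Qed.

Lemma rect_integral_bound x1 x2 y1 y2 f (M : R) : x1 <= x2 -> y1 <= y2 ->
  ccont_on (rect_boundary x1 x2 y1 y2) f ->
  (forall z, rect_boundary x1 x2 y1 y2 z -> cabs (f z) <= M) ->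
  cabs (rect_integral x1 x2 y1 y2 f) <= 4 * M * ((x2 - x1) + (y2 - y1)).
Proof.
move=> x12 y12 /(rect_integral_scont x12 y12)[f1 f2 f3 f4] fM.
rewrite /rect_integral (le_trans (cabsD _ _))// cabsM -/imu cabs_imu mul1r mulrDr.
have -> : 4 * M = 2 * (M + M) by ring.
apply: lerD; apply: seg_integral_bound => //; try exact: scontB.
  move=> t tab; rewrite (le_trans (cabsB _ _))// lerD// fM//; split => /=;
    by rewrite /rect/= ?tab ?lexx ?y12 ?eqxx ?orbT.
move=> t tab; rewrite (le_trans (cabsB _ _))// lerD// fM//; split => /=;
  by rewrite /rect/= ?tab ?lexx ?x12 ?eqxx ?orbT.
Qed.

Lemma rect_integral_affine x1 x2 y1 y2 (c0 c1 : C R) : x1 <= x2 -> y1 <= y2 ->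
  rect_integral x1 x2 y1 y2 (fun z => c0 + c1 * z) = 0.
Proof.
move=> x12 y12; rewrite /rect_integral.
rewrite (@eq_seg_integral _ x1 x2 _ (fun=> c1 * (0 +i* (y1 - y2))%C)); last first.
  move=> x _; rewrite opprD addrACA subrr add0r -mulrBr; congr (_ * _).
  by apply/eqP; rewrite eq_complex/= subrr !eqxx.
rewrite (@eq_seg_integral _ y1 y2 _ (fun=> c1 * rc (x2 - x1))); last first.
  move=> x _; rewrite opprD addrACA subrr add0r -mulrBr; congr (_ * _).
  by apply/eqP; rewrite eq_complex/= subrr !eqxx.
rewrite !seg_integral_cst//.
have -> : (0 +i* (y1 - y2))%C = - (imu * rc (y2 - y1)) :> C R.
  by apply/eqP; rewrite eq_complex/=; apply/andP; split; apply/eqP; ring.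
by rewrite -/imu; ring.
Qed.

Lemma rect_integral_vcut x1 m x2 y1 y2 f : x1 <= m -> m <= x2 -> y1 <= y2 ->
  ccont_on (rect x1 x2 y1 y2) f ->
  rect_integral x1 x2 y1 y2 f = rect_integral x1 m y1 y2 f + rect_integral m x2 y1 y2 f.
Proof.
move=> x1m mx2 y12 cf; have x12 := le_trans x1m mx2; rewrite /rect_integral.
have hor y : y1 <= y <= y2 -> scont x1 x2 (fun x => f (x +i* y)%C).
  by move=> yy; apply: scont_hor cf _ => x xx; rewrite /rect/= xx yy.
have ver x : x1 <= x <= x2 -> scont y1 y2 (fun y => f (x +i* y)%C).
  by move=> yy; apply: scont_ver cf _ => y xx; rewrite /rect/= xx yy.
rewrite (seg_integral_cut x1m mx2); last by apply: scontB; apply: hor; rewrite lexx y12.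
rewrite !(@seg_integralB _ y1 y2); try by apply: ver; rewrite ?lexx ?x12 ?x1m ?mx2.
by ring.
Qed.

Lemma rect_integral_hcut x1 x2 y1 m y2 f : x1 <= x2 -> y1 <= m -> m <= y2 ->
  ccont_on (rect x1 x2 y1 y2) f ->
  rect_integral x1 x2 y1 y2 f = rect_integral x1 x2 y1 m f + rect_integral x1 x2 m y2 f.
Proof.
move=> x12 y1m my2 cf; have y12 := le_trans y1m my2; rewrite /rect_integral.
have hor y : y1 <= y <= y2 -> scont x1 x2 (fun x => f (x +i* y)%C).
  by move=> yy; apply: scont_hor cf _ => x xx; rewrite /rect/= xx yy.
have ver x : x1 <= x <= x2 -> scont y1 y2 (fun y => f (x +i* y)%C).
  by move=> yy; apply: scont_ver cf _ => y xx; rewrite /rect/= xx yy.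
rewrite (seg_integral_cut y1m my2); last by apply: scontB; apply: ver; rewrite lexx x12.
rewrite !(@seg_integralB _ x1 x2); try by apply: hor; rewrite ?lexx ?y12 ?y1m ?my2.
by ring.
Qed.

Lemma sub_rect x1 x2 y1 y2 u1 u2 v1 v2 : x1 <= u1 -> u2 <= x2 -> y1 <= v1 -> v2 <= y2 ->
  rect u1 u2 v1 v2 `<=` rect x1 x2 y1 y2.
Proof.
move=> h1 h2 h3 h4 z /andP[/andP[a1 a2] /andP[a3 a4]].
by rewrite /rect/= (le_trans h1 a1) (le_trans a2 h2) (le_trans h3 a3) (le_trans a4 h4).
Qed.

Lemma rect_boundary_rect x1 x2 y1 y2 : rect_boundary x1 x2 y1 y2 `<=` rect x1 x2 y1 y2.
Proof. by move=> z []. Qed.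

(** Bisection step: one of the four quarters carries a quarter of the integral. *)
Lemma max_quarter (a1 a2 a3 a4 k : R) :
  k <= a1 + a2 + a3 + a4 -> [\/ k / 4 <= a1, k / 4 <= a2, k / 4 <= a3 | k / 4 <= a4].
Proof.
move=> h; case: (leP (k / 4) a1) => h1; first by constructor 1.
case: (leP (k / 4) a2) => h2; first by constructor 2.
case: (leP (k / 4) a3) => h3; first by constructor 3.
by constructor 4; move: h h1 h2 h3; lra.
Qed.

Lemma rect_integral_quarter x y A B f : 0 <= A -> 0 <= B ->
  ccont_on (rect x (x + A) y (y + B)) f ->
  exists x' y', [/\ x <= x' <= x + A / 2, y <= y' <= y + B / 2 &
    cabs (rect_integral x (x + A) y (y + B) f) / 4 <=
    cabs (rect_integral x' (x' + A / 2) y' (y' + B / 2) f)].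
Proof.
move=> A0 B0 cf.
have A2 : 0 <= A / 2 by rewrite divr_ge0. have B2 : 0 <= B / 2 by rewrite divr_ge0.
have xA : x + A = x + A / 2 + A / 2 by rewrite -addrA -splitr.
have yB : y + B = y + B / 2 + B / 2 by rewrite -addrA -splitr.
rewrite xA yB in cf *.
have e1 := @rect_integral_vcut x (x + A / 2) (x + A / 2 + A / 2) y (y + B / 2 + B / 2) f.
rewrite e1 ?lerDl//; last by rewrite -addrA lerDl addr_ge0.
rewrite (@rect_integral_hcut x (x + A / 2) y (y + B / 2)) ?lerDl//; last first.
  by apply: ccont_onS cf; apply: sub_rect; rewrite ?lexx ?lerDl.
rewrite (@rect_integral_hcut (x + A / 2) (x + A / 2 + A / 2) y (y + B / 2)) ?lerDl//; last first.
  by apply: ccont_onS cf; apply: sub_rect; rewrite ?lexx ?lerDl.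
set I1 := rect_integral x _ y _ f; set I2 := rect_integral x _ (y + _) _ f.
set I3 := rect_integral (x + _) _ y _ f.
set I4 := rect_integral (x + _) _ (y + _) _ f.
have : cabs (I1 + I2 + (I3 + I4)) <= cabs I1 + cabs I2 + cabs I3 + cabs I4.
  by rewrite addrA !(le_trans (cabsD _ _))// lerD2r// (le_trans (cabsD _ _))// lerD2r cabsD.
case/max_quarter => h; [exists x, y|exists x, (y + B / 2)|exists (x + A / 2), y|
  exists (x + A / 2), (y + B / 2)]; by rewrite ?lexx ?lerDl ?A2 ?B2.
Qed.

(** Goursat: bisecting keeps a fixed proportion of the integral per unit area,
    whereas near a point of differentiability the integral is [o(area)]. *)
Theorem goursat x1 x2 y1 y2 f : x1 <= x2 -> y1 <= y2 ->
  (forall z, rect x1 x2 y1 y2 z -> exists c, cdiff f z c) ->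
  rect_integral x1 x2 y1 y2 f = 0.
Proof.
move=> x12 y12 df; have cf := cdiff_cont_on df.
apply/eqP; rewrite -cabs_eq0 eq_le cabs_ge0 andbT leNgt; apply/negP.
set eta := cabs _ => eta0.
pose A := x2 - x1; pose B := y2 - y1.
have A0 : 0 <= A by rewrite subr_ge0. have B0 : 0 <= B by rewrite subr_ge0.
pose P n (p : R * R) := [/\ x1 <= p.1, p.1 + A / 2 ^+ n <= x2, y1 <= p.2,
  p.2 + B / 2 ^+ n <= y2 & eta / 4 ^+ n <=
  cabs (rect_integral p.1 (p.1 + A / 2 ^+ n) p.2 (p.2 + B / 2 ^+ n) f)].
have An n : 0 <= A / 2 ^+ n by rewrite divr_ge0// exprn_ge0.
have Bn n : 0 <= B / 2 ^+ n by rewrite divr_ge0// exprn_ge0.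
have halfS (k : R) n : k / 2 ^+ n.+1 = k / 2 ^+ n / 2.
  by rewrite exprS invfM mulrA mulrAC.
have step n (p : R * R) : {q : R * R | P n p -> [/\ P n.+1 q,
    p.1 <= q.1, q.1 + A / 2 ^+ n.+1 <= p.1 + A / 2 ^+ n,
    p.2 <= q.2 & q.2 + B / 2 ^+ n.+1 <= p.2 + B / 2 ^+ n]}.
  apply: cid; have [[p1 p2 p3 p4 p5]|nP] := pselect (P n p); last by exists p.
  have cp : ccont_on (rect p.1 (p.1 + A / 2 ^+ n) p.2 (p.2 + B / 2 ^+ n)) f.
    by apply: ccont_onS cf; exact: sub_rect.
  have [x' [y' [/andP[h1 h2] /andP[h3 h4] h5]]] := rect_integral_quarter (An n) (Bn n) cp.
  exists (x', y') => _; rewrite /P /= !halfS.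
  have k1 : x' + A / 2 ^+ n / 2 <= p.1 + A / 2 ^+ n.
    by rewrite [leRHS](_ : _ = p.1 + A / 2 ^+ n / 2 + A / 2 ^+ n / 2) ?lerD2r// -addrA -splitr.
  have k2 : y' + B / 2 ^+ n / 2 <= p.2 + B / 2 ^+ n.
    by rewrite [leRHS](_ : _ = p.2 + B / 2 ^+ n / 2 + B / 2 ^+ n / 2) ?lerD2r// -addrA -splitr.
  split=> //; split; rewrite ?(le_trans p1 h1) ?(le_trans k1 p2) ?(le_trans p3 h3)
    ?(le_trans k2 p4)//.
  apply: le_trans h5; rewrite [4 ^+ _]exprS invfM mulrA mulrAC.
  by rewrite ler_pM2r// invr_gt0.
pose q := fix q n := if n is m.+1 then sval (step m (q m)) else (x1, y1).
have qS n : P n (q n) -> [/\ P n.+1 (q n.+1),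
    (q n).1 <= (q n.+1).1, (q n.+1).1 + A / 2 ^+ n.+1 <= (q n).1 + A / 2 ^+ n,
    (q n).2 <= (q n.+1).2 & (q n.+1).2 + B / 2 ^+ n.+1 <= (q n).2 + B / 2 ^+ n].
  exact: (svalP (step n (q n))).
have Pq n : P n (q n).
  elim: n => [|n /qS[]//]; rewrite /P /= expr0 !divr1 /A /B !subrKC.
  by split=> //; rewrite divr1.
have nested (u : nat -> R) (L : R) : (forall n, u n <= u n.+1) ->
    (forall n, u n.+1 + L / 2 ^+ n.+1 <= u n + L / 2 ^+ n) -> 0 <= L ->
    exists X, forall n, u n <= X <= u n + L / 2 ^+ n.
  move=> u1 u2 L0; have Ln n : 0 <= L / 2 ^+ n by rewrite divr_ge0// exprn_ge0.
  have inc n m : u n <= u (n + m)%N.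
    by elim: m => [|m IH]; rewrite ?addn0// addnS (le_trans IH).
  have dec n m : u (n + m)%N + L / 2 ^+ (n + m) <= u n + L / 2 ^+ n.
    by elim: m => [|m IH]; rewrite ?addn0// addnS (le_trans (u2 _)).
  have ub n m : u m <= u n + L / 2 ^+ n.
    have [nm|/ltnW mn] := leqP n m.
      by rewrite -(subnKC nm) (le_trans _ (dec n (m - n)%N))// lerDl.
    by rewrite -(subnKC mn) (le_trans (inc m (n - m)%N))// lerDl.
  exists (sup (range u)) => n; apply/andP; split.
    apply: ub_le_sup; last by exists n.
    by exists (u 0%N + L / 2 ^+ 0) => _ [m _ <-].
  apply: ge_sup; first by exists (u 0%N); exists 0%N.
  by move=> _ [m _ <-].
have [X HX] : exists X, forall n, (q n).1 <= X <= (q n).1 + A / 2 ^+ n.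
  by apply: nested => // n; case: (qS n (Pq n)).
have [Y HY] : exists Y, forall n, (q n).2 <= Y <= (q n).2 + B / 2 ^+ n.
  by apply: nested => // n; case: (qS n (Pq n)).
pose p : C R := (X +i* Y)%C.
have Rp : rect x1 x2 y1 y2 p.
  rewrite /rect/=; have := HX 0%N; have := HY 0%N.
  by rewrite /= !expr0 !divr1 /A /B !subrKC => -> ->.
have [c cd] := df _ Rp.
pose S := A + B; have S0 : 0 <= S by rewrite addr_ge0.
pose e := eta / (4 * (S ^+ 2 + 1)).
have S1 : 0 < S ^+ 2 + 1 by rewrite ltr_wpDl ?sqr_ge0.
have e0 : 0 < e by rewrite divr_gt0// mulr_gt0.
have [d d0 Hd] := cd e e0.
have [n Sn] : exists n, S / 2 ^+ n < d.
  exists (Num.bound (S / d)); rewrite ltr_pdivrMr ?exprn_gt0// mulrC -ltr_pdivrMr//.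
  have SD : 0 <= S / d by rewrite divr_ge0// ltW.
  have := archi_boundP SD; move/lt_le_trans; apply.
  by rewrite -natrX ler_nat ltnW// ltn_expl.
have [q1 q2 q3 q4] := Pq n; set x := (q n).1 in q1 q2 *; set y := (q n).2 in q3 q4 *.
set An' := A / 2 ^+ n in q2 *; set Bn' := B / 2 ^+ n in q4 *.
have Sn' : An' + Bn' = S / 2 ^+ n by rewrite /An' /Bn' -mulrDl.
have near z : rect x (x + An') y (y + Bn') z -> cabs (z - p) <= S / 2 ^+ n.
  move=> /andP[/andP[z1 z2] /andP[z3 z4]]; rewrite (le_trans (cabs_le_ReIm _))//.
  rewrite -Sn' ReD ReN ImD ImN /= lerD// ler_norml.
    by have /andP := HX n; rewrite -/x -/An' => -[]; move: z1 z2; lra.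
  by have /andP := HY n; rewrite -/y -/Bn' => -[]; move: z3 z4; lra.
pose h z := f z + ((c * p - f p) + (- c) * z).
have xx : x <= x + An' by rewrite lerDl An. have yy : y <= y + Bn' by rewrite lerDl Bn.
have crn : ccont_on (rect_boundary x (x + An') y (y + Bn')) f.
  apply: (@ccont_onS _ (rect x1 x2 y1 y2)) => // z /rect_boundary_rect; exact: sub_rect.
have caff : ccont_on (rect_boundary x (x + An') y (y + Bn')) (fun z => (c * p - f p) + (- c) * z).
  apply: ccont_onD; first exact: ccont_on_cst.
  by apply: ccont_onM; [exact: ccont_on_cst|exact: ccont_on_id].
have Ih : rect_integral x (x + An') y (y + Bn') h = rect_integral x (x + An') y (y + Bn') f.
  by rewrite /h rect_integralD// rect_integral_affine// addr0.
rewrite -Ih => q5.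
have hb : cabs (rect_integral x (x + An') y (y + Bn') h) <=
    4 * (e * (S / 2 ^+ n)) * ((x + An' - x) + (y + Bn' - y)).
  apply: rect_integral_bound => //; first exact: ccont_onD.
  move=> z /rect_boundary_rect /near zp; rewrite /h.
  have -> : f z + (c * p - f p + - c * z) = f z - f p - c * (z - p) by ring.
  by rewrite (le_trans (Hd z (le_lt_trans zp Sn)))// ler_wpM2l// ltW.
have := le_trans q5 hb; rewrite ![_ + _ - _]addrAC !subrr !add0r Sn'.
have -> : 4 * (e * (S / 2 ^+ n)) * (S / 2 ^+ n) = 4 * e * S ^+ 2 / 4 ^+ n.
  have -> : 4 ^+ n = 2 ^+ n * 2 ^+ n :> R by rewrite -exprMn -natrM.
  by field; rewrite expf_neq0.
rewrite ler_pM2r ?invr_gt0 ?exprn_gt0// leNgt => /negP; apply.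
have -> : 4 * e * S ^+ 2 = eta * (S ^+ 2 / (S ^+ 2 + 1)).
  by rewrite /e; field; rewrite gt_eqF.
by rewrite gtr_pMr// ltr_pdivrMr// mul1r ltrDl.
Qed.

End Goursat.

(** * Cauchy's formula on a square *)

Section CauchyFormula.
Context {R : realType}.
Implicit Types (x y d : R) (f g psi : C R -> C R) (a w z : C R).

Lemma derivable_local f g z (e : R) : 0 < e ->
  (forall w, cabs (w - z) < e -> f w = g w) -> derivable f z 1 -> derivable g z 1.
Proof.
move=> e0 fg /derivable_cP[c cd]; apply/derivable_cP; exists c => k k0.
have [del del0 H] := cd k k0; exists (Num.min del e); first by rewrite lt_min del0.
move=> w; rewrite lt_min => /andP[w1 w2]; rewrite -!fg//; first exact: H.
by rewrite subrr cabs0.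
Qed.

Lemma derivable_quot f w z : z != w -> derivable f z 1 ->
  derivable (fun u => (f u - f w) / (u - w)) z 1.
Proof.
move=> zw df; have zw0 : z - w != 0 by rewrite subr_eq0.
have dz := @derivable_addcst R _ (- w) _ (@derivable_idc R z).
have dv := @derivable_invc R (fun u => u - w) z zw0 dz.
exact: (derivable_mulc (@derivable_addcst R _ (- f w) _ df) dv).
Qed.

(** A single exceptional point where the function is merely continuous does not
    affect Goursat's theorem: the four outer strips of a subdivision contribute
    nothing and the small square around the point shrinks. *)
Lemma goursat_except x1 x2 y1 y2 f w :
  x1 < Re w -> Re w < x2 -> y1 < Im w -> Im w < y2 ->
  ccont_on (rect x1 x2 y1 y2) f ->
  (forall z, rect x1 x2 y1 y2 z -> z != w -> derivable f z 1) ->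
  rect_integral x1 x2 y1 y2 f = 0.
Proof.
move=> xw1 xw2 yw1 yw2 cf df.
have Rw : rect x1 x2 y1 y2 w by rewrite /rect/= !ltW.
have [del del0 Hd] := cf w Rw 1 ltr01.
pose M := cabs (f w) + 1; have M0 : 0 < M by rewrite ltr_wpDl ?cabs_ge0.
apply/eqP; rewrite -cabs_eq0 eq_le cabs_ge0 andbT; apply/ler_addgt0Pr => e e0.
rewrite add0r; set s := Num.min (Num.min (Num.min (Re w - x1) (x2 - Re w))
  (Num.min (Im w - y1) (y2 - Im w))) (Num.min (del / 3) (e / (16 * M))).
have s0 : 0 < s by rewrite !lt_min !subr_gt0 xw1 xw2 yw1 yw2 !divr_gt0 ?mulr_gt0.
have : s <= s by [].
rewrite {2}/s !le_min => /andP[/andP[/andP[s1 s2] /andP[s3 s4]] /andP[s5 s6]].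
have gz u1 u2 v1 v2 : x1 <= u1 -> u1 <= u2 -> u2 <= x2 -> y1 <= v1 -> v1 <= v2 ->
    v2 <= y2 -> (forall z, rect u1 u2 v1 v2 z -> z != w) -> rect_integral u1 u2 v1 v2 f = 0.
  move=> h1 h2 h3 h4 h5 h6 h7; apply: goursat => // z Rz; apply/derivable_cP.
  by apply: df; [apply: sub_rect Rz|exact: h7].
have notw (P : C R -> Prop) : ~ P w -> forall z, P z -> z != w.
  by move=> nP z Pz; apply: contra_not_neq nP => <-.
rewrite (@rect_integral_vcut _ x1 (Re w - s) x2)//; try lra.
rewrite (gz x1 (Re w - s)) ?add0r; try lra; last first.
  by apply: notw; rewrite /rect/= => /andP[/andP[]]; lra.
rewrite (@rect_integral_vcut _ (Re w - s) (Re w + s) x2)//; try lra; last first.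
  by apply: ccont_onS cf; apply: sub_rect => //; lra.
rewrite (gz (Re w + s)) ?addr0; try lra; last first.
  by apply: notw; rewrite /rect/= => /andP[/andP[]]; lra.
rewrite (@rect_integral_hcut _ _ _ y1 (Im w - s) y2)//; try lra; last first.
  by apply: ccont_onS cf; apply: sub_rect => //; lra.
rewrite (gz _ _ y1 (Im w - s)) ?add0r; try lra; last first.
  by apply: notw; rewrite /rect/= => /andP[_ /andP[]]; lra.
rewrite (@rect_integral_hcut _ _ _ (Im w - s) (Im w + s) y2)//; try lra; last first.
  by apply: ccont_onS cf; apply: sub_rect => //; lra.
rewrite (gz _ _ (Im w + s)) ?addr0; try lra; last first.
  by apply: notw; rewrite /rect/= => /andP[_ /andP[]]; lra.
have sR : rect (Re w - s) (Re w + s) (Im w - s) (Im w + s) `<=` rect x1 x2 y1 y2.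
  by apply: sub_rect; lra.
apply: (@le_trans _ _ (4 * M * ((Re w + s - (Re w - s)) + (Im w + s - (Im w - s))))).
  apply: rect_integral_bound; try lra.
    by apply: ccont_onS cf => z /rect_boundary_rect /sR.
  move=> z /rect_boundary_rect Rz; have := cabsD (f z - f w) (f w); rewrite subrK.
  suff: cabs (f z - f w) <= 1 by rewrite /M; lra.
  apply: Hd; first exact: sR.
  rewrite (le_lt_trans (cabs_le_ReIm _))// ReD ReN ImD ImN.
  move: Rz => /andP[/andP[z1 z2] /andP[z3 z4]].
  have : `|Re z - Re w| <= s by rewrite ler_norml; lra.
  have : `|Im z - Im w| <= s by rewrite ler_norml; lra.
  by move: s5; rewrite ler_pdivlMr//; lra.
have -> : 4 * M * ((Re w + s - (Re w - s)) + (Im w + s - (Im w - s))) = s * (16 * M).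
  by ring.
by rewrite -ler_pdivlMr ?mulr_gt0.
Qed.

Definition square_integral a d f : C R :=
  rect_integral (Re a - 2 * d) (Re a + 2 * d) (Im a - 2 * d) (Im a + 2 * d) f.
Definition square a d : set (C R) :=
  rect (Re a - 2 * d) (Re a + 2 * d) (Im a - 2 * d) (Im a + 2 * d).
Definition square_boundary a d : set (C R) :=
  rect_boundary (Re a - 2 * d) (Re a + 2 * d) (Im a - 2 * d) (Im a + 2 * d).

Lemma square_near a d z : square a d z -> cabs (z - a) <= 4 * d.
Proof.
move=> /andP[/andP[z1 z2] /andP[z3 z4]]; rewrite (le_trans (cabs_le_ReIm _))//.
rewrite ReD ReN ImD ImN.
have : `|Re z - Re a| <= 2 * d by rewrite ler_norml; lra.
have : `|Im z - Im a| <= 2 * d by rewrite ler_norml; lra.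
lra.
Qed.

Lemma disc_coord a d w : cabs (w - a) <= d -> `|Re w - Re a| <= d /\ `|Im w - Im a| <= d.
Proof.
move=> h; split; rewrite (le_trans _ h)//.
  by have := Re_le_cabs (w - a); rewrite ReD ReN.
by have := Im_le_cabs (w - a); rewrite ImD ImN.
Qed.

Lemma square_boundary_far a d z w : 0 < d -> square_boundary a d z -> cabs (w - a) <= d ->
  d <= cabs (z - w).
Proof.
move=> d0 [Rz bz] /disc_coord[]; rewrite !ler_norml => /andP[w1 w2] /andP[w3 w4].
have hRe := Re_le_cabs (z - w); have hIm := Im_le_cabs (z - w).
rewrite ReD ReN ImD ImN in hRe hIm.
have := ler_norm (Re z - Re w); have := ler_norm (- (Re z - Re w)).
have := ler_norm (Im z - Im w); have := ler_norm (- (Im z - Im w)).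
rewrite !normrN => h1 h2 h3 h4.
by move: bz => /or4P[] /eqP e; rewrite ?e in h1 h2 h3 h4 hRe hIm *; lra.
Qed.

Lemma square_boundary_neq a d z w : 0 < d -> square_boundary a d z -> cabs (w - a) <= d ->
  z - w != 0.
Proof.
by move=> d0 h1 h2; rewrite -cabs_gt0 (lt_le_trans d0)// (square_boundary_far d0 h1).
Qed.

Lemma square_boundary_cont_inv a d w : 0 < d -> cabs (w - a) <= d ->
  ccont_on (square_boundary a d) (fun z => (z - w)^-1).
Proof.
move=> d0 wa; apply: ccont_onV; last by move=> z bz; exact: square_boundary_neq bz wa.
by apply: ccont_onD; [exact: ccont_on_id|exact: ccont_on_cst].
Qed.

Lemma cauchy_formula a d f w : 0 < d -> cabs (w - a) <= d ->
  (forall z, cabs (z - a) <= 4 * d -> derivable f z 1) ->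
  square_integral a d (fun z => f z / (z - w)) = f w * square_integral a d (fun z => (z - w)^-1).
Proof.
move=> d0 wa df; have [/[!ler_norml] w1 w2] := disc_coord wa.
have dfw : derivable f w 1 by apply: df; rewrite (le_trans wa)//; lra.
have /derivable_cP[c cd] := dfw.
pose g z := if z == w then c else (f z - f w) / (z - w).
have gd z : square a d z -> z != w -> derivable g z 1.
  move=> Rz zw; have := derivable_quot zw (df z (square_near Rz)).
  apply: (@derivable_local _ _ _ (cabs (z - w))); first by rewrite cabs_gt0 subr_eq0.
  move=> u uz; rewrite /g ifN//; apply: contraTneq uz => ->.
  by rewrite cdistC ltxx.
have gc : ccont_on (square a d) g.
  move=> z Rz; have [->|zw] := eqVneq z w; last first.
    move=> e e0; have : ccont_on (square a d `&` [set u | u != w]) g.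
      by apply: cdiff_cont_on => u [Ru uw]; apply/derivable_cP; exact: gd.
    move=> /(_ z (conj Rz zw) e e0)[del del0 H].
    exists (Num.min del (cabs (z - w))).
      by rewrite lt_min del0 cabs_gt0 subr_eq0.
    move=> u Ru; rewrite lt_min => /andP[u1 u2]; apply: H => //; split => //=.
    by apply: contraTneq u2 => ->; rewrite cdistC ltxx.
  move=> e e0; have [del del0 H] := cd e e0; exists del => // u Ru uw.
  rewrite /g eqxx; case: eqVneq => [_|nuw]; first by rewrite subrr cabs0 ltW.
  have uw0 : u - w != 0 by rewrite subr_eq0.
  have -> : (f u - f w) / (u - w) - c = (f u - f w - c * (u - w)) / (u - w) by field.
  by rewrite cabsf ler_pdivrMr ?cabs_gt0// H.
have I0 : square_integral a d g = 0.
  by apply: (@goursat_except _ _ _ _ g w) => //; lra.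
have x12 : Re a - 2 * d <= Re a + 2 * d by lra.
have y12 : Im a - 2 * d <= Im a + 2 * d by lra.
have cfi : ccont_on (square_boundary a d) (fun z => f z / (z - w)).
  apply: ccont_onM; last exact: square_boundary_cont_inv.
  by apply: cdiff_cont_on => z /rect_boundary_rect/square_near/df/derivable_cP.
have ci := square_boundary_cont_inv d0 wa.
have E : square_integral a d (fun z => f z / (z - w) + (- f w) * (z - w)^-1) = 0.
  rewrite -I0; apply: eq_rect_integral => // z bz.
  have zw0 := square_boundary_neq d0 bz wa.
  have zw : z != w by rewrite -subr_eq0.
  by rewrite /g (negbTE zw) mulrBl mulNr.
move: E; rewrite /square_integral rect_integralD//;
  last by apply: ccont_onM => //; exact: ccont_on_cst.
by rewrite rect_integralZ// mulNr => /eqP; rewrite subr_eq0 => /eqP.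
Qed.

Lemma Im_inv z : Im z^-1 = - Im z / cabs z ^+ 2.
Proof. by rewrite cabs_sqr; case: z => u v /=; rewrite mulNr. Qed.

Lemma Re_inv z : Re z^-1 = Re z / cabs z ^+ 2.
Proof. by rewrite cabs_sqr; case: z => u v. Qed.

(** The winding integral: each side contributes a positive imaginary part. *)
Lemma winding_lower a d w : 0 < d -> cabs (w - a) <= d ->
  1 / 2 <= cabs (square_integral a d (fun z => (z - w)^-1)).
Proof.
move=> d0 wa; have [/[!ler_norml] w1 w2] := disc_coord wa.
have x12 : Re a - 2 * d <= Re a + 2 * d by lra.
have y12 : Im a - 2 * d <= Im a + 2 * d by lra.
rewrite (le_trans _ (Im_le_cabs _))// (le_trans _ (ler_norm _))//.
have ci := square_boundary_cont_inv d0 wa.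
have [s1 s2 s3 s4] := rect_integral_scont x12 y12 ci.
have kk : 1 / 2 <= (1 / (9 * d)) * (4 * d) + (1 / (9 * d)) * (4 * d).
  have -> : (1 / (9 * d)) * (4 * d) + (1 / (9 * d)) * (4 * d) = 8 / 9.
    by field; rewrite gt_eqF.
  lra.
have sq z : square_boundary a d z -> cabs (z - w) ^+ 2 <= 18 * d ^+ 2.
  move=> /rect_boundary_rect/andP[/andP[z1 z2] /andP[z3 z4]]; rewrite cabs_sqr ReD ImD ReN ImN.
  have h1 : `|Re z - Re w| <= 3 * d by rewrite ler_norml; lra.
  have h2 : `|Im z - Im w| <= 3 * d by rewrite ler_norml; lra.
  have k1 : (Re z - Re w) ^+ 2 <= (3 * d) ^+ 2.
    by rewrite -real_normK ?num_real// lerXn2r ?nnegrE//; lra.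
  have k2 : (Im z - Im w) ^+ 2 <= (3 * d) ^+ 2.
    by rewrite -real_normK ?num_real// lerXn2r ?nnegrE//; lra.
  by move: k1 k2; rewrite !exprMn; lra.
have lo (t : R) z : square_boundary a d z -> d <= t -> 1 / (18 * d) <= t / cabs (z - w) ^+ 2.
  move=> bz dt; have p0 : 0 < cabs (z - w) ^+ 2.
    by rewrite exprn_gt0// cabs_gt0 (square_boundary_neq d0 bz wa).
  rewrite ler_pdivlMr// mulrC mulrA mulr1 ler_pdivrMr ?mulr_gt0//.
  rewrite (le_trans (sq z bz))// expr2 mulrCA ler_wpM2r//; lra.
have h18 : 1 / (9 * d) = 1 / (18 * d) + 1 / (18 * d).
  by field; rewrite gt_eqF.
have hor y x : y = Im a - 2 * d \/ y = Im a + 2 * d ->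
    Re a - 2 * d <= x <= Re a + 2 * d -> square_boundary a d (x +i* y)%C.
  move=> ye xab; split; rewrite /= /rect/= ?xab/=.
    by case: ye => ->; rewrite lexx y12.
  by case: ye => ->; rewrite eqxx ?orbT.
have ver x y : x = Re a - 2 * d \/ x = Re a + 2 * d ->
    Im a - 2 * d <= y <= Im a + 2 * d -> square_boundary a d (x +i* y)%C.
  move=> ye xab; split; rewrite /= /rect/= ?xab/= ?andbT.
    by case: ye => ->; rewrite lexx x12.
  by case: ye => ->; rewrite eqxx ?orbT.
rewrite /square_integral /rect_integral ImD (le_trans kk)// lerD//.
  have -> : 4 * d = (Re a + 2 * d) - (Re a - 2 * d) by ring.
  apply: Im_seg_integral_ge => //; first exact: scontB.
  move=> x xab; rewrite ImD ImN !Im_inv h18 lerD//; [|rewrite mulNr opprK];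
    apply: lo; rewrite ?ImD ?ImN /=; try lra; by apply: hor => //; by [left|right].
have -> (u : C R) : Im ((0 +i* 1)%C * u) = Re u.
  by case: u => u1 u2 /=; rewrite mul0r mul1r add0r.
have -> : 4 * d = (Im a + 2 * d) - (Im a - 2 * d) by ring.
apply: Re_seg_integral_ge => //; first exact: scontB.
move=> y yab; rewrite ReD ReN !Re_inv h18 lerD//; [|rewrite -mulNr];
  apply: lo; rewrite ?ReD ?ReN /=; try lra; by apply: ver => //; by [left|right].
Qed.

End CauchyFormula.

(** * Removable singularities of difference quotients *)

Section LocalQuotient.
Context {R : realType}.
Implicit Types (d P M : R) (f g psi : C R -> C R) (a w z : C R).

Definition cauchy_integral a d psi w : C R := square_integral a d (fun z => psi z / (z - w)).

Lemma sq_wf (t d : R) : 0 < d -> t - 2 * d <= t + 2 * d.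
Proof. lra. Qed.

Lemma square_integral_bound a d f M : 0 < d -> ccont_on (square_boundary a d) f ->
  (forall z, square_boundary a d z -> cabs (f z) <= M) ->
    cabs (square_integral a d f) <= 32 * M * d.
Proof.
move=> d0 cf fM; rewrite (le_trans (rect_integral_bound _ _ cf fM)) ?sq_wf// /square_integral.
by rewrite le_eqVlt; apply/orP; left; apply/eqP; ring.
Qed.

Lemma cauchy_integral_cont a d psi w : 0 < d -> ccont_on (square_boundary a d) psi ->
  cabs (w - a) <= d ->
  ccont_on (square_boundary a d) (fun z => psi z / (z - w)).
Proof. by move=> d0 cp wa; apply: ccont_onM => //; exact: square_boundary_cont_inv. Qed.

Lemma cabs_div_le (u v : C R) P d : 0 < d -> cabs u <= P -> d <= cabs v -> cabs (u / v) <= P / d.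
Proof.
move=> d0 uP dv; rewrite cabsf ler_pM ?cabs_ge0 ?invr_ge0 ?cabs_ge0//.
by rewrite lef_pV2 ?posrE// (lt_le_trans d0).
Qed.

Lemma cauchy_integral_bound a d psi P w : 0 < d -> ccont_on (square_boundary a d) psi ->
  (forall z, square_boundary a d z -> cabs (psi z) <= P) -> cabs (w - a) <= d ->
  cabs (cauchy_integral a d psi w) <= 32 * P.
Proof.
move=> d0 cp pP wa.
have := @square_integral_bound a d (fun z => psi z / (z - w)) (P / d) d0
  (cauchy_integral_cont d0 cp wa).
rewrite -mulrA divfK ?gt_eqF//; apply=> z bz.
by apply: cabs_div_le => //; [exact: pP|exact: square_boundary_far bz wa].
Qed.

Lemma cauchy_integral_diff a d psi w w' : 0 < d -> ccont_on (square_boundary a d) psi ->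
  cabs (w - a) <= d -> cabs (w' - a) <= d ->
  cauchy_integral a d psi w' - cauchy_integral a d psi w =
  (w' - w) * cauchy_integral a d (fun z => psi z / (z - w)) w'.
Proof.
move=> d0 cp wa wa'; rewrite /cauchy_integral /square_integral.
have c1 := cauchy_integral_cont d0 cp wa; have c1' := cauchy_integral_cont d0 cp wa'.
rewrite -(@rect_integralZ _ _ _ _ _ (w' - w)) ?sq_wf//; last exact: cauchy_integral_cont c1 wa'.
rewrite -[- rect_integral _ _ _ _ _]mulN1r -rect_integralZ ?sq_wf// -rect_integralD ?sq_wf//;
  last first.
  by apply: ccont_onM c1; exact: ccont_on_cst.
apply: eq_rect_integral; rewrite ?sq_wf// => z bz.
have zw := square_boundary_neq d0 bz wa; have zw' := square_boundary_neq d0 bz wa'.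
by field; rewrite zw zw'.
Qed.

Lemma cauchy_integral_lip a d psi P w w' : 0 < d -> ccont_on (square_boundary a d) psi ->
  (forall z, square_boundary a d z -> cabs (psi z) <= P) -> cabs (w - a) <= d ->
    cabs (w' - a) <= d ->
  cabs (cauchy_integral a d psi w' - cauchy_integral a d psi w) <= 32 * (P / d) * cabs (w' - w).
Proof.
move=> d0 cp pP wa wa'; rewrite cauchy_integral_diff// cabsM mulrC ler_wpM2r ?cabs_ge0//.
apply: cauchy_integral_bound => //; first exact: cauchy_integral_cont.
by move=> z bz; apply: cabs_div_le => //; [exact: pP|exact: square_boundary_far bz wa].
Qed.

Lemma cauchy_integral_derivable a d psi P w : 0 < d -> ccont_on (square_boundary a d) psi ->
  (forall z, square_boundary a d z -> cabs (psi z) <= P) -> cabs (w - a) < d ->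
  derivable (cauchy_integral a d psi) w 1.
Proof.
move=> d0 cp pP wa; apply/derivable_cP.
exists (cauchy_integral a d (fun z => psi z / (z - w)) w) => e e0.
have [c1 wa'] := (cauchy_integral_cont d0 cp (ltW wa), ltW wa).
pose L := 32 * ((P / d) / d); pose k := e / (`|L| + 1).
have L1 : 0 < `|L| + 1 by rewrite ltr_wpDl.
have k0 : 0 < k by rewrite divr_gt0.
exists (Num.min (d - cabs (w - a)) k); first by rewrite lt_min subr_gt0 wa.
move=> u; rewrite lt_min => /andP[u1 u2].
have ua : cabs (u - a) <= d by have := cdistD w u a; move: u1; lra.
rewrite cauchy_integral_diff// mulrC -mulrBl cabsM ler_wpM2r ?cabs_ge0//.
have h : cabs (cauchy_integral a d (fun z => psi z / (z - w)) u -
    cauchy_integral a d (fun z => psi z / (z - w)) w) <= L * cabs (u - w).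
  apply: cauchy_integral_lip => // z bz.
  by apply: cabs_div_le => //; [exact: pP|exact: square_boundary_far bz wa'].
rewrite (le_trans h)// (le_trans (ler_wpM2r (cabs_ge0 _) (ler_norm L)))//.
rewrite (@le_trans _ _ ((`|L| + 1) * cabs (u - w)))//.
  by rewrite ler_wpM2r ?cabs_ge0// lerDl.
by rewrite mulrC -ler_pdivlMr// ltW.
Qed.

(** Removable singularity with bounds: near [a] the difference quotient of [f] at
    [a] is [N psi / N 1], where [psi] is that quotient on the boundary of a square
    and [N] the Cauchy integral over it; so it is holomorphic and Lipschitz with
    constants depending only on the size of the square. *)
Lemma local_quotient d : 0 < d -> exists2 K : R, 0 < K & forall a f M,
  (forall z, cabs (z - a) <= 4 * d -> derivable f z 1 /\ cabs (f z) <= M) ->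
  exists g, forall w, cabs (w - a) < d ->
    [/\ f w - f a = (w - a) * g w, derivable g w 1, cabs (g w) <= K * M &
        forall w', cabs (w' - a) < d -> cabs (g w' - g w) <= K * M * cabs (w' - w)].
Proof.
move=> d0; pose K1 := 64 / d; pose K2 := 64 * (65 / d ^+ 2).
have K10 : 0 < K1 by rewrite divr_gt0. have K20 : 0 < K2 by rewrite !mulr_gt0 ?invr_gt0 ?exprn_gt0.
exists (K1 + K2) => [|a f M fM]; first by rewrite addr_gt0.
have aa : cabs (a - a) <= d by rewrite subrr cabs0 ltW.
have a4 : cabs (a - a) <= 4 * d by move: aa; lra.
have M0 : 0 <= M by rewrite (le_trans (cabs_ge0 (f a)))//; have [] := fM a a4.
have df z : cabs (z - a) <= 4 * d -> derivable f z 1 by move=> /fM[].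
pose F z := f z + (- f a).
have dF z : cabs (z - a) <= 4 * d -> derivable F z 1.
  by move=> /df; exact: (@derivable_addcst R f (- f a) z).
have cF : ccont_on (square_boundary a d) F.
  by apply: cdiff_cont_on => z /rect_boundary_rect/square_near/dF/derivable_cP.
pose psi z := F z / (z - a).
have cpsi : ccont_on (square_boundary a d) psi by exact: cauchy_integral_cont.
pose P := M / d.
have psiP z : square_boundary a d z -> cabs (psi z) <= P.
  move=> bz; have za : 2 * d <= cabs (z - a).
    have := bz; case=> _ /or4P e.
    have := Re_le_cabs (z - a); have := Im_le_cabs (z - a).
    rewrite ReD ReN ImD ImN; have := ler_norm (Re z - Re a); have := ler_norm (- (Re z - Re a)).
    have := ler_norm (Im z - Im a); have := ler_norm (- (Im z - Im a)).
    by rewrite !normrN => h1 h2 h3 h4 h5 h6;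
      case: e => /eqP e; rewrite ?e in h1 h2 h3 h4 h5 h6; lra.
  have -> : P = (2 * M) / (2 * d) by rewrite /P; field; rewrite gt_eqF.
  apply: cabs_div_le za; first by rewrite mulr_gt0.
  rewrite (le_trans (cabsB _ _))//.
  have [_ h1] := fM z (square_near (rect_boundary_rect bz)); have [_ h2] := fM a a4.
  by move: h1 h2; lra.
have P0 : 0 <= P by rewrite divr_ge0// ltW.
pose N := cauchy_integral a d psi; pose c := cauchy_integral a d (fun _ => 1).
have c1 : ccont_on (square_boundary a d) (fun _ : C R => 1 : C R) by exact: ccont_on_cst.
have one z : square_boundary a d z -> cabs ((fun _ : C R => 1 : C R) z) <= 1 by rewrite cabs1.
have cE w : c w = square_integral a d (fun z => (z - w)^-1).
  by apply: eq_rect_integral; rewrite ?sq_wf// => z _; rewrite mul1r.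
have c12 w : cabs (w - a) <= d -> 1 / 2 <= cabs (c w).
  by move=> wa; rewrite cE winding_lower.
have cn0 w : cabs (w - a) <= d -> c w != 0.
  by move=> /c12 h; rewrite -cabs_gt0; lra.
have key w : cabs (w - a) <= d -> F w * c w = square_integral a d psi + (w - a) * N w.
  move=> wa; rewrite cE -cauchy_formula//.
  rewrite /N /cauchy_integral /square_integral -rect_integralZ ?sq_wf//;
    last exact: cauchy_integral_cont.
  rewrite -rect_integralD ?sq_wf//; last first.
    by apply: ccont_onM; [exact: ccont_on_cst|exact: cauchy_integral_cont].
  apply: eq_rect_integral; rewrite ?sq_wf// => z bz.
  have zw := square_boundary_neq d0 bz wa; have za := square_boundary_neq d0 bz aa.
  by rewrite /psi; field; rewrite zw za.
have I0 : square_integral a d psi = 0.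
  by have := key a aa; rewrite subrr mul0r addr0 /F subrr mul0r.
exists (fun w => N w / c w) => w wa; have wa' := ltW wa.
have Nb u : cabs (u - a) <= d -> cabs (N u) <= 32 * P.
  by move=> ua; apply: cauchy_integral_bound.
have inv2 u : cabs (u - a) <= d -> (cabs (c u))^-1 <= 2.
  move=> ua; have h := c12 u ua; rewrite -[2]invrK lef_pV2 ?posrE ?invr_gt0//; first by lra.
  by rewrite (lt_le_trans _ h)// divr_gt0.
split.
- have := key w wa'; rewrite I0 add0r => e; have := cn0 w wa' => c0.
  by rewrite mulrA -e mulfK.
- have dN := cauchy_integral_derivable d0 cpsi psiP wa.
  have dc := cauchy_integral_derivable d0 c1 one wa.
  exact: (derivable_mulc dN (@derivable_invc R c w (cn0 w wa') dc)).
- rewrite cabsf (@le_trans _ _ (32 * P * 2))//.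
    by rewrite ler_pM ?cabs_ge0 ?invr_ge0 ?cabs_ge0 ?Nb ?inv2.
  have -> : 32 * P * 2 = K1 * M by rewrite /P /K1; field; rewrite gt_eqF.
  by rewrite ler_wpM2r// lerDl ltW.
- move=> w' /ltW wa2.
  have -> : N w' / c w' - N w / c w =
      (N w' - N w) / c w' + N w * ((c w - c w') / (c w' * c w)).
    by field; rewrite !cn0.
  have b1 : cabs (N w' - N w) <= 32 * (P / d) * cabs (w' - w) by exact: cauchy_integral_lip.
  have b2 : cabs (c w - c w') <= 32 * (1 / d) * cabs (w' - w).
    by rewrite cdistC; apply: cauchy_integral_lip.
  have D0 := cabs_ge0 (w' - w).
  have t1 : cabs ((N w' - N w) / c w') <= 32 * (P / d) * cabs (w' - w) * 2.
    by rewrite cabsf ler_pM ?cabs_ge0 ?invr_ge0 ?cabs_ge0 ?inv2.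
  have t2 : cabs (N w * ((c w - c w') / (c w' * c w))) <=
      32 * P * (32 * (1 / d) * cabs (w' - w) * (2 * 2)).
    rewrite cabsM ler_pM ?cabs_ge0 ?Nb// cabsf cabsM invfM.
    by rewrite ler_pM ?mulr_ge0 ?cabs_ge0 ?invr_ge0 ?cabs_ge0// ler_pM ?invr_ge0 ?cabs_ge0 ?inv2.
  rewrite (le_trans (cabsD _ _))// (le_trans (lerD t1 t2))//.
  have -> : 32 * (P / d) * cabs (w' - w) * 2 + 32 * P * (32 * (1 / d) * cabs (w' - w) * (2 * 2))
     = K2 * M * cabs (w' - w) by rewrite /P /K2; field; rewrite gt_eqF.
  by rewrite ler_wpM2r// ler_wpM2r// lerDr ltW.
Qed.

End LocalQuotient.

(** * The algebra of little Lipschitz holomorphic functions *)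

Section LipAlgebra.
Context {R : realType}.
Context (alpha : R) (U : set (C R)) (T : R).
Context (alpha_gt0 : 0 < alpha) (alpha_lt1 : alpha < 1).
Context (U_open : open U) (U_ne : U !=set0).
Context (T_gt0 : 0 < T) (U_T : forall z, U z -> cabs z <= T).
Implicit Types (f g : C R -> C R) (z w a : C R) (k : R).

Definition lip k f := forall z w, U z -> U w -> cabs (f z - f w) <= k * cabs (z - w) `^ alpha.

Definition little f := forall e : R, 0 < e -> exists2 del : R, 0 < del &
  forall z w, U z -> U w -> cabs (z - w) < del ->
    cabs (f z - f w) <= e * cabs (z - w) `^ alpha.

Lemma quotient_le k f z w : 0 < cabs (z - w) ->
  (lip_quotient alpha f z w <= k) = (cabs (f z - f w) <= k * cabs (z - w) `^ alpha).
Proof. by move=> zw; rewrite /lip_quotient ler_pdivrMr ?powR_gt0. Qed.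

Lemma diff_same f z : cabs (f z - f z) = 0.
Proof. by rewrite subrr cabs0. Qed.

Lemma kappa_leP k f : (kappa U alpha f <= k%:E)%E <->
  (forall z w, U z -> U w -> z != w -> cabs (f z - f w) <= k * cabs (z - w) `^ alpha).
Proof.
split=> [h z w Uz Uw zw|h].
  rewrite -quotient_le ?cabs_gt0 ?subr_eq0// -lee_fin (le_trans _ h)//.
  by apply: ereal_sup_ubound; exists z, w.
apply: ge_ereal_sup => _ [z [w [Uz Uw zw ->]]].
by rewrite lee_fin quotient_le ?cabs_gt0 ?subr_eq0// h.
Qed.

Lemma lipP k f : 0 <= k -> (kappa U alpha f <= k%:E)%E <-> lip k f.
Proof.
move=> k0; split=> [/kappa_leP h z w Uz Uw|h]; last by apply/kappa_leP => *; exact: h.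
by have [->|] := eqVneq z w; [rewrite diff_same mulr_ge0 ?powR_ge0|exact: h].
Qed.

Lemma U_close z (e : R) : U z -> 0 < e -> exists2 w, U w & 0 < cabs (z - w) < e.
Proof.
move=> Uz e0; have /open_cP/(_ z Uz)[del del0 H] := U_open.
pose t := Num.min e del / 2; have t0 : 0 < t by rewrite divr_gt0// lt_min e0.
have tm : t < Num.min e del by rewrite /t ltr_pdivrMr// ltr_pMr ?ltr1n// lt_min e0.
exists (z + rc t); first by apply: H; rewrite addrC addKr cabs_rc gtr0_norm//
  (lt_le_trans tm)// ge_min lexx orbT.
by rewrite cdistC addrC addKr cabs_rc gtr0_norm// t0 (lt_le_trans tm)// ge_min lexx.
Qed.

Lemma littleP f : local_kappa U alpha f delta @[delta --> 0^'+] --> 0%E <-> little f.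
Proof.
split=> [h e e0|h].
  have /h : nbhs (0%E : \bar R) [set x | (x < e%:E)%E].
    by exists e => //= x; rewrite /ball_/= sub0r normrN lte_fin; exact: le_lt_trans (ler_norm x).
  move=> /nbhs_ballP[del /= del0 H].
  exists (del / 2); first by rewrite divr_gt0.
  move=> z w Uz Uw zw; have [->|nzw] := eqVneq z w.
    by rewrite diff_same mulr_ge0 ?powR_ge0// ltW.
  have zw0 : 0 < cabs (z - w) by rewrite cabs_gt0 subr_eq0.
  rewrite -quotient_le// -lee_fin; apply/ltW; apply: le_lt_trans (H (del / 2) _ _); last first.
  - by rewrite /= divr_gt0.
  - rewrite /ball/= sub0r normrN gtr0_norm ?divr_gt0//.
    by rewrite ltr_pdivrMr// ltr_pMr// ltr1n.
  - by apply: ereal_sup_ubound; exists z, w; rewrite zw zw0.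
move=> A [e /= e0 sA]; have e2 : 0 < e / 2 by rewrite divr_gt0.
have [del del0 H] := h _ e2; apply/nbhs_ballP; exists del => // t.
rewrite /ball/= sub0r normrN => td t0; rewrite gtr0_norm// in td.
have up : (local_kappa U alpha f t <= (e / 2)%:E)%E.
  apply: ge_ereal_sup => _ [z [w [Uz Uw /andP[zw0 zw] ->]]].
  by rewrite lee_fin quotient_le// H// (lt_trans zw).
have lo : (0 <= local_kappa U alpha f t)%E.
  have [z Uz] := U_ne; have [w Uw zw] := U_close Uz t0.
  apply: (@le_trans _ _ (lip_quotient alpha f z w)%:E); last first.
    by apply: ereal_sup_ubound; exists z, w.
  by rewrite lee_fin divr_ge0 ?cabs_ge0 ?powR_ge0.
move: up lo; rewrite /preimage/=; case: (local_kappa _ _ _ _) => [r| |]//.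
rewrite !lee_fin => r1 r0; apply: sA; rewrite /ball_/= sub0r normrN ger0_norm//.
by rewrite (le_lt_trans r1)// ltr_pdivrMr// ltr_pMr// ltr1n.
Qed.

Lemma A_P f : A_ U alpha f <-> [/\ holomorphic_on U f, exists2 k, 0 <= k & lip k f & little f].
Proof.
split=> [[h1 h2 /littleP h3]|[h1 [k k0 /lipP h2] /littleP h3]]; last first.
  by split=> //; rewrite (le_lt_trans (h2 k0)) ?ltry.
split=> //; move: h2; case e : (kappa U alpha f) => [r| |]// _.
  exists (Num.max r 0); first by rewrite le_max lexx orbT.
  by apply/lipP; rewrite ?e ?lee_fin ?le_max ?lexx ?orbT.
by exists 0 => //; apply/lipP => //; rewrite e leNye.
Qed.

Lemma U_diam z w : U z -> U w -> cabs (z - w) <= 2 * T.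
Proof. by move=> /U_T h1 /U_T h2; have := cabsB z w; lra. Qed.

Lemma powR_le (s x y : R) : 0 <= s -> 0 <= x -> x <= y -> x `^ s <= y `^ s.
Proof. by move=> s0 x0 xy; apply: ge0_ler_powR; rewrite ?nnegrE// (le_trans x0). Qed.

Lemma lip_bounded f k : 0 <= k -> lip k f -> exists B, forall z, U z -> cabs (f z) <= B.
Proof.
move=> k0 fk; have [z0 Uz0] := U_ne.
exists (cabs (f z0) + k * (2 * T) `^ alpha) => z Uz.
have := cabsD (f z - f z0) (f z0); rewrite subrK.
have := fk z z0 Uz Uz0.
have : k * cabs (z - z0) `^ alpha <= k * (2 * T) `^ alpha.
  by rewrite ler_wpM2l// powR_le ?cabs_ge0 ?U_diam// ltW.
lra.
Qed.

Lemma A_bounded f : A_ U alpha f -> exists B, forall z, U z -> cabs (f z) <= B.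
Proof. by move=> /A_P[_ [k k0 fk] _]; exact: lip_bounded fk. Qed.

(** For a bounded function the little condition suffices: it gives the Lipschitz
    bound for close points, boundedness gives it for the others. *)
Lemma A_mk f B : holomorphic_on U f -> (forall z, U z -> cabs (f z) <= B) ->
  little f -> A_ U alpha f.
Proof.
move=> hf fB lf; apply/A_P; split=> //.
have [del del0 H] := lf 1 ltr01; have [z0 Uz0] := U_ne.
have B0 : 0 <= B := le_trans (cabs_ge0 _) (fB z0 Uz0).
have d1 : 0 < del `^ alpha by rewrite powR_gt0.
exists (1 + 2 * B / del `^ alpha).
  by rewrite addr_ge0// divr_ge0 ?mulr_ge0// ltW.
move=> z w Uz Uw; have P0 : 0 <= cabs (z - w) `^ alpha by exact: powR_ge0.
have [zw|zw] := ltP (cabs (z - w)) del.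
  by rewrite (le_trans (H z w Uz Uw zw))// ler_wpM2r// lerDl divr_ge0 ?mulr_ge0// ltW.
rewrite (le_trans (cabsB _ _))// (@le_trans _ _ (2 * B))//.
  by have := fB z Uz; have := fB w Uw; lra.
have q : 2 * B <= 2 * B / del `^ alpha * cabs (z - w) `^ alpha.
  rewrite mulrAC ler_pdivlMr// ler_wpM2l ?mulr_ge0//.
  by apply: powR_le => //; exact: ltW.
by apply: (le_trans q); rewrite ler_wpM2r// lerDr.
Qed.

Lemma powR_split (s x : R) : 0 <= x -> 0 < s -> s < 1 -> x = x `^ (1 - s) * x `^ s.
Proof.
move=> x0 s0 s1; rewrite -powRD ?subrK ?powRr1//.
by apply/implyP => /eqP h; exfalso; lra.
Qed.

Lemma powR_lt_eps (s e : R) : 0 < s -> 0 < e -> exists2 del : R, 0 < del &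
  forall x, 0 <= x -> x < del -> x `^ s <= e.
Proof.
move=> s0 e0; exists (e `^ s^-1); first by rewrite powR_gt0.
move=> x x0 /ltW xd; have := powR_le (ltW s0) x0 xd.
by rewrite -powRrM mulVf ?gt_eqF// powRr1// ltW.
Qed.

Lemma little_of_exponent f (beta L : R) : alpha < beta ->
  (forall z w, U z -> U w -> cabs (f z - f w) <= L * cabs (z - w) `^ beta) -> little f.
Proof.
move=> ab H e e0; have L1 : 0 < `|L| + 1 by rewrite ltr_wpDl.
have ba : 0 < beta - alpha by rewrite subr_gt0.
have [del del0 Hd] := powR_lt_eps ba (divr_gt0 e0 L1).
exists del => // z w Uz Uw zw; have z0 := cabs_ge0 (z - w).
rewrite (le_trans (H z w Uz Uw))//.
have -> : cabs (z - w) `^ beta = cabs (z - w) `^ (beta - alpha) * cabs (z - w) `^ alpha.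
  by rewrite -powRD ?subrK// gt_eqF// (lt_trans alpha_gt0).
rewrite mulrA ler_wpM2r ?powR_ge0//.
rewrite (@le_trans _ _ ((`|L| + 1) * cabs (z - w) `^ (beta - alpha)))//.
  by rewrite ler_wpM2r ?powR_ge0// (le_trans (ler_norm L))// lerDl.
by rewrite mulrC -ler_pdivlMr// Hd.
Qed.

Lemma little_of_lipschitz f L :
  (forall z w, U z -> U w -> cabs (f z - f w) <= L * cabs (z - w)) -> little f.
Proof.
move=> H; apply: (@little_of_exponent _ 1 L) => // z w Uz Uw.
by rewrite powRr1 ?cabs_ge0 ?H.
Qed.

Lemma A_const c : A_ U alpha (fun _ => c).
Proof.
apply: (@A_mk _ (cabs c)) => [z _|//|]; first exact: derivable_constc.
by apply: (@little_of_lipschitz _ 0) => z w _ _; rewrite subrr cabs0 mul0r.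
Qed.

Lemma A_id : A_ U alpha (fun z => z).
Proof.
apply: (@A_mk _ T) => [z _|//|]; first exact: derivable_idc.
by apply: (@little_of_lipschitz _ 1) => z w _ _; rewrite mul1r.
Qed.

Lemma little_add f g : little f -> little g -> little (fun z => f z + g z).
Proof.
move=> h1 h2 e e0; have e2 : 0 < e / 2 by rewrite divr_gt0.
have [d1 d10 H1] := h1 _ e2; have [d2 d20 H2] := h2 _ e2.
exists (Num.min d1 d2); first by rewrite lt_min d10.
move=> z w Uz Uw; rewrite lt_min => /andP[zw1 zw2].
rewrite opprD addrACA (le_trans (cabsD _ _))// (splitr e) mulrDl lerD//; first exact: H1.
exact: H2.
Qed.

Lemma little_mul f g B : 0 <= B -> (forall z, U z -> cabs (f z) <= B) ->
  (forall z, U z -> cabs (g z) <= B) -> little f -> little g -> little (fun z => f z * g z).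
Proof.
move=> B0 fB gB h1 h2 e e0; pose k := e / (2 * B + 1).
have B1 : 0 < 2 * B + 1 by lra.
have k0 : 0 < k by rewrite divr_gt0.
have [d1 d10 H1] := h1 _ k0; have [d2 d20 H2] := h2 _ k0.
exists (Num.min d1 d2); first by rewrite lt_min d10.
move=> z w Uz Uw; rewrite lt_min => /andP[zw1 zw2].
have -> : f z * g z - f w * g w = f z * (g z - g w) + g w * (f z - f w) by ring.
set P := _ `^ alpha; have P0 : 0 <= P by exact: powR_ge0.
rewrite (le_trans (cabsD _ _))// (@le_trans _ _ (B * (k * P) + B * (k * P)))//.
  by rewrite !cabsM lerD// ler_pM ?cabs_ge0 ?fB ?gB ?H1 ?H2.
have -> : B * (k * P) + B * (k * P) = (k * (2 * B)) * P by ring.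
rewrite ler_wpM2r// /k mulrAC ler_pdivrMr// ler_wpM2l//; first exact: ltW.
by rewrite lerDl.
Qed.

Lemma A_add f g : A_ U alpha f -> A_ U alpha g -> A_ U alpha (fun z => f z + g z).
Proof.
move=> Af Ag; have [B1 HB1] := A_bounded Af; have [B2 HB2] := A_bounded Ag.
move/A_P : Af => [h1 _ h2]; move/A_P : Ag => [k1 _ k2].
apply: (@A_mk _ (B1 + B2)); last exact: little_add.
- by move=> z Uz; exact: (derivable_addc (h1 z Uz) (k1 z Uz)).
- by move=> z Uz; rewrite (le_trans (cabsD _ _))// lerD ?HB1 ?HB2.
Qed.

Lemma A_mul f g : A_ U alpha f -> A_ U alpha g -> A_ U alpha (fun z => f z * g z).
Proof.
move=> Af Ag; have [B1 HB1] := A_bounded Af; have [B2 HB2] := A_bounded Ag.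
move/A_P : Af => [h1 _ h2]; move/A_P : Ag => [k1 _ k2].
have [z0 Uz0] := U_ne.
have B10 : 0 <= B1 := le_trans (cabs_ge0 _) (HB1 z0 Uz0).
have B20 : 0 <= B2 := le_trans (cabs_ge0 _) (HB2 z0 Uz0).
apply: (@A_mk _ (B1 * B2)).
- by move=> z Uz; exact: (derivable_mulc (h1 z Uz) (k1 z Uz)).
- by move=> z Uz; rewrite cabsM ler_pM ?cabs_ge0 ?HB1 ?HB2.
- apply: (@little_mul _ _ (B1 + B2)) => //; first exact: addr_ge0.
    by move=> z Uz; rewrite (le_trans (HB1 z Uz))// lerDl.
  by move=> z Uz; rewrite (le_trans (HB2 z Uz))// lerDr.
Qed.

Lemma A_scale c f : A_ U alpha f -> A_ U alpha (fun z => c * f z).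
Proof. by move=> Af; exact: (A_mul (A_const c) Af). Qed.

Lemma A_addcst c f : A_ U alpha f -> A_ U alpha (fun z => f z + c).
Proof. by move=> Af; exact: (A_add Af (A_const c)). Qed.

Lemma A_sum (I : Type) (s : seq I) (F : I -> C R -> C R) :
  (forall i, A_ U alpha (F i)) -> A_ U alpha (fun z => \sum_(i <- s) F i z).
Proof.
move=> AF; elim: s => [|i s IH].
  by under eq_fun do rewrite big_nil; exact: A_const.
under eq_fun do rewrite big_cons; exact: (A_add (AF i) IH).
Qed.

(** Close to [a] the quotient is handled by [local_quotient]; elsewhere it inherits
    the modulus of [f], because [1 / (z - a)] is bounded and Lipschitz there. The
    constant depends on [d] alone: in the construction of test functions the number
    of points [a] grows while their distance to the boundary is fixed. *)
Lemma A_quotient (d : R) : 0 < d -> exists2 K : R, 0 < K & forall a f,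
  (forall z, cabs (z - a) <= 4 * d -> U z) -> A_ U alpha f -> lip 1 f ->
  exists g, [/\ A_ U alpha g, forall z, U z -> f z - f a = (z - a) * g z & lip K g].
Proof.
move=> d0; have [K0 K00 HK0] := @local_quotient R d d0.
pose M := (4 * d) `^ alpha; pose D := (2 * T) `^ alpha.
have M0 : 0 <= M by exact: powR_ge0. have D0 : 0 <= D by exact: powR_ge0.
pose B := K0 * M + D / d; have B0 : 0 <= B by rewrite addr_ge0 ?mulr_ge0 ?invr_ge0// ltW.
pose L := K0 * M + D * (2 / d) * (2 / d).
have L0 : 0 <= L by rewrite addr_ge0 ?mulr_ge0 ?invr_ge0// ltW.
have h0 : 0 < (d / 2) `^ alpha by rewrite powR_gt0// divr_gt0.
pose K := 1 + L * (d / 2) `^ (1 - alpha) + 2 / d + 2 * B / (d / 2) `^ alpha.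
have K1 : 0 <= L * (d / 2) `^ (1 - alpha) by rewrite mulr_ge0 ?powR_ge0.
have K2 : 0 <= 2 / d by rewrite divr_ge0// ltW.
have K3 : 0 <= 2 * B / (d / 2) `^ alpha by rewrite divr_ge0 ?mulr_ge0// ltW.
exists K => [|a f aU Af f1]; first by rewrite /K; lra.
move/A_P : (Af) => [hf _ lf].
have Ua : U a by apply: aU; rewrite subrr cabs0; lra.
have [|g1 Hg1] := HK0 a (fun z => f z + (- f a)) M.
  move=> z za; split; first exact: (@derivable_addcst R f (- f a) z (hf z (aU z za))).
  by rewrite (le_trans (f1 z a (aU z za) Ua))// mul1r powR_le ?cabs_ge0// ltW.
pose q z := (f z - f a) / (z - a).
pose g z := if cabs (z - a) < d then g1 z else q z.
have g1q z : cabs (z - a) < d -> z != a -> g1 z = q z.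
  move=> zd za; have [e _ _ _] := Hg1 z zd.
  have {}e : f z - f a = (z - a) * g1 z by rewrite -e /= subrr subr0.
  by rewrite /q e mulrC mulKf// subr_eq0.
have gq z : z != a -> g z = q z.
  by move=> za; rewrite /g; case: ltP => // zd; exact: g1q.
have eqn z : U z -> f z - f a = (z - a) * g z.
  move=> Uz; have [->|za] := eqVneq z a; first by rewrite !subrr mul0r.
  by rewrite gq// /q mulrC divfK// subr_eq0.
have hg : holomorphic_on U g.
  move=> z Uz; have [zd|zd] := ltP (cabs (z - a)) d.
    have [_ dg _ _] := Hg1 z zd.
    apply: (@derivable_local _ g1 g z (d - cabs (z - a))) => //; first by rewrite subr_gt0.
    move=> w wz; rewrite /g ifT//; have := cdistD z w a; move: wz; lra.
  have za : z != a by apply: contraTneq zd => ->; rewrite subrr cabs0 -ltNge.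
  apply: (@derivable_local _ q g z d) => //; last exact: derivable_quot za (hf z Uz).
  move=> w wz; rewrite gq//; apply: contraTneq wz => ->.
  by rewrite cdistC -leNgt.
have fD z : U z -> cabs (f z - f a) <= D.
  move=> Uz; rewrite (le_trans (f1 z a Uz Ua))// mul1r powR_le ?cabs_ge0 ?U_diam//.
  exact: ltW.
have gB z : U z -> cabs (g z) <= B.
  move=> Uz; rewrite /g; case: ltP => zd.
    have [_ _ h _] := Hg1 z zd; rewrite (le_trans h)// lerDl mulr_ge0 ?invr_ge0//.
    exact: ltW.
  rewrite (@le_trans _ _ (D / d))//; first by apply: cabs_div_le => //; exact: fD.
  by rewrite lerDr mulr_ge0// ltW.
have near z w : U z -> U w -> cabs (z - w) < d / 2 ->
    cabs (g z - g w) <= L * cabs (z - w) + (2 / d) * cabs (f z - f w).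
  move=> Uz Uw zw; have p1 : 0 <= cabs (z - w) by exact: cabs_ge0.
  have p2 : 0 <= (2 / d) * cabs (f z - f w) by rewrite mulr_ge0// cabs_ge0.
  have in1 u v : cabs (u - v) < d / 2 -> cabs (v - a) < d / 2 ->
      cabs (g u - g v) <= L * cabs (u - v).
    move=> uv va; have vd : cabs (v - a) < d by move: va; lra.
    have ud : cabs (u - a) < d by have := cdistD v u a; move: uv va; lra.
    rewrite /g ud vd; have [_ _ _ h] := Hg1 v vd.
    rewrite (le_trans (h u ud))// ler_wpM2r ?cabs_ge0// lerDl !mulr_ge0 ?invr_ge0//; exact: ltW.
  have [wa|wa] := ltP (cabs (w - a)) (d / 2).
    by rewrite (le_trans (in1 z w zw wa))// lerDl.
  have [za|za] := ltP (cabs (z - a)) (d / 2).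
    by rewrite cdistC (cdistC z) (le_trans (in1 w z _ za)) ?lerDl// cdistC.
  have d2 : 0 < d / 2 by rewrite divr_gt0.
  have za0 : z - a != 0 by rewrite -cabs_gt0 (lt_le_trans d2).
  have wa0 : w - a != 0 by rewrite -cabs_gt0 (lt_le_trans d2).
  have za1 : z != a by rewrite -subr_eq0.
  have wa1 : w != a by rewrite -subr_eq0.
  rewrite (gq z za1) (gq w wa1).
  have -> : q z - q w = (f z - f w) / (w - a) - (f z - f a) / (z - a) / (w - a) * (z - w).
    by rewrite /q; field; rewrite za0 wa0.
  have i2 : 2 / d = (d / 2)^-1 by rewrite invf_div.
  have t1 : cabs ((f z - f w) / (w - a)) <= (2 / d) * cabs (f z - f w).
    by rewrite i2 [leRHS]mulrC; apply: cabs_div_le.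
  have t2 : cabs ((f z - f a) / (z - a) / (w - a) * (z - w)) <=
      D * (2 / d) * (2 / d) * cabs (z - w).
    rewrite cabsM ler_wpM2r ?cabs_ge0// i2.
    by apply: cabs_div_le => //; apply: cabs_div_le => //; exact: fD.
  rewrite (le_trans (cabsB _ _))//.
  have : 0 <= K0 * M * cabs (z - w) by rewrite !mulr_ge0// ltW.
  by move: t1 t2; rewrite /L; lra.
have lg : little g.
  have lin := @little_of_lipschitz (fun z => rc L * z) L.
  move=> e e0; have [||d1 d10 H1] := lin _ (e / 2); rewrite ?divr_gt0//.
    by move=> z w _ _; rewrite -mulrBr cabsM cabs_rc ger0_norm.
  have e2 : 0 < e / 2 / (2 / d) by rewrite !divr_gt0.
  have [d2 d20 H2] := lf _ e2.
  exists (Num.min (Num.min d1 d2) (d / 2)); first by rewrite !lt_min d10 d20 divr_gt0.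
  move=> z w Uz Uw; rewrite !lt_min => /andP[/andP[zw1 zw2] zw3].
  rewrite (le_trans (near z w Uz Uw zw3))// (splitr e) [leRHS]mulrDl lerD//.
    by have := H1 z w Uz Uw zw1; rewrite -mulrBr cabsM cabs_rc ger0_norm.
  rewrite mulrC -ler_pdivlMr ?divr_gt0// mulrAC; exact: H2.
exists g; split=> //; first exact: (@A_mk _ B).
move=> z w Uz Uw; have P0 : 0 <= cabs (z - w) `^ alpha by exact: powR_ge0.
have [zw|zw] := ltP (cabs (z - w)) (d / 2).
  rewrite (le_trans (near z w Uz Uw zw))//.
  have b1 : L * cabs (z - w) <= L * (d / 2) `^ (1 - alpha) * cabs (z - w) `^ alpha.
    rewrite -mulrA ler_wpM2l//.
    rewrite {1}(@powR_split alpha (cabs (z - w))) ?cabs_ge0// ler_wpM2r//.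
    by apply: powR_le; rewrite ?cabs_ge0// ?subr_ge0 ltW.
  have b2 : (2 / d) * cabs (f z - f w) <= (2 / d) * cabs (z - w) `^ alpha.
    by rewrite ler_wpM2l//; have := f1 z w Uz Uw; rewrite mul1r.
  have b3 : 0 <= 2 * B / (d / 2) `^ alpha * cabs (z - w) `^ alpha by rewrite mulr_ge0.
  rewrite /K [leRHS]mulrDl [X in _ <= X + _]mulrDl [X in _ <= X + _ + _]mulrDl mul1r.
  by move: b1 b2 b3; lra.
rewrite (le_trans (cabsB _ _))// (@le_trans _ _ (2 * B))//.
  by have := gB z Uz; have := gB w Uw; lra.
rewrite (@le_trans _ _ (2 * B / (d / 2) `^ alpha * cabs (z - w) `^ alpha))//.
  rewrite mulrAC ler_pdivlMr// ler_wpM2l ?mulr_ge0//.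
  by apply: powR_le => //; [exact: ltW|rewrite divr_ge0// ltW].
by rewrite ler_wpM2r// /K; lra.
Qed.

End LipAlgebra.

(** * Point derivations and difference quotients *)

Section Derivation.
Context {R : realType}.
Context (alpha : R) (U : set (C R)) (T : R) (b : C R) (d : (C R -> C R) -> C R).
Context (alpha_gt0 : 0 < alpha) (alpha_lt1 : alpha < 1).
Context (U_open : open U) (U_ne : U !=set0).
Context (U_T : forall z, U z -> cabs z <= T).
Context (b_cl : closure U b).
Context (d_der : point_derivation U alpha b d)
  (d_cont : continuous_functional U alpha d) (d_norm : normalised d).
Implicit Types (f g : C R -> C R) (z w a : C R) (k : R).
Local Notation A := (A_ U alpha).
Local Notation ev := (ext_value U b).

Let ProperUb : ProperFilter (within U (nbhs b)).
Proof. exact: within_nbhs_proper. Qed.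

Let A_cst c : A (fun _ => c). Proof. exact: (A_const alpha_gt0 alpha_lt1 U_open U_ne). Qed.
Let A_z : A (fun z => z). Proof. exact: (A_id alpha_gt0 alpha_lt1 U_open U_ne U_T). Qed.
Let A_D f g : A f -> A g -> A (fun z => f z + g z).
Proof. exact: (A_add alpha_gt0 U_open U_ne U_T). Qed.
Let A_M f g : A f -> A g -> A (fun z => f z * g z).
Proof. exact: (A_mul alpha_gt0 U_open U_ne U_T). Qed.
Let A_Z c f : A f -> A (fun z => c * f z).
Proof. exact: (A_scale alpha_gt0 alpha_lt1 U_open U_ne U_T). Qed.

Lemma d_eq f g : A f -> A g -> (forall z, U z -> f z = g z) -> d f = d g.
Proof. by case: d_der => H _ _; exact: H. Qed.

Lemma d_leibniz f g : A f -> A g -> d (fun z => f z * g z) = ev f * d g + ev g * d f.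
Proof. by case: d_der => _ _; apply. Qed.

Lemma d_lin c f g : A f -> A g -> d (fun z => c * f z + g z) = c * d f + d g.
Proof. by case: d_der => _ H _; exact: H. Qed.

Lemma ev_lim f l : f z @[z --> within U (nbhs b)] --> l -> ev f = l.
Proof.
exact: (@cvg_lim (C R) (@norm_hausdorff (C R) (C R)) _ _ ProperUb f l).
Qed.

Lemma ev_cst c : ev (fun _ => c) = c.
Proof. by apply: ev_lim; exact: cvg_cst. Qed.

Lemma ev_shrink f B : (forall z, U z -> cabs (f z) <= B) -> ev (fun z => (z - b) * f z) = 0.
Proof.
move=> fB; apply: ev_lim; apply/cvg_cP => e e0.
have B1 : 0 < `|B| + 1 by rewrite ltr_wpDl.
apply/nbhs_cP; exists (e / (`|B| + 1)); first by rewrite divr_gt0.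
move=> z zb Uz; rewrite /= subr0 cabsM; have := fB z Uz.
move=> h; rewrite (@le_lt_trans _ _ (cabs (z - b) * (`|B| + 1)))//.
  by rewrite ler_wpM2l ?cabs_ge0// (le_trans h)// (le_trans (ler_norm B))// lerDl.
by rewrite -ltr_pdivlMr.
Qed.

Lemma d_one : d (fun _ => 1) = 0.
Proof.
have A1 := A_cst 1; have := d_leibniz A1 A1; rewrite ev_cst !mul1r.
by move=> /eqP; rewrite eq_sym -subr_eq0 addrK => /eqP.
Qed.

Lemma d_add f g : A f -> A g -> d (fun z => f z + g z) = d f + d g.
Proof.
move=> Af Ag; have := d_lin 1 Af Ag; rewrite mul1r => <-.
by apply: d_eq; [exact: A_D|apply: A_D => //; exact: A_Z|move=> z _; rewrite mul1r].
Qed.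

Lemma d_scale c f : A f -> d (fun z => c * f z) = c * d f.
Proof.
move=> Af; have A0 := A_cst 0.
have d0 : d (fun _ => 0) = 0.
  have := d_lin 1 A0 A0; rewrite !mul1r addr0.
  by move=> /eqP; rewrite eq_sym -subr_eq0 addrK => /eqP.
have := d_lin c Af A0; rewrite d0 addr0 => <-.
apply: d_eq; [exact: A_Z|exact: A_D (A_Z c Af) A0|by move=> z _; rewrite addr0].
Qed.

Lemma d_cst c : d (fun _ => c) = 0.
Proof.
have := d_scale c (A_cst 1); rewrite d_one mulr0 => <-.
by apply: d_eq; [exact: A_cst|exact: A_Z (A_cst 1)|move=> z _; rewrite mulr1].
Qed.

Lemma d_addcst f c : A f -> d (fun z => f z + c) = d f.
Proof. by move=> Af; rewrite d_add ?d_cst ?addr0. Qed.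

Lemma d_sum (I : Type) (s : seq I) (F : I -> C R -> C R) :
  (forall i, A (F i)) -> d (fun z => \sum_(i <- s) F i z) = \sum_(i <- s) d (F i).
Proof.
move=> AF; elim: s => [|i s IH].
  rewrite big_nil; transitivity (d (fun _ => 0)); last exact: d_cst.
  apply: d_eq => [||z _]; [|exact: A_cst|by rewrite big_nil].
  exact: (A_sum alpha_gt0 alpha_lt1 U_open U_ne U_T).
have As : A (fun z => \sum_(i <- s) F i z) by exact: (A_sum alpha_gt0 alpha_lt1 U_open U_ne U_T).
rewrite big_cons -IH -d_add//; apply: d_eq;
  first exact: (A_sum alpha_gt0 alpha_lt1 U_open U_ne U_T).
  exact: A_D.
by move=> z _; rewrite big_cons.
Qed.

(** Leibniz' rule for [(z - b) f] and [d z = 1]. The right-hand side is linear in [f],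
    and thus so is evaluation at [b], although a [lim] by itself is linear only on
    convergent functions. *)
Lemma ev_dE f : A f -> ev f = d (fun z => (z - b) * f z).
Proof.
move=> Af; have Azb : A (fun z => z - b) by exact: A_D A_z (A_cst (- b)).
rewrite d_leibniz// (@d_addcst (fun z => z))// d_norm mulr1.
suff -> : ev (fun z => z - b) = 0 by rewrite mul0r add0r.
have e : (fun z => z - b) = (fun z => (z - b) * (fun _ => 1) z).
  by apply/funext => z; rewrite mulr1.
by rewrite e; apply: (@ev_shrink (fun _ => 1) 1) => z _; rewrite cabs1.
Qed.

Lemma ev_add f g : A f -> A g -> ev (fun z => f z + g z) = ev f + ev g.
Proof.
move=> Af Ag; have Azb : A (fun z => z - b) by exact: A_D A_z (A_cst (- b)).
rewrite !ev_dE//; last exact: A_D.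
rewrite -d_add; [|exact: A_M|exact: A_M].
apply: d_eq; [exact: A_M Azb (A_D Af Ag)|exact: A_D (A_M Azb Af) (A_M Azb Ag)|].
by move=> z _; rewrite mulrDr.
Qed.

Lemma ev_shrinkA f : A f -> ev (fun z => (z - b) * f z) = 0.
Proof.
move=> Af; have [B HB] := A_bounded alpha_gt0 U_open U_ne U_T Af.
exact: ev_shrink HB.
Qed.

(** Apply [d] and evaluation at [b] to [f = f a + (z - a) g]. So the error of the
    difference quotient at [a] is itself a value of the derivation, and smallness of
    this error becomes a statement on the norm of [(a - b) g]. *)
Lemma quotient_error f g a : A f -> A g -> a != b ->
  (forall z, U z -> f z - f a = (z - a) * g z) ->
  (f a - ev f) / (a - b) - d f = (a - b) * d g.
Proof.
move=> Af Ag ab fg.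
have Azb : A (fun z => z - b) by exact: A_D A_z (A_cst (- b)).
have Aba : A (fun z => (b - a) * g z) by exact: A_Z.
have Azg : A (fun z => (z - b) * g z) by exact: A_M.
have AR : A (fun z => (z - b) * g z + (b - a) * g z) by exact: A_D.
have ARa : A (fun z => ((z - b) * g z + (b - a) * g z) + f a) by exact: A_D AR (A_cst (f a)).
have E : forall z, U z -> f z = ((z - b) * g z + (b - a) * g z) + f a.
  by move=> z Uz; rewrite -mulrDl subrKA -fg// subrK.
have df : d f = ev g + (b - a) * d g.
  by rewrite (d_eq Af ARa E) d_addcst// d_add// d_scale// -ev_dE.
have ef : ev f = (b - a) * ev g + f a.
  rewrite (ev_dE Af).
  transitivity (d (fun z => (z - b) * (((z - b) * g z + (b - a) * g z) + f a))).
    by apply: d_eq => [||z Uz]; [exact: A_M Azb Af|exact: A_M Azb ARa|rewrite -E].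
  rewrite -(ev_dE ARa) (ev_add AR (A_cst (f a))) ev_cst (ev_add Azg Aba).
  rewrite (ev_shrinkA Ag) add0r; congr (_ + _).
  rewrite (ev_dE Aba) (ev_dE Ag) -(d_scale _ (A_M Azb Ag)).
  apply: d_eq; [exact: A_M Azb Aba|exact: A_Z (A_M Azb Ag)|].
  by move=> z _; rewrite mulrCA.
rewrite df ef; have ab0 : a - b != 0 by rewrite subr_eq0.
by field.
Qed.

(** Constants are killed by [d], so its continuity only involves the Lipschitz
    constant. *)
Lemma d_lip : exists2 M : R, 0 <= M &
  forall f k, A f -> 0 <= k -> lip alpha U k f -> cabs (d f) <= M * k.
Proof.
have [M HM] := d_cont; have [z0 Uz0] := U_ne.
pose D := (2 * T) `^ alpha; have D0 : 0 <= D by exact: powR_ge0.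
pose M1 := Num.max M 0; have M10 : 0 <= M1 by rewrite le_max lexx orbT.
exists (M1 * (D + 1)) => [|f k Af k0 fk]; first by rewrite mulr_ge0// addr_ge0.
pose g z := f z + (- f z0).
have Ag : A g by exact: (A_D Af (A_cst (- f z0))).
have dg : d g = d f by exact: d_addcst.
have gk : lip alpha U k g by move=> z w Uz Uw; rewrite /g opprD addrACA subrr addr0 fk.
have n1 : (ereal_sup [set (cabs (g z))%:E | z in U] <= (k * D)%:E)%E.
  apply: ge_ereal_sup => _ [z Uz <-]; rewrite lee_fin (le_trans (fk z z0 Uz Uz0))//.
  rewrite ler_wpM2l// /D; apply: ge0_ler_powR; rewrite ?nnegrE ?cabs_ge0//.
  - exact: ltW.
  - by rewrite mulr_ge0// (le_trans (cabs_ge0 _) (U_T Uz0)).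
  - exact: (U_diam U_T).
have n10 : (0 <= ereal_sup [set (cabs (g z))%:E | z in U])%E.
  apply: (@le_trans _ _ (cabs (g z0))%:E); first by rewrite lee_fin cabs_ge0.
  by apply: ereal_sup_ubound; exists z0.
have n2 : (kappa U alpha g <= k%:E)%E by apply/lipP.
have N : (A_norm U alpha g <= (k * D + k)%:E)%E.
  by rewrite EFinD; apply: leeD.
have n20 : (0 <= kappa U alpha g)%E.
  have [w Uw zw] := U_close U_open Uz0 ltr01.
  apply: (@le_trans _ _ (lip_quotient alpha g z0 w)%:E); last first.
    apply: ereal_sup_ubound; exists z0, w; split => //.
    by rewrite -subr_eq0 -cabs_gt0; case/andP: zw.
  by rewrite lee_fin divr_ge0 ?cabs_ge0 ?powR_ge0.
have N0 : (0 <= A_norm U alpha g)%E by apply: adde_ge0.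
have := HM g Ag; rewrite dg => h; rewrite -lee_fin (le_trans h)//.
apply: (@le_trans _ _ (M1%:E * A_norm U alpha g)%E).
  by rewrite lee_wpmul2r// lee_fin le_max lexx.
apply: (@le_trans _ _ (M1%:E * (k * D + k)%:E)%E); first by rewrite lee_wpmul2l// lee_fin.
by rewrite -EFinM lee_fin le_eqVlt; apply/orP; left; apply/eqP; ring.
Qed.

End Derivation.

(** * Area and its discretization *)

Section PlaneMeasure.
Context {R : realType}.
Implicit Types (S V A : set (R * R)) (rho x y : R).
Local Notation mu := (@lebesgue_measure R).
Local Notation mu2 := (@lebesgue_measure R \x @lebesgue_measure R)%E.

Definition box x x' y y' : set (R * R) :=
  [set p | (x <= p.1 <= x') && (y <= p.2 <= y')].

Lemma box_setX x x' y y' : box x x' y y' = `[x, x'] `*` `[y, y'].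
Proof.
apply/seteqP; split=> p; rewrite /box /setX/= !in_itv/=; first by move/andP.
by move=> [-> ->].
Qed.

Lemma measurable_box x x' y y' : measurable (box x x' y y').
Proof. by rewrite box_setX; exact: measurableX. Qed.

Lemma mu2_box x x' y y' : x <= x' -> y <= y' ->
  mu2 (box x x' y y') = ((x' - x) * (y' - y))%:E.
Proof.
move=> xx yy; rewrite box_setX product_measure1E//= !lebesgue_measure_itv/= !lte_fin.
have e (u v : R) : u <= v -> (if (u < v)%R then v%:E - u%:E else 0)%E = (v - u)%:E.
  by move=> uv; case: ltP => // vu; rewrite (le_anti (introT andP (conj uv vu))) subrr.
by rewrite !e// EFinM.
Qed.

Definition in_box S := exists x x' y y', S `<=` box x x' y y'.

Lemma mu2_lty S : measurable S -> in_box S -> (mu2 S < +oo)%E.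
Proof.
move=> mS [x [x' [y [y' sS]]]].
have sub : S `<=` box (Num.min x x') (Num.max x x') (Num.min y y') (Num.max y y').
  move=> p /sS/andP[/andP[h1 h2] /andP[h3 h4]].
  by rewrite /box/= !ge_min !le_max ?h1 ?h2 ?h3 ?h4 ?orbT.
apply: (@le_lt_trans _ _ (mu2 (box (Num.min x x') (Num.max x x') (Num.min y y') (Num.max y y')))).
  by apply: le_measure => //; rewrite inE//; exact: measurable_box.
have mM (u v : R) : Num.min u v <= Num.max u v by rewrite ge_min !le_max lexx.
by rewrite mu2_box// ltry.
Qed.

Definition rarea S : R := fine (mu2 S).

Lemma rareaE S : measurable S -> in_box S -> (rarea S)%:E = mu2 S.
Proof. by move=> mS bS; rewrite /rarea fineK// ge0_fin_numE// mu2_lty. Qed.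

Lemma rarea_ge0 S : 0 <= rarea S.
Proof. exact: fine_ge0. Qed.

Lemma in_boxS S V : S `<=` V -> in_box V -> in_box S.
Proof.
by move=> SV [x [x' [y [y' sS]]]]; exists x, x', y, y'; exact: subset_trans sS.
Qed.

Lemma rarea_le S V : measurable S -> measurable V -> in_box V -> S `<=` V -> rarea S <= rarea V.
Proof.
move=> mS mV bV SV; rewrite -lee_fin !rareaE//; last exact: in_boxS bV.
by apply: le_measure; rewrite ?inE.
Qed.

Lemma rarea_box x x' y y' : x <= x' -> y <= y' -> rarea (box x x' y y') = (x' - x) * (y' - y).
Proof. by move=> xx yy; rewrite /rarea mu2_box. Qed.

Lemma rarea_split S A : measurable S -> measurable A -> in_box S ->
  rarea S = rarea (S `&` A) + rarea (S `\` A).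
Proof.
move=> mS mA bS; have mI : measurable (S `&` A) by exact: measurableI.
have mD : measurable (S `\` A) by exact: measurableD.
have bI : in_box (S `&` A) by apply: in_boxS bS => p [].
have bD : in_box (S `\` A) by apply: in_boxS bS => p [].
have e : (mu2 S = mu2 (S `\` A) + mu2 (S `&` A))%E by apply: measureDI.
by apply: EFin_inj; rewrite EFinD (rareaE mS bS) (rareaE mI bI) (rareaE mD bD) e addeC.
Qed.

Lemma rarea_subU S V : measurable S -> measurable V -> in_box S -> in_box V ->
  in_box (S `|` V) -> rarea (S `|` V) <= rarea S + rarea V.
Proof.
move=> mS mV bS bV bSV; rewrite -lee_fin EFinD !rareaE//; last exact: measurableU.
have := @measureU2 _ _ _ mu2 S V mS mV.
exact.
Qed.

(** A finite weighted set of points of [S] carrying the area of [S] and imitating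
    area at scales above [rho]: the points with property [P] weigh no more than the
    [rho]-neighbourhood of the part of [S] with property [P]. Arbitrary [P], rather
    than discs, makes the notion stable under cutting [S] in two. *)
Definition discretized rho S := exists s : seq (R * (R * R)),
  [/\ forall p, p \in s -> 0 < p.1 /\ S p.2,
      \sum_(p <- s) p.1 = rarea S &
      forall (P : pred (R * R)) V, measurable V ->
        (forall p q, S p -> S q -> P p -> `|q.1 - p.1| <= rho -> `|q.2 - p.2| <= rho -> V q) ->
        \sum_(p <- s | P p.2) p.1 <= rarea (S `&` V)].

Lemma discretized_split rho S A : measurable S -> measurable A -> in_box S ->
  discretized rho (S `&` A) -> discretized rho (S `\` A) -> discretized rho S.
Proof.
move=> mS mA bS [s1 [p1 t1 g1]] [s2 [p2 t2 g2]]; exists (s1 ++ s2); split.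
- by move=> p; rewrite mem_cat => /orP[/p1[? []]|/p2[? []]].
- by rewrite big_cat/= t1 t2 -rarea_split.
- move=> P V mV HV; rewrite big_cat/=.
  rewrite (@rarea_split (S `&` V) A)//; [|exact: measurableI|by apply: in_boxS bS => p []].
  rewrite lerD//.
    have -> : S `&` V `&` A = S `&` A `&` V by rewrite setIAC.
    by apply: g1 => // p q [Sp _] [Sq _]; exact: HV.
  have -> : (S `&` V) `\` A = (S `\` A) `&` V by rewrite !setDE setIAC.
  by apply: g2 => // p q [Sp _] [Sq _]; exact: HV.
Qed.

Lemma discretized_small rho S : measurable S -> in_box S ->
  (forall p q, S p -> S q -> `|q.1 - p.1| <= rho /\ `|q.2 - p.2| <= rho) -> discretized rho S.
Proof.
move=> mS bS dS; have [m0|m0] := eqVneq (rarea S) 0.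
  exists [::]; split=> //; first by rewrite big_nil.
  by move=> P V mV _; rewrite big_nil rarea_ge0.
have [a Sa] : S !=set0.
  apply/set0P; apply: contra_neq m0 => ->; by rewrite /rarea measure0.
have mp : 0 < rarea S by rewrite lt_neqAle eq_sym m0 rarea_ge0.
exists [:: (rarea S, a)]; split=> [p||P V mV HV].
- by rewrite inE => /eqP ->.
- by rewrite big_seq1.
- rewrite big_mkcond big_seq1 /=; case: ifP => Pa; last exact: rarea_ge0.
  have -> : S `&` V = S.
    by apply/setIidl => q Sq; have [d1 d2] := dS a q Sa Sq; exact: HV Pa d1 d2.
  by [].
Qed.

Lemma measurable_half (c : R) : measurable [set p : R * R | p.1 <= c] /\
  measurable [set p : R * R | p.2 <= c].
Proof.
split.
  have -> : [set p : R * R | p.1 <= c] = `]-oo, c] `*` setT.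
    by apply/seteqP; split=> p /=; rewrite in_itv/= => // -[].
  exact: measurableX.
have -> : [set p : R * R | p.2 <= c] = setT `*` `]-oo, c].
  by apply/seteqP; split=> p /=; rewrite in_itv/= => // -[].
exact: measurableX.
Qed.

(** Bisection in both directions until the pieces have diameter at most [rho]. *)
Lemma discretize rho S : 0 < rho -> measurable S -> in_box S -> discretized rho S.
Proof.
move=> r0 mS bS.
have bis (w : R) : exists n, w <= 2 ^+ n * rho.
  exists (Num.bound (`|w| / rho)); rewrite -ler_pdivrMr//.
  rewrite (@le_trans _ _ (`|w| / rho))//.
    by rewrite ler_pM2r ?invr_gt0// ler_norm.
  have w0 : 0 <= `|w| / rho by rewrite divr_ge0// ltW.
  have /ltW/le_trans := archi_boundP w0; apply.
  by rewrite -natrX ler_nat ltnW// ltn_expl.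
have stepx n (X x y : R) V : measurable V -> V `<=` box x (x + 2 ^+ n * rho) y (y + rho) ->
    discretized rho V.
  elim: n x V => [|n IH] x V mV sV.
    apply: discretized_small => //; first by exists x, (x + 2 ^+ 0 * rho), y, (y + rho).
    move=> p q /sV/andP[/andP[a1 a2] /andP[a3 a4]].
    move=> /sV/andP[/andP[b1 b2] /andP[b3 b4]].
    by move: a1 a2 a3 a4 b1 b2 b3 b4; rewrite expr0 !ler_norml => *; split; lra.
  have [mh _] := measurable_half (x + 2 ^+ n * rho).
  apply: (discretized_split mV mh); first by exists x, (x + 2 ^+ n.+1 * rho), y, (y + rho).
    apply: (IH x); first exact: measurableI.
    move=> p [/sV/andP[/andP[a1 a2] /andP[a3 a4]]] h.
    by rewrite /box/= ?a1 ?h ?a3 ?a4.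
  apply: (IH (x + 2 ^+ n * rho)); first exact: measurableD.
  move=> p [/sV/andP[/andP[a1 a2] /andP[a3 a4]]] /negP.
  rewrite -ltNge => h; rewrite /box/= a3 a4 (ltW h) andbT /=.
  by move: a2; rewrite exprS; lra.
have stepy n m (x y : R) V : measurable V ->
    V `<=` box x (x + 2 ^+ m * rho) y (y + 2 ^+ n * rho) -> discretized rho V.
  elim: n y V => [|n IH] y V mV sV.
    by apply: (stepx m 0 x y) => //; rewrite expr0 mul1r in sV.
  have [_ mh] := measurable_half (y + 2 ^+ n * rho).
  apply: (discretized_split mV mh); first by exists x, (x + 2 ^+ m * rho), y, (y + 2 ^+ n.+1 * rho).
    apply: (IH y); first exact: measurableI.
    move=> p [/sV/andP[/andP[a1 a2] /andP[a3 a4]]] h.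
    by rewrite /box/= ?a1 ?a2 ?a3 ?h.
  apply: (IH (y + 2 ^+ n * rho)); first exact: measurableD.
  move=> p [/sV/andP[/andP[a1 a2] /andP[a3 a4]]] /negP.
  rewrite -ltNge => h; rewrite /box/= a1 a2 (ltW h) /=.
  by move: a4; rewrite exprS; lra.
have [x [x' [y [y' sS]]]] := bS.
have [m hm] := bis (x' - x); have [n hn] := bis (y' - y).
apply: (stepy n m x y) => // p /sS/andP[/andP[a1 a2] /andP[a3 a4]].
by rewrite /box/= a1 a3/=; apply/andP; split; [move: hm a2|move: hn a4]; lra.
Qed.

(** The constant 16 comes from a square of side [4 t]: it contains the disc of radius
    [t] together with all cells that meet it. *)
Lemma discretize_C rho (K : set (C R)) : 0 < rho -> measurable (in_plane K) ->
  in_box (in_plane K) -> exists s : seq (R * C R),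
  [/\ forall p, p \in s -> 0 < p.1 /\ K p.2,
      \sum_(p <- s) p.1 = rarea (in_plane K) &
      forall z (t : R), rho <= t -> \sum_(p <- s | cabs (p.2 - z) < t) p.1 <= 16 * t ^+ 2].
Proof.
move=> r0 mK bK; have [s [s1 s2 s3]] := discretize r0 mK bK.
exists [seq (p.1, (p.2.1 +i* p.2.2)%C) | p <- s]; split.
- by move=> _ /mapP[p /s1[p0 Kp] ->].
- by rewrite big_map.
- move=> z t rt; rewrite big_map /=.
  pose V := box (Re z - 2 * t) (Re z + 2 * t) (Im z - 2 * t) (Im z + 2 * t).
  have t0 : 0 < t by exact: lt_le_trans rt.
  have mV : measurable V by exact: measurable_box.
  have := s3 (fun p => cabs ((p.1 +i* p.2)%C - z) < t) V mV.
  move/(_ _)/le_trans; apply.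
    move=> p q _ _ pz h1 h2.
    have := Re_le_cabs ((p.1 +i* p.2)%C - z); rewrite ReD ReN /= => h3.
    have := Im_le_cabs ((p.1 +i* p.2)%C - z); rewrite ImD ImN /= => h4.
    have {}h3 := le_lt_trans h3 pz; have {}h4 := le_lt_trans h4 pz.
    move: h1 h2 h3 h4; rewrite !ler_norml !ltr_norml => /andP[? ?] /andP[? ?] /andP[? ?] /andP[? ?].
    by rewrite /V /box/=; apply/andP; split; apply/andP; split; lra.
  rewrite (@le_trans _ _ (rarea V))//.
    apply: rarea_le => //; first exact: measurableI.
    by exists (Re z - 2 * t), (Re z + 2 * t), (Im z - 2 * t), (Im z + 2 * t).
  rewrite rarea_box; [|lra|lra].
  by rewrite le_eqVlt; apply/orP; left; apply/eqP; ring.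
Qed.

End PlaneMeasure.

(** * Potentials of discretized area *)

Section Potentials.
Context {R : realType}.
Implicit Types (rho r p x y D : R) (s : seq (R * C R)) (b z w a : C R).

(** Stands for the area of a disc being [O(t^2)]; below the scale [rho] it must fail
    for a finite set of points. *)
Definition growth rho s := forall z (t : R), rho <= t ->
  \sum_(q <- s | cabs (q.2 - z) < t) q.1 <= 16 * t ^+ 2.

(** The discrete version of the bound on the area integral of [|z - a|^-p] over a
    disc of radius [r], by summation over dyadic annuli. *)
Lemma potential_bound p : 0 < p -> p < 2 -> exists2 K : R, 0 < K &
  forall rho r s b, 0 < rho -> rho <= r -> growth rho s ->
  (forall q, q \in s -> 0 < q.1 /\ cabs (q.2 - b) <= r) ->
  forall z, \sum_(q <- s | rho <= cabs (z - q.2)) q.1 / cabs (z - q.2) `^ p <= K * r `^ (2 - p).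
Proof.
move=> p0 p2; pose c : R := 2 `^ (2 - p).
have c1 : 1 < c.
  by rewrite /c /powR pnatr_eq0/= expR_gt1 mulr_gt0 ?subr_gt0// ln_gt0// ltr1n.
have c10 : 0 < c - 1 by rewrite subr_gt0.
pose K := 64 / (c - 1); have K0 : 0 < K by rewrite divr_gt0.
exists (K * c + 64); first by rewrite addr_gt0// mulr_gt0// (lt_trans ltr01).
move=> rho r s b rho0 rr gs sb z.
have r0 : 0 < r by exact: lt_le_trans rr.
have mass0 q : q \in s -> 0 <= q.1 by move=> /sb[/ltW].
have powV (t x : R) : 0 < t -> t <= x -> (x `^ p)^-1 <= (t `^ p)^-1.
  move=> t0 tx; rewrite lef_pV2 ?posrE ?powR_gt0 ?(lt_le_trans t0)//.
  by apply: powR_le => //; exact: ltW.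
have y2 (y : R) : 0 < y -> y ^+ 2 / y `^ p = y `^ (2 - p).
  by move=> y0; rewrite powRB ?gt_eqF ?implybT// powR_mulrn// ltW.
have twice (y : R) : 0 < y -> (2 * y) `^ (2 - p) = c * y `^ (2 - p).
  by move=> y0; rewrite powRM// ltW.
pose x (q : R * C R) := cabs (z - q.2).
have dy n : \sum_(q <- s | rho <= x q < 2 ^+ n * rho) q.1 / x q `^ p <=
    K * (2 ^+ n * rho) `^ (2 - p).
  elim: n => [|n IH].
    rewrite big_pred0; first by apply: mulr_ge0; [exact: ltW|exact: powR_ge0].
    by move=> q; rewrite expr0 mul1r; apply/negbTE/negP => /andP[h1 h2]; move: h1 h2; lra.
  set y := 2 ^+ n * rho in IH *; have y0 : 0 < y by rewrite mulr_gt0// exprn_gt0.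
  have yS : 2 ^+ n.+1 * rho = 2 * y by rewrite exprS mulrA.
  rewrite yS.
  have h : \sum_(q <- s | rho <= x q < 2 * y) q.1 / x q `^ p <=
      \sum_(q <- s | rho <= x q < y) q.1 / x q `^ p +
      \sum_(q <- s | cabs (q.2 - z) < 2 * y) q.1 / y `^ p.
    rewrite [leLHS]big_seq_cond [leLHS]big_mkcond.
    rewrite [X in _ <= X + _]big_seq_cond [X in _ <= X + _]big_mkcond.
    rewrite [X in _ <= _ + X]big_seq_cond [X in _ <= _ + X]big_mkcond -big_split/=.
    apply: ler_sum => q _; case qs : (q \in s); last by rewrite /= ?addr0.
    rewrite /=.
    have q0 := mass0 q qs; rewrite cdistC -/(x q).
    have [xy|yx] := ltP (x q) y.
      have xy2 : x q < 2 * y by lra.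
      by rewrite xy2 !andbT; case: ifP => _; rewrite ?lerDl ?add0r divr_ge0 ?powR_ge0.
    rewrite andbF add0r; have [xy2|] := ltP (x q) (2 * y); last by rewrite andbF.
    rewrite andbT; case: ifP => _; last by rewrite divr_ge0 ?powR_ge0.
    by rewrite ler_wpM2l// powV.
  rewrite (le_trans h)// -mulr_suml.
  have ry : rho <= 2 * y.
    rewrite -yS -[leLHS]mul1r ler_wpM2r//; first exact: ltW.
    by rewrite -natrX ler1n expn_gt0.
  have h2 := gs z (2 * y) ry.
  have h3 : (\sum_(q <- s | cabs (q.2 - z) < 2 * y) q.1) / y `^ p <= 64 * y `^ (2 - p).
    rewrite -y2// mulrA ler_wpM2r ?invr_ge0 ?powR_ge0// (le_trans h2)// exprMn.
    by rewrite le_eqVlt; apply/orP; left; apply/eqP; ring.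
  rewrite twice// (le_trans (lerD IH h3))// -mulrDl mulrA ler_wpM2r ?powR_ge0//.
  have -> : K * c = K + 64 by rewrite /K; field; rewrite gt_eqF.
  by [].
have [n rn nr] : exists2 n, r <= 2 ^+ n * rho & 2 ^+ n * rho <= 2 * r.
  have ex : exists n, r <= 2 ^+ n * rho.
    exists (Num.bound (r / rho)); rewrite -ler_pdivrMr//.
    have w0 : 0 <= r / rho by rewrite divr_ge0// ltW.
    have /ltW/le_trans := archi_boundP w0; apply.
    by rewrite -natrX ler_nat ltnW// ltn_expl.
  case: (ex_minnP ex) => n hn mn; exists n => //; case: n hn mn => [|n] hn mn.
    by rewrite expr0 mul1r; lra.
  rewrite exprS -mulrA ler_wpM2l// ltW// ltNge; apply/negP => /mn.
  by rewrite ltnn.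
set Y := 2 ^+ n * rho in rn nr dy.
have h : \sum_(q <- s | rho <= x q) q.1 / x q `^ p <=
    \sum_(q <- s | rho <= x q < Y) q.1 / x q `^ p +
    \sum_(q <- s | cabs (q.2 - b) < 2 * r) q.1 / r `^ p.
  rewrite [leLHS]big_seq_cond [leLHS]big_mkcond.
  rewrite [X in _ <= X + _]big_seq_cond [X in _ <= X + _]big_mkcond.
  rewrite [X in _ <= _ + X]big_seq_cond [X in _ <= _ + X]big_mkcond -big_split/=.
  apply: ler_sum => q _; case qs : (q \in s); last by rewrite /= ?addr0.
  rewrite /=.
  have q0 := mass0 q qs; have [_ qb] := sb q qs.
  have qb2 : cabs (q.2 - b) < 2 * r by move: qb; lra.
  rewrite qb2; case: ifP => _/=; last by rewrite add0r divr_ge0 ?powR_ge0.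
  have [xy|yx] := ltP (x q) Y; first by rewrite lerDl divr_ge0 ?powR_ge0.
  by rewrite add0r ler_wpM2l// powV// (le_trans rn).
rewrite (le_trans h)// -mulr_suml [leRHS]mulrDl lerD//.
  have Y0 : 0 <= Y by rewrite (le_trans _ rn)// ltW.
  have -> : K * c * r `^ (2 - p) = K * (2 * r) `^ (2 - p) by rewrite twice// mulrA.
  rewrite (le_trans (dy n))// ler_wpM2l//; first exact: ltW.
  by apply: powR_le => //; rewrite subr_ge0 ltW.
have h2 : \sum_(q <- s | cabs (q.2 - b) < 2 * r) q.1 <= 16 * (2 * r) ^+ 2.
  by apply: gs; lra.
rewrite -y2// mulrA ler_wpM2r ?invr_ge0 ?powR_ge0// (le_trans h2)// exprMn.
by rewrite le_eqVlt; apply/orP; left; apply/eqP; ring.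
Qed.

Lemma kernel_half x y D beta : 0 < beta -> beta < 1 -> 0 < x -> x <= y -> 0 <= D ->
  D <= 2 * y -> D `^ (1 - beta) / (x * y) <= 2 / x `^ (1 + beta).
Proof.
move=> b0 b1 x0 xy D0 Dy; have y0 : 0 < y by exact: lt_le_trans xy.
have bb : 0 <= 1 - beta by rewrite subr_ge0 ltW.
have h1 : D `^ (1 - beta) <= 2 * (y / y `^ beta).
  rewrite (le_trans (powR_le bb D0 Dy))// powRM ?(ltW y0)//.
  rewrite ler_pM ?powR_ge0//; first by apply: ler1_powR; lra.
  by rewrite powRB ?gt_eqF ?implybT// powRr1// ltW.
have xb : 0 < x `^ beta by rewrite powR_gt0.
have yb : 0 < y `^ beta by rewrite powR_gt0.
rewrite ler_pdivrMr ?mulr_gt0// (le_trans h1)//.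
have -> : x `^ (1 + beta) = x * x `^ beta.
  by rewrite powRD ?(gt_eqF x0) ?implybT// powRr1// ltW.
have -> : 2 / (x * x `^ beta) * (x * y) = 2 * (y / x `^ beta).
  by field; rewrite !gt_eqF.
rewrite ler_pM2l// ler_pM2l// lef_pV2 ?posrE//.
by apply: powR_le; rewrite // ltW.
Qed.

(** Of [|z - w| = |z - w|^(1 - beta) |z - w|^beta] the first factor is absorbed by
    the larger of the two denominators. *)
Lemma cauchy_kernel z w a beta : 0 < beta -> beta < 1 -> z != a -> w != a ->
  cabs ((z - a)^-1 - (w - a)^-1) <=
  (2 / cabs (z - a) `^ (1 + beta) + 2 / cabs (w - a) `^ (1 + beta)) * cabs (z - w) `^ beta.
Proof.
move=> b0 b1 za wa; set x := cabs (z - a); set y := cabs (w - a); set D := cabs (z - w).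
have x0 : 0 < x by rewrite cabs_gt0 subr_eq0. have y0 : 0 < y by rewrite cabs_gt0 subr_eq0.
have D0 : 0 <= D by exact: cabs_ge0.
have Dxy : D <= x + y by rewrite /D /y (cdistC w) cdistD.
have -> : (z - a)^-1 - (w - a)^-1 = (w - z) / ((z - a) * (w - a)).
  by field; rewrite !subr_eq0 za wa.
rewrite cabsf cabsM cdistC -/D -/x -/y.
rewrite {1}(@powR_split R beta D)// mulrAC ler_wpM2r ?powR_ge0//.
have px : 0 <= 2 / x `^ (1 + beta) by rewrite divr_ge0 ?powR_ge0.
have py : 0 <= 2 / y `^ (1 + beta) by rewrite divr_ge0 ?powR_ge0.
have [xy|/ltW yx] := leP x y.
  have Dy : D <= 2 * y by lra.
  by rewrite (le_trans (kernel_half b0 b1 x0 xy D0 Dy))// lerDl.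
have Dx : D <= 2 * x by lra.
by rewrite [x * y]mulrC (le_trans (kernel_half b0 b1 y0 yx D0 Dx))// lerDr.
Qed.

End Potentials.

(** * A generalized limit *)

Section GeneralizedLimit.
Context {R : realType}.
Implicit Types (u v : nat -> R) (M : R).

Definition bdd u := exists M, forall n, `|u n| <= M.

(** The limit along an ultrafilter. It will turn Riemann sums of kernels with
    singularities into an integral without any integrability question. *)
Lemma generalized_limit : exists L : (nat -> R) -> R,
  [/\ forall u v, bdd u -> bdd v -> L (fun n => u n + v n) = L u + L v,
      forall c u, bdd u -> L (fun n => c * u n) = c * L u,
      forall c, L (fun _ => c) = c &
      forall u M N, bdd u -> (forall n, (N <= n)%N -> `|u n| <= M) -> `|L u| <= M].
Proof.
have [G [GU sG]] := ultraFilterLemma (@eventually_filter).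
have GP : ProperFilter G by exact: ultra_proper.
have cv u : bdd u -> cvg (u @ G).
  move=> [M HM]; have : compact `[(- M), M]%classic by exact: segment_compact.
  move=> /(_ (u @ G) (fmap_proper_filter u GP)) [].
    apply: (@filterS _ G _ setT); last exact: filterT.
    by move=> n _; rewrite /preimage/= in_itv/= -ler_norml HM.
  move=> p [_ clp]; apply/cvg_ex; exists p => A nA.
  have [//|GnA] := in_ultra_setVsetC (u @^-1` A) GU.
  have [q [/= nAq Aq]] : (~` A) `&` A !=set0 by apply: clp.
  by [].
exists (fun u => lim (u @ G)); split.
- by move=> u v /cv cu /cv cw; apply: cvg_lim => //; apply: cvgD.
- by move=> c u /cv cu; apply: cvg_lim => //; apply: cvgMr.
- by move=> c; apply: cvg_lim => //; exact: cvg_cst.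
- move=> u M N /cv cu uM.
  have ev : G [set n | (N <= n)%N] by apply: sG; exists N.
  rewrite ler_norml; apply/andP; split.
    apply: limr_ge => //; apply: filterS ev => n /uM; by rewrite ler_norml => /andP[].
  apply: limr_le => //; apply: filterS ev => n /uM; by rewrite ler_norml => /andP[].
Qed.

End GeneralizedLimit.

(** * Planar sets and complex limits *)

Section PlaneSets.
Context {R : realType}.
Implicit Types (U E K : set (C R)) (b z w : C R) (r : R).

(** An open set is the union of the boxes with rational centre and radius [1/k] that
    it contains. *)
Lemma measurable_open_plane U : open U -> measurable (in_plane U).
Proof.
move=> /open_cP oU.
pose B (q1 q2 : rat) (k : nat) : set (R * R) :=
  box (ratr q1 - k.+1%:R^-1) (ratr q1 + k.+1%:R^-1) (ratr q2 - k.+1%:R^-1) (ratr q2 + k.+1%:R^-1).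
pose F q1 q2 k := if `[< B q1 q2 k `<=` in_plane U >] then B q1 q2 k else set0.
have mF q1 q2 k : measurable (F q1 q2 k).
  by rewrite /F; case: ifP => // _; exact: measurable_box.
have -> : in_plane U = \bigcup_q1 \bigcup_q2 \bigcup_k F q1 q2 k.
  apply/seteqP; split=> p; last first.
    by move=> [q1 _ [q2 _ [k _]]]; rewrite /F; case: ifP => // /asboolP; apply.
  move=> /oU[e e0 He].
  have [k ke] : exists k : nat, k.+1%:R^-1 < e / 4.
    have e4 : 0 <= 4 / e by rewrite divr_ge0// ltW.
    exists (Num.bound (4 / e)); have := archi_boundP e4.
    rewrite -[e / 4]invf_div ltf_pV2 ?posrE ?divr_gt0// => /lt_le_trans; apply.
    by rewrite ler_nat.
  set h := k.+1%:R^-1 in ke; have h0 : 0 < h by rewrite invr_gt0.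
  have near (x : R) : exists q : rat, x - h < ratr q < x + h.
    have xx : x - h < x + h by lra.
    by have [q] := rat_in_itvoo xx; rewrite in_itv/= => Hq; exists q.
  have [q1 /andP[a1 a2]] := near p.1; have [q2 /andP[c1 c2]] := near p.2.
  exists q1 => //; exists q2 => //; exists k => //.
  rewrite /F ifT; first by rewrite /B /box/= -/h; apply/andP; split; apply/andP; split; lra.
  apply/asboolP => x /andP[/andP[x1 x2] /andP[x3 x4]]; apply: He.
  rewrite (le_lt_trans (cabs_le_ReIm _))// ReD ReN ImD ImN/=.
  have b1 : `|x.1 - p.1| <= 2 * h by move: x1 x2; rewrite ler_norml -/h; lra.
  have b2 : `|x.2 - p.2| <= 2 * h by move: x3 x4; rewrite ler_norml -/h; lra.
  by move: b1 b2 ke; lra.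
apply: bigcupT_measurable_rat => q1; apply: bigcupT_measurable_rat => q2.
exact: bigcupT_measurable.
Qed.

Lemma in_planeC E : in_plane (~` E) = ~` in_plane E.
Proof. by []. Qed.

Lemma measurable_notin_plane U : open U -> measurable (in_plane (~` U)).
Proof. by move=> oU; rewrite in_planeC; apply: measurableC; exact: measurable_open_plane. Qed.

Lemma measurable_disc b r : measurable (in_plane (closed_disc b r)).
Proof.
have -> : closed_disc b r = ~` [set z | r < cabs (z - b)].
  by apply/seteqP; split=> z; rewrite /closed_disc/=;
    [move=> h; apply/negP; rewrite -leNgt|move/negP; rewrite -leNgt].
apply: measurable_notin_plane; apply/open_cP => z /= rz.
exists (cabs (z - b) - r); first by rewrite subr_gt0.
by move=> w wz; have := cdistD w z b; rewrite (cdistC z w); move: wz; lra.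
Qed.

Lemma in_box_disc b r : in_box (in_plane (closed_disc b r)).
Proof.
exists (Re b - r), (Re b + r), (Im b - r), (Im b + r) => p; rewrite /closed_disc /in_plane/= => h.
have [] := disc_coord h; rewrite /= !ler_norml => /andP[? ?] /andP[? ?].
by rewrite /box/=; apply/andP; split; apply/andP; split; lra.
Qed.

Lemma rarea_disc_le b r : 0 <= r -> rarea (in_plane (closed_disc b r)) <= 4 * r ^+ 2.
Proof.
move=> r0; have -> : 4 * r ^+ 2 = rarea (box (Re b - r) (Re b + r) (Im b - r) (Im b + r)).
  by rewrite rarea_box; [ring|lra|lra].
apply: rarea_le; [exact: measurable_disc|exact: measurable_box| |].
  by exists (Re b - r), (Re b + r), (Im b - r), (Im b + r).
move=> p; rewrite /closed_disc /in_plane/= => h.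
have [] := disc_coord h; rewrite /= !ler_norml => /andP[? ?] /andP[? ?].
by rewrite /box/=; apply/andP; split; apply/andP; split; lra.
Qed.

Definition cbdd (u : nat -> C R) := exists M, forall n, cabs (u n) <= M.

Lemma generalized_climit : exists L : (nat -> C R) -> C R,
  [/\ forall u v, cbdd u -> cbdd v -> L (fun n => u n + v n) = L u + L v,
      forall c u, cbdd u -> L (fun n => c * u n) = c * L u,
      forall c, L (fun _ => c) = c &
      forall u M N, cbdd u -> (forall n, (N <= n)%N -> cabs (u n) <= M) -> cabs (L u) <= 2 * M].
Proof.
have [L [LD LZ Lc Lb]] := @generalized_limit R.
have bR u : cbdd u -> bdd (fun n => Re (u n)).
  by move=> [M HM]; exists M => n; rewrite (le_trans (Re_le_cabs _)).
have bI u : cbdd u -> bdd (fun n => Im (u n)).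
  by move=> [M HM]; exists M => n; rewrite (le_trans (Im_le_cabs _)).
exists (fun u => (L (fun n => Re (u n)) +i* L (fun n => Im (u n)))%C); split.
- move=> u v bu bv; under eq_fun do rewrite ReD.
  by under [X in (_ +i* L X)%C]eq_fun do rewrite ImD; rewrite !LD; auto.
- move=> [c1 c2] u bu.
  have RM z : Re ((c1 +i* c2)%C * z : C R) = c1 * Re z + (- c2) * Im z.
    by case: z => x y /=; rewrite mulNr.
  have IM z : Im ((c1 +i* c2)%C * z : C R) = c1 * Im z + c2 * Re z.
    by case: z => x y /=.
  have bZ k (w : nat -> R) : bdd w -> bdd (fun n => k * w n).
    by move=> [M HM]; exists (`|k| * M) => n; rewrite normrM ler_wpM2l.
  under eq_fun do rewrite RM.
  under [X in (_ +i* L X)%C]eq_fun do rewrite IM.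
  rewrite !LD; try by apply: bZ; auto.
  rewrite !LZ; try by auto.
  by apply/eqP; rewrite eq_complex/= mulNr !eqxx.
- by move=> [c1 c2] /=; rewrite !Lc.
- move=> u M N bu uM; rewrite (le_trans (cabs_le_ReIm _))//= mulr_natl mulr2n lerD//.
    by apply: (Lb _ _ N); [auto|move=> n /uM; exact: le_trans (Re_le_cabs _)].
  by apply: (Lb _ _ N); [auto|move=> n /uM; exact: le_trans (Im_le_cabs _)].
Qed.

End PlaneSets.

(** * The complement of the domain has density zero at the point *)

Section ComplementArea.
Context {R : realType}.

Definition bounded_on (K : set (C R)) (phi : C R -> C R) :=
  exists B, forall a, K a -> cabs (phi a) <= B.

(** The property of the constant of [potential_bound], named in order to be passed
    as an argument. *)
Definition potential_const (p k : R) := forall rho r (s : seq (R * C R)) b,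
  0 < rho -> rho <= r -> growth rho s ->
  (forall q, q \in s -> 0 < q.1 /\ cabs (q.2 - b) <= r) ->
  forall z, \sum_(q <- s | rho <= cabs (z - q.2)) q.1 / cabs (z - q.2) `^ p <= k * r `^ (2 - p).

(** Integration over [K] with respect to area, as a limit of Riemann sums along
    ever finer discretizations. The last clause is the point: for kernels with poles
    [z] and [w] in [U], arbitrarily close to [K], the bound is uniform, because the
    mesh is eventually finer than the distance of the poles to [K]. *)
Lemma area_functional (U K : set (C R)) b (r : R) : open U -> 0 < r ->
  measurable (in_plane K) -> K `<=` ~` U -> K `<=` closed_disc b r ->
  exists I : (C R -> C R) -> C R,
  [/\ forall phi psi, bounded_on K phi -> bounded_on K psi ->
        I (fun a => phi a + psi a) = I phi + I psi,
      forall c phi, bounded_on K phi -> I (fun a => c * phi a) = c * I phi,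
      I (fun _ => 1) = rc (rarea (in_plane K)),
      forall phi B, (forall a, K a -> cabs (phi a) <= B) ->
        cabs (I phi) <= 2 * (rarea (in_plane K) * B) &
      forall p k, 0 < p -> potential_const p k -> forall z w phi (c : R),
        U z -> U w -> 0 <= c -> bounded_on K phi ->
        (forall a, K a -> cabs (phi a) <= (2 / cabs (z - a) `^ p + 2 / cabs (w - a) `^ p) * c) ->
        cabs (I phi) <= 8 * k * r `^ (2 - p) * c].
Proof.
move=> /open_cP oU r0 mK KU Kb.
have bK : in_box (in_plane K) by apply: in_boxS (in_box_disc b r) => p; exact: Kb.
pose rho (n : nat) := r / n.+1%:R.
have rho0 n : 0 < rho n by rewrite divr_gt0.
have rhor n : rho n <= r by rewrite ler_pdivrMr// ler_peMr ?ler1n// ltW.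
have rhoe (del : R) : 0 < del -> exists N, forall n, (N <= n)%N -> rho n <= del.
  move=> del0; have e0 : 0 <= r / del by rewrite divr_ge0// ltW.
  exists (Num.bound (r / del)) => n Nn; rewrite ler_pdivrMr// mulrC -ler_pdivrMr//.
  have /ltW/le_trans := archi_boundP e0; apply.
  by rewrite ler_nat (leq_trans Nn).
have [s_ Hs] := choice (fun n => @discretize_C R (rho n) K (rho0 n) mK bK).
set m := rarea (in_plane K) in Hs *.
have m0 : 0 <= m by exact: rarea_ge0.
pose S n phi : C R := \sum_(q <- s_ n) rc q.1 * phi q.2.
have Ssum n (F : R * C R -> R) phi : (forall q, q \in s_ n -> cabs (phi q.2) * q.1 <= F q) ->
    cabs (S n phi) <= \sum_(q <- s_ n) F q.
  move=> H; rewrite (le_trans (cabs_sum _ _ _))// [leLHS]big_seq [leRHS]big_seq.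
  apply: ler_sum => q qs; have [h1 _ _] := Hs n; have [q0 _] := h1 q qs.
  by rewrite cabsM cabs_rc gtr0_norm// mulrC H.
have Sb n phi B : (forall a, K a -> cabs (phi a) <= B) -> cabs (S n phi) <= m * B.
  move=> HB; have [h1 <- _] := Hs n; rewrite mulr_suml; apply: Ssum => q qs.
  by have [q0 Kq] := h1 q qs; rewrite mulrC ler_wpM2l ?HB// ltW.
have [L [LD LZ Lc Lb]] := @generalized_climit R.
have bS phi : bounded_on K phi -> cbdd (fun n => S n phi).
  by move=> [B HB]; exists (m * B) => n; exact: Sb.
exists (fun phi => L (fun n => S n phi)); split.
- move=> phi psi b1 b2; rewrite -LD; [|exact: bS|exact: bS].
  congr L; apply/funext => n; rewrite /S -big_split/=.
  by apply: eq_bigr => q _; rewrite mulrDr.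
- move=> c phi b1; rewrite -LZ; last exact: bS.
  congr L; apply/funext => n; rewrite /S mulr_sumr.
  by apply: eq_bigr => q _; rewrite mulrCA.
- rewrite -[RHS]Lc; congr L; apply/funext => n.
  have [_ <- _] := Hs n; rewrite /S rc_sum; by apply: eq_bigr => q _; rewrite mulr1.
- move=> phi B HB; apply: (Lb _ _ 0%N) => [|n _]; last exact: Sb.
  by apply: bS; exists B.
- move=> p k p0 pk z w phi c Uz Uw c0 bphi Hphi.
  have far z' : U z' -> exists N, forall n, (N <= n)%N -> forall a, K a -> rho n <= cabs (z' - a).
    move=> Uz'; have [e e0 He] := oU z' Uz'; have [N HN] := rhoe e e0.
    exists N => n Nn a Ka; rewrite (le_trans (HN n Nn))// leNgt; apply/negP => ae.
    by apply: (KU a Ka); apply: He; rewrite cdistC.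
  have [N1 H1] := far z Uz; have [N2 H2] := far w Uw.
  have -> : 8 * k * r `^ (2 - p) * c = 2 * (4 * (k * r `^ (2 - p)) * c) by ring.
  apply: (Lb _ _ (maxn N1 N2)) => [|n]; first exact: bS.
  rewrite geq_max => /andP[n1 n2]; have [h1 _ h3] := Hs n.
  have pot u : (forall a, K a -> rho n <= cabs (u - a)) ->
      \sum_(q <- s_ n) q.1 / cabs (u - q.2) `^ p <= k * r `^ (2 - p).
    move=> Hu; have H : forall q, q \in s_ n -> 0 < q.1 /\ cabs (q.2 - b) <= r.
      by move=> q qs; have [q0 /Kb] := h1 q qs.
    have -> : \sum_(q <- s_ n) q.1 / cabs (u - q.2) `^ p =
        \sum_(q <- s_ n | rho n <= cabs (u - q.2)) q.1 / cabs (u - q.2) `^ p.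
      rewrite [LHS]big_seq [RHS]big_seq_cond.
      by apply: eq_bigl => q; case qs : (q \in s_ n) => //=; have [_ /Hu ->] := h1 q qs.
    exact: (pk _ _ (s_ n) b (rho0 n) (rhor n) h3 H).
  have HS : cabs (S n phi) <= \sum_(q <- s_ n)
      ((2 * c) * (q.1 / cabs (z - q.2) `^ p) + (2 * c) * (q.1 / cabs (w - q.2) `^ p)).
    apply: Ssum => q qs; have [q0 Kq] := h1 q qs.
    rewrite (le_trans (ler_wpM2r (ltW q0) (Hphi _ Kq)))//.
    by rewrite le_eqVlt; apply/orP; left; apply/eqP; ring.
  rewrite (le_trans HS)// big_split/= -!mulr_sumr.
  have p1 := pot z (H1 n n1); have p2 := pot w (H2 n n2).
  have c2 : 0 <= 2 * c by rewrite mulr_ge0.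
  have := lerD (ler_wpM2l c2 p1) (ler_wpM2l c2 p2).
  move/le_trans; apply; rewrite le_eqVlt; apply/orP; left; apply/eqP; ring.
Qed.

Context (alpha : R) (U : set (C R)) (T : R) (b : C R) (d : (C R -> C R) -> C R).
Context (alpha_gt0 : 0 < alpha) (alpha_lt1 : alpha < 1).
Context (U_open : open U) (U_ne : U !=set0).
Context (U_T : forall z, U z -> cabs z <= T).
Context (b_cl : closure U b).
Context (d_der : point_derivation U alpha b d)
  (d_cont : continuous_functional U alpha d) (d_norm : normalised d).
Local Notation A := (A_ U alpha).

(** With [K] the part of the complement of [U] in a disc of radius [r] around [b],
    [h z = \int_K (a - b)^2 / (z - a)] belongs to the algebra, has a Lipschitz
    constant [O(r^(3 - alpha))], and [d h = - |K|] because
    [h = (z - b)^2 g - |K| (z - b) + const] with [g] the Cauchy transform of [K]. *)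
Lemma complement_area : exists2 Q : R, 0 <= Q & forall r, 0 < r ->
  rarea (in_plane (~` U `&` closed_disc b r)) <= Q * r `^ (3 - alpha).
Proof.
have [M M0 HM] := d_lip alpha_gt0 alpha_lt1 U_open U_ne U_T b_cl d_der d_cont.
have a0 := alpha_gt0; have a1 := alpha_lt1.
pose beta := (1 + alpha) / 2.
have ab : alpha < beta by rewrite /beta; lra.
have beta1 : beta < 1 by rewrite /beta; lra.
have beta0 : 0 < beta by exact: lt_trans ab.
have [KA KA0 HKA] := @potential_bound R (1 + alpha) ltac:(lra) ltac:(lra).
have [KB KB0 HKB] := @potential_bound R (1 + beta) ltac:(lra) ltac:(lra).
have [K1 K10 HK1] := @potential_bound R 1 ltac:(lra) ltac:(lra).
exists (M * (8 * KA)) => [|r r0]; first by rewrite !mulr_ge0// ltW.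
set K := ~` U `&` _.
have mK : measurable (in_plane K).
  by apply: measurableI; [exact: measurable_notin_plane|exact: measurable_disc].
have KU : K `<=` ~` U by move=> z [].
have Kb : K `<=` closed_disc b r by move=> z [].
have [I [ID IZ I1 Ib Ip]] := area_functional U_open r0 mK KU Kb.
set m := rarea _ in I1 Ib *.
have m0 : 0 <= m by exact: rarea_ge0.
have UK z a : U z -> K a -> z != a by move=> Uz [nUa _]; apply: contra_notN nUa => /eqP <-.
have far z : U z -> exists2 del, 0 < del &
    (forall w, cabs (w - z) < del -> U w) /\ forall a, K a -> del <= cabs (z - a).
  move=> Uz; have /open_cP/(_ z Uz)[e e0 He] := U_open; exists e => //; split=> // a [nUa _].
  by rewrite leNgt; apply/negP => ae; apply: nUa; apply: He; rewrite cdistC.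
pose cz z a := (z - a : C R)^-1.
have bcz z : U z -> bounded_on K (cz z).
  move=> /far[e e0 [_ He]]; exists e^-1 => a /He ea.
  by rewrite /cz cabsV lef_pV2 ?posrE// (lt_le_trans e0).
have bN phi psi : bounded_on K phi -> bounded_on K psi -> bounded_on K (fun a => phi a + psi a).
  move=> [B1 H1] [B2 H2]; exists (B1 + B2) => a Ka.
  by rewrite (le_trans (cabsD _ _))// lerD ?H1 ?H2.
have bM phi psi : bounded_on K phi -> bounded_on K psi -> bounded_on K (fun a => phi a * psi a).
  move=> [B1 H1] [B2 H2]; exists (B1 * B2) => a Ka.
  by rewrite cabsM ler_pM ?cabs_ge0 ?H1 ?H2.
have bc c : bounded_on K (fun _ => c) by exists (cabs c).
have IB phi psi : bounded_on K phi -> bounded_on K psi ->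
    I (fun a => phi a + (-1) * psi a) = I phi - I psi.
  by move=> b1 b2; rewrite (ID _ _ b1 (bM _ _ (bc (-1)) b2)) (IZ _ _ b2) mulN1r.
have Ieq phi psi : bounded_on K phi -> bounded_on K psi ->
    (forall a, K a -> phi a = psi a) -> I phi = I psi.
  move=> b1 b2 H; apply/eqP; rewrite -subr_eq0 -IB// -cabs_eq0 eq_le cabs_ge0 andbT.
  have := Ib (fun a => phi a + (-1) * psi a) 0; rewrite mulr0 mulr0; apply.
  by move=> a Ka; rewrite H// mulN1r subrr cabs0.
pose g z := I (cz z).
have gdiff z w : U z -> U w -> g z - g w = I (fun a => cz z a + (-1) * cz w a).
  by move=> Uz Uw; rewrite (IB _ _ (bcz z Uz) (bcz w Uw)).
have bdiff z w : U z -> U w -> bounded_on K (fun a => cz z a + (-1) * cz w a).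
  by move=> Uz Uw; exact: (bN _ _ (bcz z Uz) (bM _ _ (bc (-1)) (bcz w Uw))).
have gbeta z w : U z -> U w ->
    cabs (g z - g w) <= 8 * KB * r `^ (2 - (1 + beta)) * cabs (z - w) `^ beta.
  move=> Uz Uw; rewrite gdiff//; apply: (Ip (1 + beta) KB _ HKB z w) => //; first by lra.
  - exact: powR_ge0.
  - exact: bdiff.
  - by move=> a Ka; rewrite mulN1r; apply: cauchy_kernel => //; exact: UK.
have gbd z : U z -> cabs (g z) <= 8 * K1 * r `^ (2 - 1) * 1.
  move=> Uz; apply: (Ip 1 K1 _ HK1 z z) => //; first exact: bcz.
  move=> a Ka; rewrite /cz cabsV powRr1 ?cabs_ge0// mulr1.
  have : 0 <= (cabs (z - a))^-1 by rewrite invr_ge0 cabs_ge0.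
  lra.
have gder : holomorphic_on U g.
  move=> z Uz; have [e e0 [He1 He2]] := far z Uz; apply/derivable_cP.
  (* The derivative of the Cauchy kernel; the remainder of the first-order
     expansion is [(w - z)^2 / ((w - a) (z - a)^2)]. *)
  pose phi2 a := (-1) * (cz z a * cz z a).
  have b2 := bM _ _ (bcz z Uz) (bcz z Uz).
  have bphi2 : bounded_on K phi2 by exact: (bM _ _ (bc (-1)) b2).
  exists (I phi2) => k k0; pose Y := 2 * (m * (2 / e ^+ 3)).
  have Y0 : 0 <= Y by rewrite !mulr_ge0 ?invr_ge0 ?exprn_ge0// ltW.
  have Y1 : 0 < Y + 1 by rewrite ltr_wpDl.
  exists (Num.min (e / 2) (k / (Y + 1))); first by rewrite lt_min !divr_gt0.
  move=> w; rewrite lt_min => /andP[w1 w2].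
  have Uw : U w by apply: He1; move: w1; lra.
  have -> : g w - g z - I phi2 * (w - z) =
      I (fun a => (cz w a + (-1) * cz z a) + (-1) * ((w - z) * phi2 a)).
    rewrite (IB _ _ (bdiff w z Uw Uz) (bM _ _ (bc (w - z)) bphi2)) -gdiff//.
    by rewrite (IZ _ _ bphi2) [I phi2 * _]mulrC.
  have -> : I (fun a => (cz w a + (-1) * cz z a) + (-1) * ((w - z) * phi2 a)) =
      I (fun a => (w - z) ^+ 2 * (cz w a * (cz z a * cz z a))).
    apply: Ieq.
    - exact: (bN _ _ (bdiff w z Uw Uz) (bM _ _ (bc (-1)) (bM _ _ (bc (w - z)) bphi2))).
    - exact: (bM _ _ (bc ((w - z) ^+ 2)) (bM _ _ (bcz w Uw) b2)).
    - move=> a Ka; have za := UK z a Uz Ka; have wa := UK w a Uw Ka.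
      by rewrite /phi2 /cz; field; rewrite !subr_eq0 za wa.
  have h := Ib (fun a => (w - z) ^+ 2 * (cz w a * (cz z a * cz z a)))
      (cabs (w - z) ^+ 2 * (2 / e ^+ 3)).
  apply: (@le_trans _ _ (2 * (m * (cabs (w - z) ^+ 2 * (2 / e ^+ 3))))).
    apply: h => a Ka; rewrite cabsM cabsX ler_wpM2l ?exprn_ge0 ?cabs_ge0//.
    have -> : 2 / e ^+ 3 = (e / 2)^-1 * (e^-1 * e^-1) by field; rewrite gt_eqF.
    have e2 : 0 < e / 2 by rewrite divr_gt0.
    have h1 := He2 a Ka; have h2 : e / 2 <= cabs (w - a).
      by have := cdistD w z a; rewrite (cdistC z w); move: h1 w1; lra.
    have c1 : cabs (cz z a) <= e^-1 by rewrite cabsV lef_pV2 ?posrE// (lt_le_trans e0).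
    have c2 : cabs (cz w a) <= (e / 2)^-1 by rewrite cabsV lef_pV2 ?posrE// (lt_le_trans e2).
    by rewrite !cabsM ler_pM ?mulr_ge0 ?cabs_ge0// ler_pM ?cabs_ge0.
  have -> : 2 * (m * (cabs (w - z) ^+ 2 * (2 / e ^+ 3))) = Y * cabs (w - z) * cabs (w - z).
    by rewrite /Y; ring.
  rewrite ler_wpM2r ?cabs_ge0//.
  rewrite (@le_trans _ _ ((Y + 1) * cabs (w - z)))//.
    by rewrite ler_wpM2r ?cabs_ge0// lerDl.
  by rewrite mulrC -ler_pdivlMr// ltW.
have Ag : A g.
  apply: (A_mk alpha_gt0 U_open U_ne gder gbd).
  exact: (little_of_exponent alpha_gt0 ab gbeta).
have Ac c : A (fun _ => c) by exact: (A_const alpha_gt0 alpha_lt1 U_open U_ne).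
have AD f1 f2 : A f1 -> A f2 -> A (fun z => f1 z + f2 z).
  exact: (A_add alpha_gt0 U_open U_ne U_T).
have AM f1 f2 : A f1 -> A f2 -> A (fun z => f1 z * f2 z).
  exact: (A_mul alpha_gt0 U_open U_ne U_T).
have Az : A (fun z => z - b).
  by apply: (AD (fun z => z) (fun _ => - b)); [exact: (A_id alpha_gt0 alpha_lt1 U_open U_ne U_T)|].
pose e0 := I (fun a => a - b).
pose h0 z := (z - b) * ((z - b) * g z).
pose h1 z := (- rc m) * (z - b).
pose h z := (h0 z + h1 z) + (- e0).
have Ah0 : A h0 by apply: (AM _ _ Az); exact: AM.
have Ah1 : A h1 by exact: (AM _ _ (Ac _) Az).
have Ah01 : A (fun z => h0 z + h1 z) by exact: AD.
have Ah : A h by exact: (AD _ _ Ah01 (Ac _)).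
have Aid : A (fun z => z) by exact: (A_id alpha_gt0 alpha_lt1 U_open U_ne U_T).
have dC f c : A f -> d (fun z => f z + c) = d f.
  exact: (d_addcst alpha_gt0 alpha_lt1 U_open U_ne U_T b_cl d_der).
have dD f1 f2 : A f1 -> A f2 -> d (fun z => f1 z + f2 z) = d f1 + d f2.
  exact: (d_add alpha_gt0 alpha_lt1 U_open U_ne U_T d_der).
have dZ c f : A f -> d (fun z => c * f z) = c * d f.
  exact: (d_scale alpha_gt0 alpha_lt1 U_open U_ne U_T d_der).
have dz : d (fun z => z - b) = 1 by exact: (etrans (dC _ (- b) Aid) d_norm).
have evs f : A f -> ext_value U b (fun z => (z - b) * f z) = 0.
  exact: (ev_shrinkA alpha_gt0 U_open U_ne U_T b_cl).
have evz : ext_value U b (fun z => z - b) = 0.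
  have := evs _ (Ac 1); under eq_fun do rewrite mulr1.
  by [].
have dh : d h = - rc m.
  rewrite (dC _ (- e0) Ah01) (dD _ _ Ah0 Ah1) (dZ _ _ Az) dz mulr1.
  rewrite (d_leibniz d_der Az (AM _ _ Az Ag)) evz (evs _ Ag).
  by rewrite mul0r mul0r addr0 add0r.
have bab : bounded_on K (fun a => a - b) by exists r => a /Kb.
(* [(a - b)^2 / (z - a) = (z - b)^2 / (z - a) - (z - b) - (a - b)]. *)
have hE z : U z -> h z = I (fun a => (a - b) ^+ 2 * cz z a).
  move=> Uz.
  have bz1 := bM _ _ (bc ((z - b) ^+ 2)) (bcz z Uz).
  have bz2 := bM _ _ (bc (z - b)) (bc 1).
  have b12 := bN _ _ bz1 (bM _ _ (bc (-1)) bz2).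
  transitivity (I (fun a => ((z - b) ^+ 2 * cz z a + (-1) * ((z - b) * 1)) + (-1) * (a - b))).
    rewrite (IB _ _ b12 bab) (IB _ _ bz1 bz2) (IZ _ _ (bcz z Uz)) (IZ _ _ (bc 1)).
    by rewrite I1 /h /h0 /h1 -/(g z) -/e0; ring.
  apply: Ieq.
  - exact: (bN _ _ b12 (bM _ _ (bc (-1)) bab)).
  - exact: (bM _ _ (bM _ _ bab bab) (bcz z Uz)).
  - move=> a Ka; have za := UK z a Uz Ka.
    by rewrite /cz; field; rewrite subr_eq0.
have hlip : lip alpha U (8 * KA * r `^ (3 - alpha)) h.
  move=> z w Uz Uw; rewrite !hE//.
  have bz u : U u -> bounded_on K (fun a => (a - b) ^+ 2 * cz u a).
    by move=> Uu; exact: (bM _ _ (bM _ _ bab bab) (bcz u Uu)).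
  rewrite -(IB _ _ (bz z Uz) (bz w Uw)).
  have -> : 8 * KA * r `^ (3 - alpha) * cabs (z - w) `^ alpha =
     8 * KA * r `^ (2 - (1 + alpha)) * (r ^+ 2 * cabs (z - w) `^ alpha).
    have -> : r `^ (3 - alpha) = r `^ (2 - (1 + alpha)) * r ^+ 2; last by ring.
    rewrite -(@powR_mulrn _ r 2) ?ltW// -powRD ?(gt_eqF r0) ?implybT//.
    by congr (_ `^ _); ring.
  apply: (Ip (1 + alpha) KA _ HKA z w) => //; first by lra.
  - by rewrite mulr_ge0 ?exprn_ge0 ?powR_ge0// ltW.
  - exact: (bN _ _ (bz z Uz) (bM _ _ (bc (-1)) (bz w Uw))).
  - move=> a Ka; rewrite mulN1r -mulrBr cabsM cabsX.
    have -> : (2 / cabs (z - a) `^ (1 + alpha) + 2 / cabs (w - a) `^ (1 + alpha)) *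
       (r ^+ 2 * cabs (z - w) `^ alpha) = r ^+ 2 * ((2 / cabs (z - a) `^ (1 + alpha) +
       2 / cabs (w - a) `^ (1 + alpha)) * cabs (z - w) `^ alpha) by rewrite mulrCA.
    rewrite ler_pM ?exprn_ge0 ?cabs_ge0//.
      have abr : cabs (a - b) <= r by exact: Kb.
      by rewrite lerXn2r ?nnegrE ?cabs_ge0 ?(ltW r0).
    by apply: cauchy_kernel => //; exact: UK.
have k0 : 0 <= 8 * KA * r `^ (3 - alpha) by rewrite !mulr_ge0 ?powR_ge0// ltW.
have := HM h _ Ah k0 hlip; rewrite dh cabsN cabs_rc ger0_norm//.
by move/le_trans; apply; rewrite le_eqVlt; apply/orP; left; apply/eqP; ring.
Qed.

End ComplementArea.

(** * Bad points and kernel estimates *)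

Section Hump.
Context {R : realType}.
Context (alpha : R) (U : set (C R)) (T : R) (b : C R) (d : (C R -> C R) -> C R).
Context (alpha_gt0 : 0 < alpha) (alpha_lt1 : alpha < 1).
Context (U_open : open U) (U_ne : U !=set0).
Context (U_T : forall z, U z -> cabs z <= T).
Context (b_cl : closure U b) (b_notin : ~ U b).
Context (d_der : point_derivation U alpha b d) (d_norm : normalised d).
Local Notation A := (A_ U alpha).

(** The basic identity, in which [w] is the point whose distance to [a] appears in
    both terms; the caller chooses it to be the better one. *)
Lemma quotient_diff f g a z w : U z -> U w ->
  (forall u, U u -> f u - f a = (u - a) * g u) -> lip alpha U 1 f -> U a ->
  z != a -> w != a ->
  cabs (g z - g w) <= ((cabs (w - a))^-1 + cabs (z - w) `^ (1 - alpha) *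
     cabs (z - a) `^ alpha / (cabs (z - a) * cabs (w - a))) * cabs (z - w) `^ alpha.
Proof.
move=> Uz Uw fg f1 Ua za wa; have za0 : z - a != 0 by rewrite subr_eq0.
have wa0 : w - a != 0 by rewrite subr_eq0.
have -> : g z - g w = (f z - f w) / (w - a) - (f z - f a) * (z - w) / ((z - a) * (w - a)).
  have -> : f z - f w = (z - a) * g z - (w - a) * g w by rewrite -!fg//; ring.
  by rewrite fg//; field; rewrite za0 wa0.
set D := cabs (z - w); set x := cabs (z - a); set y := cabs (w - a).
have x0 : 0 < x by rewrite cabs_gt0. have y0 : 0 < y by rewrite cabs_gt0.
rewrite (le_trans (cabsB _ _))// [leRHS]mulrDl lerD//.
  rewrite cabsf -/y mulrC ler_wpM2l ?invr_ge0 ?cabs_ge0//.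
  by have := f1 z w Uz Uw; rewrite mul1r.
rewrite cabsf !cabsM -/x -/y -/D [leRHS]mulrAC ler_wpM2r ?invr_ge0 ?mulr_ge0 ?cabs_ge0//.
rewrite {1}(@powR_split R alpha D) ?cabs_ge0//.
have -> : D `^ (1 - alpha) * x `^ alpha * D `^ alpha = x `^ alpha * (D `^ (1 - alpha) * D `^ alpha).
  by ring.
rewrite ler_wpM2r ?mulr_ge0 ?powR_ge0//.
by have := f1 z a Uz Ua; rewrite mul1r.
Qed.

(** Averaged over [a] in a disc of radius [r], this is [O(1/r)] whatever [z] and [w]
    are. *)
Lemma quotient_diff_unif f g a z w : U z -> U w ->
  (forall u, U u -> f u - f a = (u - a) * g u) -> lip alpha U 1 f -> U a ->
  z != a -> w != a ->
  cabs (g z - g w) <= (3 / cabs (z - a) + 3 / cabs (w - a)) * cabs (z - w) `^ alpha.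
Proof.
move=> Uz Uw fg f1 Ua za wa; rewrite (le_trans (quotient_diff Uz Uw fg f1 Ua za wa))//.
rewrite ler_wpM2r ?powR_ge0//.
set D := cabs (z - w); set x := cabs (z - a); set y := cabs (w - a).
have x0 : 0 < x by rewrite cabs_gt0 subr_eq0. have y0 : 0 < y by rewrite cabs_gt0 subr_eq0.
have D0 : 0 <= D by exact: cabs_ge0.
have Dxy : D <= x + y by rewrite /D /y (cdistC w) cdistD.
have ix : 0 < x^-1 by rewrite invr_gt0. have iy : 0 < y^-1 by rewrite invr_gt0.
have xa : 0 < x `^ alpha by rewrite powR_gt0.
have a1 : 0 <= 1 - alpha by rewrite subr_ge0 ltW.
have [xy|/ltW yx] := leP x y.
  have Dy : D <= 2 * y by lra.
  have h := kernel_half alpha_gt0 alpha_lt1 x0 xy D0 Dy.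
  have -> : D `^ (1 - alpha) * x `^ alpha / (x * y) = (D `^ (1 - alpha) / (x * y)) * x `^ alpha.
    by rewrite mulrAC.
  have h2 : (D `^ (1 - alpha) / (x * y)) * x `^ alpha <= 2 / x.
    rewrite (le_trans (ler_wpM2r (ltW xa) h))//.
    rewrite powRD ?(gt_eqF x0) ?implybT// powRr1 ?(ltW x0)//.
    rewrite le_eqVlt; apply/orP; left; apply/eqP; field.
    by rewrite !gt_eqF.
  by move: h2; lra.
have Dx : D <= 2 * x by lra.
have h1 : D `^ (1 - alpha) <= 2 * x `^ (1 - alpha).
  rewrite (le_trans (powR_le a1 D0 Dx))// powRM ?(ltW x0)//.
  rewrite ler_wpM2r ?powR_ge0//; apply: ler1_powR; rewrite ?ler1n//.
  by rewrite gerBl ltW.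
have h2 : D `^ (1 - alpha) * x `^ alpha / (x * y) <= 2 / y.
  rewrite ler_pdivrMr ?mulr_gt0// (le_trans (ler_wpM2r (ltW xa) h1))//.
  rewrite -mulrA -powR_split ?(ltW x0)//.
  by rewrite le_eqVlt; apply/orP; left; apply/eqP; field; rewrite gt_eqF.
by move: h2; lra.
Qed.

(** When [w] is at a distance of order [t] from the points [a], much larger than
    their distance [r] to [b], the average is smaller by a factor [(r/t)^alpha]. *)
Lemma quotient_diff_far f g a z w t : U z -> U w ->
  (forall u, U u -> f u - f a = (u - a) * g u) -> lip alpha U 1 f -> U a ->
  z != a -> 0 < t -> t / 2 <= cabs (w - a) -> cabs (z - w) <= 2 * t ->
  cabs (g z - g w) <= (2 / t + 4 / t `^ alpha / cabs (z - a) `^ (1 - alpha)) *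
    cabs (z - w) `^ alpha.
Proof.
move=> Uz Uw fg f1 Ua za t0 ty Dt; have t2 : 0 < t / 2 by rewrite divr_gt0.
have wa : w != a by rewrite -subr_eq0 -cabs_gt0 (lt_le_trans t2).
rewrite (le_trans (quotient_diff Uz Uw fg f1 Ua za wa))// ler_wpM2r ?powR_ge0//.
set D := cabs (z - w) in Dt *; set x := cabs (z - a); set y := cabs (w - a) in ty *.
have x0 : 0 < x by rewrite cabs_gt0 subr_eq0. have y0 : 0 < y by rewrite cabs_gt0 subr_eq0.
have D0 : 0 <= D by exact: cabs_ge0.
have a1 : 0 <= 1 - alpha by rewrite subr_ge0 ltW.
have yi : y^-1 <= 2 / t by rewrite -[2 / t]invf_div lef_pV2 ?posrE.
rewrite lerD//.
have h1 : D `^ (1 - alpha) <= 2 * t `^ (1 - alpha).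
  rewrite (le_trans (powR_le a1 D0 Dt))// powRM ?(ltW t0)//.
  rewrite ler_wpM2r ?powR_ge0//; apply: ler1_powR; rewrite ?ler1n//.
  by rewrite gerBl ltW.
have xa : 0 < x `^ alpha by rewrite powR_gt0.
have xb : 0 < x `^ (1 - alpha) by rewrite powR_gt0.
have ta : 0 < t `^ alpha by rewrite powR_gt0.
have ex : x = x `^ (1 - alpha) * x `^ alpha by exact: powR_split (ltW x0) _ _.
have et : t = t `^ (1 - alpha) * t `^ alpha by exact: powR_split (ltW t0) _ _.
have -> : D `^ (1 - alpha) * x `^ alpha / (x * y) = D `^ (1 - alpha) * (y^-1 / x `^ (1 - alpha)).
  rewrite {2}ex; field; by rewrite !gt_eqF.
apply: (@le_trans _ _ (2 * t `^ (1 - alpha) * ((2 / t) / x `^ (1 - alpha)))).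
  rewrite ler_pM ?powR_ge0 ?mulr_ge0 ?invr_ge0 ?powR_ge0 ?(ltW y0)//.
  by rewrite ler_wpM2r ?invr_ge0 ?powR_ge0.
have tb : 0 < t `^ (1 - alpha) by rewrite powR_gt0.
rewrite {2}et le_eqVlt; apply/orP; left; apply/eqP; field.
by rewrite !gt_eqF.
Qed.

Definition quot_err f a := (f a - ext_value U b f) / (a - b) - d f.

(** The points where the difference quotient is off by more than [del] for some
    function of the unit ball; a supremum over the ball would have to be proved
    finite first. *)
Definition bad_point (del : R) : set (C R) :=
  [set a | U a /\ exists f, [/\ A f, lip alpha U 1 f & del < cabs (quot_err f a)]].

Lemma U_neq_b a : U a -> a != b.
Proof. by move=> Ua; apply: contra_notN b_notin => /eqP <-. Qed.

Lemma bad_open del : open (bad_point del).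
Proof.
apply/open_cP => a [Ua [f [Af f1 fa]]].
have hf : holomorphic_on U f by case: Af.
have cont : ccont_on U (quot_err f).
  apply: cdiff_cont_on => z Uz; apply/derivable_cP.
  have zb : z - b != 0 by rewrite subr_eq0 U_neq_b.
  have h1 := @derivable_addcst R f (- ext_value U b f) z (hf z Uz).
  have h2 := @derivable_invc R (fun u => u - b) z zb (@derivable_addcst R _ (- b) z
    (@derivable_idc R z)).
  exact: (@derivable_addcst R _ (- d f) z (derivable_mulc h1 h2)).
have e0 : 0 < (cabs (quot_err f a) - del) / 2 by rewrite divr_gt0// subr_gt0.
have [eta eta0 H] := cont a Ua _ e0.
have /open_cP/(_ a Ua)[e1 e10 H1] := U_open.
exists (Num.min eta e1); first by rewrite lt_min eta0.
move=> w; rewrite lt_min => /andP[w1 w2]; have Uw := H1 w w2.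
split=> //; exists f; split=> //; have := H w Uw w1.
have := cabsD (quot_err f w) (quot_err f a - quot_err f w);
  rewrite subrKC [cabs (quot_err f a - _)]cdistC.
by move: fa; lra.
Qed.

(** Indicator functions let bounds that depend on the position of a point be added
    up term by term. *)
Lemma sum_ind (s : seq (R * C R)) (P : pred (R * C R)) (G : R * C R -> R) :
  \sum_(q <- s) (P q)%:R * G q = \sum_(q <- s | P q) G q.
Proof.
rewrite [RHS]big_mkcond; apply: eq_bigr => q _.
by case: (P q); rewrite ?mul1r ?mul0r.
Qed.

(** By [quotient_error] the quotient [g] at [a] of a function showing that [a] is bad
    has [|(a - b) d g| > del]; multiplying by a number of modulus 1 makes this value
    positive, so that such functions can be averaged over different [a]. *)
Lemma bad_witness del dd Kq a : 0 < del ->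
  (forall a f, (forall z, cabs (z - a) <= 4 * dd -> U z) -> A f -> lip alpha U 1 f ->
    exists g, [/\ A g, forall z, U z -> f z - f a = (z - a) * g z & lip alpha U Kq g]) ->
  bad_point del a -> (forall z, cabs (z - a) <= 4 * dd -> U z) ->
  exists g, [/\ A g, lip alpha U Kq g, del <= Re ((a - b) * d g) &
    exists f, lip alpha U 1 f /\ forall z, U z -> f z - f a = (z - a) * g z].
Proof.
move=> del0 HK [Ua [f [Af f1 fa]]] aU; have [g [Ag fg gK]] := HK a f aU Af f1.
have e := quotient_error alpha_gt0 alpha_lt1 U_open U_ne U_T b_cl d_der d_norm
  Af Ag (U_neq_b Ua) fg.
set L := cabs (quot_err f a) in fa; have L0 : 0 < L by exact: lt_trans fa.
have En0 : quot_err f a != 0 by rewrite -cabs_gt0.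
pose th := rc L / quot_err f a.
have th1 : cabs th = 1 by rewrite cabsf cabs_rc gtr0_norm// divff// gt_eqF.
have lipZ k h : lip alpha U k h -> lip alpha U k (fun z => th * h z).
  by move=> hk z w Uz Uw; rewrite -mulrBr cabsM th1 mul1r; exact: hk.
exists (fun z => th * g z); split.
- exact: (A_scale alpha_gt0 alpha_lt1 U_open U_ne U_T).
- exact: lipZ.
- rewrite (d_scale alpha_gt0 alpha_lt1 U_open U_ne U_T d_der)//.
  by rewrite mulrCA -e -/(quot_err f a) /th divfK//= ltW.
- exists (fun z => th * f z); split; first exact: lipZ.
  by move=> z Uz; rewrite -mulrBr fg// mulrCA.
Qed.

End Hump.

(** * Test functions at a given scale *)

Section HumpConstruction.
Context {R : realType}.
Context (alpha : R) (U : set (C R)) (T : R) (b : C R) (d : (C R -> C R) -> C R).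
Context (alpha_gt0 : 0 < alpha) (alpha_lt1 : alpha < 1).
Context (U_open : open U) (U_ne : U !=set0).
Context (U_T : forall z, U z -> cabs z <= T).
Context (b_cl : closure U b) (b_notin : ~ U b).
Context (d_der : point_derivation U alpha b d) (d_norm : normalised d).
Local Notation A := (A_ U alpha).
Local Notation bad_point := (bad_point alpha U b d).

(** With a strict inequality this set is closed, hence measurable. *)
Definition deep (c : R) : set (C R) := [set a | forall z, cabs (z - a) < c -> U z].

Lemma measurable_deep c : measurable (in_plane (deep c)).
Proof.
have -> : deep c = ~` [set a | exists2 z, cabs (z - a) < c & ~ U z].
  apply/seteqP; split=> a.
    by move=> H [z za nUz]; apply: nUz; exact: H.
  by move=> H z za; apply: contrapT => nUz; apply: H; exists z.
apply: measurable_notin_plane; apply/open_cP => a [z za nUz].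
exists (c - cabs (z - a)); first by rewrite subr_gt0.
move=> w wa; exists z => //; have := cdistD a z w; rewrite (cdistC a w).
by move: wa; lra.
Qed.

(** Continuity of area from below. Keeping away from the complement is necessary, as
    the constants of [A_quotient] blow up at the boundary. *)
Lemma deep_part (K : set (C R)) (c : R) : measurable (in_plane K) -> in_box (in_plane K) ->
  K `<=` U -> c < rarea (in_plane K) ->
  exists2 dd : R, 0 < dd & c < rarea (in_plane (K `&` deep (8 * dd))).
Proof.
move=> mK bK KU cK.
pose F (n : nat) := in_plane (K `&` deep (8 * n.+1%:R^-1)).
have mF n : measurable (F n) by apply: measurableI => //; exact: measurable_deep.
have bF n : in_box (F n) by apply: in_boxS bK => p [].
have UF : \bigcup_n F n = in_plane K.
  apply/seteqP; split=> p; first by move=> [n _ []].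
  move=> Kp; have /open_cP/(_ _ (KU _ Kp))[e e0 He] := U_open.
  have e4 : 0 <= 8 / e by rewrite divr_ge0// ltW.
  exists (Num.bound (8 / e)) => //; split=> // z zp; apply: He; apply: lt_le_trans zp _.
  rewrite ler_pdivrMr// -ler_pdivrMl// mulrC.
  by have /ltW/le_trans := archi_boundP e4; apply; rewrite ler_nat.
have incF : nondecreasing_seq F.
  move=> n k nk; apply/subsetPset => p [Kp Hp]; split=> // z zp; apply: Hp.
  apply: lt_le_trans zp _; rewrite ler_pM2l// lef_pV2 ?posrE//.
  by rewrite ler_nat ltnS.
apply: contrapT => H.
have le n : ((@lebesgue_measure R \x @lebesgue_measure R) (F n) <= c%:E)%E.
  rewrite -rareaE// lee_fin leNgt; apply/negP => cF; apply: H.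
  by exists n.+1%:R^-1 => //; rewrite invr_gt0.
have mUF : measurable (\bigcup_n F n) by rewrite UF.
have cv := @nondecreasing_cvg_mu _ _ _ (@lebesgue_measure R \x @lebesgue_measure R)%E F mF mUF incF.
have h : ((@lebesgue_measure R \x @lebesgue_measure R) (in_plane K) <= c%:E)%E.
  by rewrite -UF; apply: (cvge_le _ cv); exact: nearW.
by move: h; rewrite -rareaE// lee_fin leNgt cK.
Qed.

(** Test functions at scale [r]. If the bad points occupy the proportion [eps] of
    the disc of radius [r], then averaging the functions [(a - b) g] of
    [bad_witness] over a fine discretization of these points gives [h] with
    [d h >= del]. By the potential estimates the Lipschitz constant of [h] does not
    depend on [r], and [h] hardly varies at distances from [b] much larger than [r].
    Points [a] closer than the mesh [rho] to [z] or [w] escape these estimates; they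
    carry a mass [O(rho^2)], and [A_quotient] bounds their contribution by a constant
    that does not depend on [rho], so that a small [rho] makes it negligible. *)
Lemma hump del eps : 0 < del -> 0 < eps -> exists B0 B1, [/\ 0 <= B0, 0 <= B1 &
  forall r, 0 < r -> eps * r ^+ 2 < rarea (in_plane (bad_point del `&` closed_disc b r)) ->
  exists h, [/\ A h, del <= Re (d h), lip alpha U B0 h &
    forall z w, U z -> U w -> 2 * r <= cabs (w - b) -> cabs (z - b) <= cabs (w - b) ->
      cabs (h z - h w) <= B1 * (r / cabs (w - b)) `^ alpha * cabs (z - w) `^ alpha]].
Proof.
move=> del0 eps0; have a0 := alpha_gt0; have a1 := alpha_lt1.
have [K1 K10 HK1] := @potential_bound R 1 ltac:(lra) ltac:(lra).
have [K2 K20 HK2] := @potential_bound R (1 - alpha) ltac:(lra) ltac:(lra).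
pose B0 := 6 * K1 / eps + 1; pose B1 := 3 + 4 * K2 / eps.
have B00 : 0 <= 6 * K1 / eps by rewrite !mulr_ge0 ?invr_ge0// ltW.
have B10 : 0 <= 4 * K2 / eps by rewrite !mulr_ge0 ?invr_ge0// ltW.
exists B0, B1; split; rewrite ?addr_ge0// => r r0 hr.
set K0 := bad_point del `&` _ in hr.
have mK0 : measurable (in_plane K0).
  have mb := measurable_open_plane (@bad_open R alpha U b d U_open b_notin del).
  exact: (measurableI _ _ mb (measurable_disc b r)).
have bK0 : in_box (in_plane K0) by apply: in_boxS (in_box_disc b r) => p [].
have K0U : K0 `<=` U by move=> a [[]].
have [dd dd0] := deep_part mK0 bK0 K0U hr; set K := K0 `&` _ => hK.
have mK : measurable (in_plane K) by apply: measurableI => //; exact: measurable_deep.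
have bK : in_box (in_plane K) by apply: in_boxS bK0 => p [].
set m := rarea (in_plane K) in hK.
have er0 : 0 < eps * r ^+ 2 by rewrite mulr_gt0// exprn_gt0.
have m0 : 0 < m by exact: lt_trans hK.
have [Kq Kq0 HKq] := A_quotient alpha_gt0 alpha_lt1 U_open U_ne U_T dd0.
have wit a : exists g, A g /\ (K a -> [/\ lip alpha U Kq g, del <= Re ((a - b) * d g) &
    exists f, lip alpha U 1 f /\ forall z, U z -> f z - f a = (z - a) * g z]).
  have [[[ba Da] dpa]|nK] := pselect (K a); last first.
    by exists (fun _ => 0); split => //; exact: (A_const alpha_gt0 alpha_lt1 U_open U_ne).
  have aU z : cabs (z - a) <= 4 * dd -> U z.
    by move=> za; apply: dpa; apply: le_lt_trans za _; lra.
  have [g [Ag gK dg fg]] := bad_witness alpha_gt0 alpha_lt1 U_open U_ne U_T b_cl b_notin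
    d_der d_norm del0 HKq ba aU.
  by exists g.
have [gg Hgg] := choice wit.
pose T2 := T + cabs b + r; have [z0 Uz0] := U_ne.
have T0 : 0 <= T by exact: le_trans (cabs_ge0 _) (U_T Uz0).
have T20 : 0 < T2 by rewrite ltr_wpDl// addr_ge0// cabs_ge0.
(* The admissible contribution of the points closer than [rho]: as [t] is at most
   [T2], it is below both 1 and [(r / t)^alpha]. *)
pose eta := (r / T2) `^ alpha; have eta0 : 0 < eta by rewrite powR_gt0// divr_gt0.
have eta1 : eta <= 1.
  have rT : 0 < r / T2 <= 1.
    by rewrite divr_gt0// ler_pdivrMr// mul1r lerDr addr_ge0// cabs_ge0.
  have r01 : 0 <= r / T2 by case/andP: rT => /ltW.
  have := powR_le (ltW a0) r01 (proj2 (andP rT)).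
  by rewrite powR1.
pose c0 := 32 * (r * Kq / m); have c00 : 0 < c0 by rewrite !mulr_gt0// invr_gt0.
pose rho := Num.min r (Num.min 1 (eta / c0)).
have rho0 : 0 < rho by rewrite !lt_min r0 ltr01 divr_gt0.
have rhor : rho <= r by rewrite ge_min lexx.
have rhoc : c0 * rho ^+ 2 <= eta.
  have r1 : rho <= 1 by rewrite !ge_min lexx orbT.
  have r2 : rho <= eta / c0 by rewrite !ge_min lexx !orbT.
  rewrite mulrC -ler_pdivlMr// (le_trans _ r2)// expr2 ger_pMr//.
have [s [s1 s2 s3]] := discretize_C rho0 mK bK; rewrite -/m in s2.
have sb q : q \in s -> 0 < q.1 /\ cabs (q.2 - b) <= r.
  by move=> /s1[q0 [[_ qb] _]]; split.
pose u (q : R * C R) z := rc (q.1 / m) * ((q.2 - b) * gg q.2 z).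
have Au q : A (u q).
  apply: (A_scale alpha_gt0 alpha_lt1 U_open U_ne U_T).
  apply: (A_scale alpha_gt0 alpha_lt1 U_open U_ne U_T).
  by case: (Hgg q.2).
pose h z := \sum_(q <- s) u q z.
have Ah : A h by exact: (A_sum alpha_gt0 alpha_lt1 U_open U_ne U_T).
have udiff q z w : q \in s -> cabs (u q z - u q w) <=
    r / m * (q.1 * cabs (gg q.2 z - gg q.2 w)).
  move=> qs; have [q0 qb] := sb q qs.
  have -> : u q z - u q w = rc (q.1 / m) * ((q.2 - b) * (gg q.2 z - gg q.2 w)).
    by rewrite /u; ring.
  rewrite !cabsM cabs_rc ger0_norm ?divr_ge0 ?(ltW q0) ?(ltW m0)//.
  have -> : r / m * (q.1 * cabs (gg q.2 z - gg q.2 w)) =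
     q.1 / m * (r * cabs (gg q.2 z - gg q.2 w)) by ring.
  by rewrite ler_wpM2l ?divr_ge0 ?(ltW q0) ?(ltW m0)// ler_wpM2r ?cabs_ge0.
have hdiff z w (G : R * C R -> R) (D : R) : 0 <= D ->
    (forall q, q \in s -> cabs (gg q.2 z - gg q.2 w) <= G q * D) ->
    cabs (h z - h w) <= r / m * (\sum_(q <- s) q.1 * G q) * D.
  move=> D0 HG; rewrite /h -sumrB (le_trans (cabs_sum _ _ _))//.
  rewrite -mulrA mulr_suml mulr_sumr [leLHS]big_seq [leRHS]big_seq.
  apply: ler_sum => q qs; rewrite (le_trans (udiff q z w qs))//.
  rewrite ler_wpM2l ?divr_ge0 ?(ltW r0) ?(ltW m0)// -mulrA.
  by rewrite ler_wpM2l ?HG// ltW// (sb q qs).1.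
have nearE z : \sum_(q <- s) (cabs (z - q.2) < rho)%R%:R * q.1 <= 16 * rho ^+ 2.
  rewrite sum_ind (eq_bigl (fun q => cabs (q.2 - z) < rho)); first exact: s3.
  by move=> q; rewrite cdistC.
have farE z p k : potential_const p k ->
    \sum_(q <- s) (rho <= cabs (z - q.2))%R%:R * (q.1 / cabs (z - q.2) `^ p) <= k * r `^ (2 - p).
  by move=> pk; rewrite sum_ind; exact: (pk _ _ _ b rho0 rhor s3 sb).
have farE1 z : \sum_(q <- s) (rho <= cabs (z - q.2))%R%:R * (q.1 / cabs (z - q.2)) <= K1 * r.
  have := farE z 1 K1 HK1; have -> : (2 : R) - 1 = 1 by ring.
  rewrite powRr1 ?(ltW r0)//; congr (_ <= _); apply: eq_bigr => q _.
  by rewrite powRr1 ?cabs_ge0.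
have nb (P : bool) : 0 <= P%:R :> R by exact: ler0n.
have far_neq z (q : R * C R) : rho <= cabs (z - q.2) -> z != q.2.
  by move=> H; rewrite -subr_eq0 -cabs_gt0 (lt_le_trans rho0).
exists h; split=> //.
- rewrite (d_sum alpha_gt0 alpha_lt1 U_open U_ne U_T b_cl d_der)// Re_sum.
  have -> : del = \sum_(q <- s) q.1 / m * del.
    by rewrite -!mulr_suml s2 divff ?mul1r// gt_eqF.
  rewrite [leLHS]big_seq [leRHS]big_seq; apply: ler_sum => q qs.
  have [q0 Kq2] := s1 q qs; have [Agq /(_ Kq2)[_ dq _]] := Hgg q.2.
  have A1 : A (fun z => (q.2 - b) * gg q.2 z).
    exact: (A_scale alpha_gt0 alpha_lt1 U_open U_ne U_T _ Agq).
  have dS := d_scale alpha_gt0 alpha_lt1 U_open U_ne U_T d_der.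
  rewrite (dS _ _ A1) (dS _ _ Agq).
  have Rrc (x : R) (v : C R) : Re (rc x * v) = x * Re v.
    by case: v => v1 v2 /=; rewrite mul0r subr0.
  by rewrite Rrc ler_wpM2l// divr_ge0 ?ltW.
- move=> z w Uz Uw; set D := _ `^ alpha; have D0 : 0 <= D by exact: powR_ge0.
  (* Near points are charged to [A_quotient], far ones to the kernel estimate. *)
  pose G (q : R * C R) : R := Kq * (cabs (z - q.2) < rho)%R%:R + Kq * (cabs (w - q.2) < rho)%R%:R +
    3 * ((rho <= cabs (z - q.2))%R%:R * (cabs (z - q.2))^-1) +
    3 * ((rho <= cabs (w - q.2))%R%:R * (cabs (w - q.2))^-1).
  have HG q : q \in s -> cabs (gg q.2 z - gg q.2 w) <= G q * D.
    move=> qs; have [q0 Kq2] := s1 q qs; have [Agq /(_ Kq2)[lq _ [f [f1 fg]]]] := Hgg q.2.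
    have Uq : U q.2 by case: Kq2 => /K0U.
    have lq1 := lq z w Uz Uw; rewrite -/D in lq1.
    have i1 : 0 <= (cabs (z - q.2))^-1 by rewrite invr_ge0 cabs_ge0.
    have i2 : 0 <= (cabs (w - q.2))^-1 by rewrite invr_ge0 cabs_ge0.
    have G1 : 0 <= Kq * (cabs (z - q.2) < rho)%R%:R by rewrite mulr_ge0 ?nb ?(ltW Kq0).
    have G2 : 0 <= Kq * (cabs (w - q.2) < rho)%R%:R by rewrite mulr_ge0 ?nb ?(ltW Kq0).
    have G3 : 0 <= 3 * ((rho <= cabs (z - q.2))%R%:R * (cabs (z - q.2))^-1).
      by rewrite !mulr_ge0 ?nb.
    have G4 : 0 <= 3 * ((rho <= cabs (w - q.2))%R%:R * (cabs (w - q.2))^-1).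
      by rewrite !mulr_ge0 ?nb.
    have big k : Kq <= k -> cabs (gg q.2 z - gg q.2 w) <= k * D.
      by move=> Kk; rewrite (le_trans lq1)// ler_wpM2r.
    have [zq|zq] := ltP (cabs (z - q.2)) rho.
      by apply: big; rewrite /G; move: G1 G2 G3 G4; rewrite zq mulr1; lra.
    have [wq|wq] := ltP (cabs (w - q.2)) rho.
      by apply: big; rewrite /G; move: G1 G2 G3 G4; rewrite wq mulr1; lra.
    rewrite /G zq wq !ltNge zq wq !mulr0 !add0r !mul1r.
    have := quotient_diff_unif alpha_gt0 alpha_lt1 Uz Uw fg f1 Uq (far_neq _ _ zq) (far_neq _ _ wq).
    by rewrite -/D.
  rewrite (le_trans (hdiff z w G D D0 HG))// ler_wpM2r//.
  have SG : \sum_(q <- s) q.1 * G q <= Kq * (16 * rho ^+ 2) + Kq * (16 * rho ^+ 2) +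
      3 * (K1 * r) + 3 * (K1 * r).
    have -> : \sum_(q <- s) q.1 * G q =
       Kq * (\sum_(q <- s) (cabs (z - q.2) < rho)%R%:R * q.1) +
       Kq * (\sum_(q <- s) (cabs (w - q.2) < rho)%R%:R * q.1) +
       3 * (\sum_(q <- s) (rho <= cabs (z - q.2))%R%:R * (q.1 / cabs (z - q.2))) +
       3 * (\sum_(q <- s) (rho <= cabs (w - q.2))%R%:R * (q.1 / cabs (w - q.2))).
      rewrite !mulr_sumr -!big_split/=; apply: eq_bigr => q _; rewrite /G; ring.
    by rewrite !lerD// ler_wpM2l// ltW.
  have rm0 : 0 <= r / m by rewrite divr_ge0 ?ltW.
  rewrite (le_trans (ler_wpM2l rm0 SG))//.
  have -> : r / m * (Kq * (16 * rho ^+ 2) + Kq * (16 * rho ^+ 2) + 3 * (K1 * r) + 3 * (K1 * r)) =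
     6 * K1 * (r ^+ 2 / m) + c0 * rho ^+ 2 by rewrite /c0; ring.
  rewrite lerD//; last exact: le_trans rhoc eta1.
  rewrite ler_wpM2l ?mulr_ge0 ?(ltW K10)//.
  by rewrite ler_pdivrMr// -ler_pdivrMl ?invr_gt0// invrK ltW.
- move=> z w Uz Uw; set t := cabs (w - b) => rt zt; set D := cabs (z - w) `^ alpha.
  have D0 : 0 <= D by exact: powR_ge0.
  have t0 : 0 < t by move: r0 rt; lra.
  have ta : 0 < t `^ alpha by rewrite powR_gt0.
  have tT : t <= T2.
    by have := cabsB w b; have := U_T Uw; rewrite -/t /T2; move: r0; lra.
  have Dt : cabs (z - w) <= 2 * t by have := cdistD b z w; rewrite (cdistC b w) -/t; move: zt; lra.
  pose c4 := 4 / t `^ alpha; have c40 : 0 <= c4 by rewrite divr_ge0// ltW.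
  pose G (q : R * C R) : R := Kq * (cabs (z - q.2) < rho)%R%:R + 2 / t +
    c4 * ((rho <= cabs (z - q.2))%R%:R * (cabs (z - q.2) `^ (1 - alpha))^-1).
  have tt : 0 <= 2 / t by rewrite divr_ge0// ltW.
  have HG q : q \in s -> cabs (gg q.2 z - gg q.2 w) <= G q * D.
    move=> qs; have [q0 Kq2] := s1 q qs; have [Agq /(_ Kq2)[lq _ [f [f1 fg]]]] := Hgg q.2.
    have Uq : U q.2 by case: Kq2 => /K0U.
    have lq1 := lq z w Uz Uw; rewrite -/D in lq1.
    have G1 : 0 <= Kq * (cabs (z - q.2) < rho)%R%:R by rewrite mulr_ge0 ?nb ?(ltW Kq0).
    have G3 : 0 <= c4 * ((rho <= cabs (z - q.2))%R%:R * (cabs (z - q.2) `^ (1 - alpha))^-1).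
      by rewrite !mulr_ge0 ?nb ?invr_ge0 ?powR_ge0.
    have [zq|zq] := ltP (cabs (z - q.2)) rho.
      rewrite (le_trans lq1)// ler_wpM2r// /G.
      by move: tt G3; rewrite zq mulr1; lra.
    rewrite /G zq ltNge zq mulr0 add0r mul1r.
    have tq : t / 2 <= cabs (w - q.2).
      have [_ qb] := sb q qs; have := cdistD q.2 w b; rewrite -/t.
      by move: rt qb; lra.
    exact: (quotient_diff_far alpha_gt0 alpha_lt1 Uz Uw fg f1 Uq (far_neq _ _ zq) t0 tq Dt).
  rewrite (le_trans (hdiff z w G D D0 HG))// ler_wpM2r//.
  have SG : \sum_(q <- s) q.1 * G q <= Kq * (16 * rho ^+ 2) + 2 / t * m +
      c4 * (K2 * r `^ (2 - (1 - alpha))).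
    have -> : \sum_(q <- s) q.1 * G q =
       Kq * (\sum_(q <- s) (cabs (z - q.2) < rho)%R%:R * q.1) + 2 / t * (\sum_(q <- s) q.1) +
       c4 * (\sum_(q <- s) (rho <= cabs (z - q.2))%R%:R * (q.1 / cabs (z - q.2) `^ (1 - alpha))).
      rewrite !mulr_sumr -!big_split/=; apply: eq_bigr => q _; rewrite /G; ring.
    by rewrite s2 !lerD// ler_wpM2l ?farE// ltW.
  have rm0 : 0 <= r / m by rewrite divr_ge0 ?ltW.
  rewrite (le_trans (ler_wpM2l rm0 SG))//.
  set rta := (r / t) `^ alpha.
  have rta0 : 0 <= rta by exact: powR_ge0.
  have e1 : rta = r `^ alpha / t `^ alpha.
    by rewrite /rta powRM ?invr_ge0 ?(ltW r0) ?(ltW t0)// -powRN -powR_inv1 ?(ltW t0)//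
      -powRrM mulN1r.
  have e2 : r `^ (2 - (1 - alpha)) = r * r `^ alpha.
    rewrite (_ : 2 - (1 - alpha) = 1 + alpha); last by ring.
    by rewrite powRD ?(gt_eqF r0) ?implybT// powRr1// ltW.
  have -> : r / m * (Kq * (16 * rho ^+ 2) + 2 / t * m + c4 * (K2 * r `^ (2 - (1 - alpha)))) =
     (c0 * rho ^+ 2) / 2 + 2 * (r / t) + 4 * K2 * (r ^+ 2 / m) * rta.
    by rewrite e2 e1 /c0 /c4; field; rewrite !gt_eqF.
  have t1 : (c0 * rho ^+ 2) / 2 <= rta.
    apply: (@le_trans _ _ eta); first by move: rhoc eta0; lra.
    apply: powR_le; rewrite ?(ltW a0)// ?divr_ge0 ?(ltW r0) ?(ltW T20)//.
    by rewrite ler_wpM2l ?(ltW r0)// lef_pV2 ?posrE.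
  have t2 : r / t <= rta.
    apply: ger1_powR; last exact: ltW.
    by rewrite divr_gt0// ler_pdivrMr// mul1r; move: rt r0; lra.
  have t3 : 4 * K2 * (r ^+ 2 / m) * rta <= 4 * K2 / eps * rta.
    rewrite ler_wpM2r// ler_wpM2l ?mulr_ge0 ?(ltW K20)//.
    by rewrite ler_pdivrMr// -ler_pdivrMl ?invr_gt0// invrK ltW.
  by rewrite /B1 [leRHS]mulrDl; move: t1 t2 t3; lra.
Qed.

End HumpConstruction.

(** * Gliding hump *)

Section Gliding.
Context {R : realType}.
Context (alpha : R) (U : set (C R)) (T : R) (b : C R) (d : (C R -> C R) -> C R).
Context (alpha_gt0 : 0 < alpha) (alpha_lt1 : alpha < 1).
Context (U_open : open U) (U_ne : U !=set0).
Context (U_T : forall z, U z -> cabs z <= T).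
Context (b_cl : closure U b) (b_notin : ~ U b).
Context (d_der : point_derivation U alpha b d)
  (d_cont : continuous_functional U alpha d) (d_norm : normalised d).
Local Notation A := (A_ U alpha).
Local Notation bad_point := (bad_point alpha U b d).

(** Gliding hump: test functions living at rapidly decreasing scales can be added
    up without increasing the Lipschitz constant, because each of them is in the
    little class; so infinitely many scales with a positive proportion of bad points
    would make [d] unbounded. *)
Theorem bad_density del eps : 0 < del -> 0 < eps -> exists2 r0 : R, 0 < r0 &
  forall r, 0 < r -> r < r0 -> rarea (in_plane (bad_point del `&` closed_disc b r)) <= eps * r ^+ 2.
Proof.
move=> del0 eps0; apply: contrapT => H.
have scales (r0 : R) : 0 < r0 -> exists r, [/\ 0 < r, r < r0 &
    eps * r ^+ 2 < rarea (in_plane (bad_point del `&` closed_disc b r))].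
  move=> r00; apply: contrapT => nH; apply: H; exists r0 => // r rp rr0.
  by rewrite leNgt; apply/negP => Hr; apply: nH; exists r.
have [B0 [B1 [B00 B10 Hh]]] := hump alpha_gt0 alpha_lt1 U_open U_ne U_T b_cl b_notin
  d_der d_norm del0 eps0.
(* [eta] is halved at each step; the bound [B0 + eta] is never used up. *)
have glide (k : nat) : forall eta : R, 0 < eta -> exists h,
    [/\ A h, k%:R * del <= Re (d h) & lip alpha U (B0 + eta) h].
  elim: k => [|k IH] eta eta0.
    exists (fun _ => 0); split.
    - exact: (A_const alpha_gt0 alpha_lt1 U_open U_ne).
    - by rewrite (d_cst alpha_gt0 alpha_lt1 U_open U_ne U_T b_cl d_der)// mul0r.
    - by move=> z w _ _; rewrite subrr cabs0 mulr_ge0 ?powR_ge0// addr_ge0// ltW.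
  have eta2 : 0 < eta / 2 by rewrite divr_gt0.
  have [h [Ah dh lh]] := IH _ eta2.
  have /A_P-/(_ U_open U_ne)[_ _ /(_ eta eta0)[d1 d10 Hd1]] := Ah.
  have B11 : 0 < B1 + 1 by rewrite ltr_wpDl.
  have [x1 x10 Hx1] := powR_lt_eps alpha_gt0 (divr_gt0 eta2 B11).
  have m0 : 0 < Num.min (d1 / 4) (x1 * (d1 / 2)) by rewrite lt_min !mulr_gt0.
  have [r [r0 rm hr]] := scales _ m0; move: rm; rewrite lt_min => /andP[r1 r2].
  have [u [Au du lu fu]] := Hh r r0 hr.
  exists (fun z => h z + u z); split.
  - exact: (A_add alpha_gt0 U_open U_ne U_T).
  - rewrite (d_add alpha_gt0 alpha_lt1 U_open U_ne U_T d_der)// ReD.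
    by rewrite -natr1 mulrDl mul1r lerD.
  - have wl z w : U z -> U w -> cabs (z - b) <= cabs (w - b) ->
        cabs (h z + u z - (h w + u w)) <= (B0 + eta) * cabs (z - w) `^ alpha.
      move=> Uz Uw zw; rewrite opprD addrACA (le_trans (cabsD _ _))//.
      set D := _ `^ alpha; have D0 : 0 <= D by exact: powR_ge0.
      (* Close to [b] the previous sum [h] is negligible, being in the little class;
         further away the new function [u] is. *)
      have [wd|wd] := ltP (cabs (w - b)) (d1 / 2).
        have zwd : cabs (z - w) < d1.
          by have := cdistD b z w; rewrite (cdistC b w); move: zw wd; lra.
        by rewrite [leLHS]addrC [leRHS]mulrDl lerD//; [exact: lu|exact: Hd1].
      have w0 : 0 < cabs (w - b) by rewrite (lt_le_trans _ wd)// divr_gt0.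
      have rw : 2 * r <= cabs (w - b) by move: r1 wd; lra.
      have e1 : (r / cabs (w - b)) `^ alpha <= eta / 2 / (B1 + 1).
        apply: Hx1; first by rewrite divr_ge0 ?cabs_ge0// ltW.
        by rewrite ltr_pdivrMr// (lt_le_trans r2)// ler_pM2l.
      have e2 : cabs (u z - u w) <= eta / 2 * D.
        rewrite (le_trans (fu z w Uz Uw rw zw))// ler_wpM2r//.
        rewrite (le_trans (ler_wpM2l B10 e1))// mulrA ler_pdivrMr// mulrC.
        by rewrite ler_wpM2l ?(ltW eta2)// lerDl.
      have e3 := lh z w Uz Uw; rewrite -/D in e3.
      rewrite (le_trans (lerD e3 e2))// -mulrDl -addrA -splitr//.
    move=> z w Uz Uw; have [zw|/ltW wz] := leP (cabs (z - b)) (cabs (w - b)).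
      exact: wl.
    by rewrite cdistC [cabs (z - w)]cdistC; exact: wl.
have [M M0 HM] := d_lip alpha_gt0 alpha_lt1 U_open U_ne U_T b_cl d_der d_cont.
have B01 : 0 <= B0 + 1 by rewrite addr_ge0.
have q0 : 0 <= M * (B0 + 1) / del by rewrite !mulr_ge0 ?invr_ge0// ltW.
have [h [Ah dh lh]] := glide (Num.bound (M * (B0 + 1) / del)) 1 ltr01.
have := archi_boundP q0; rewrite ltr_pdivrMr// ltNge => /negP; apply.
rewrite (le_trans dh)// (le_trans (ler_norm _))// (le_trans (Re_le_cabs _))//.
exact: HM.
Qed.

End Gliding.

(** * The area of a disc *)

Section DiscArea.
Context {R : realType}.
Implicit Types (r x : R).
Local Notation mu := (@lebesgue_measure R).

Lemma is_derive_mulr x (f g : R -> R) df dg : is_derive x 1 f df -> is_derive x 1 g dg ->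
  is_derive x 1 (fun x => f x * g x) (df * g x + f x * dg).
Proof.
by move=> h1 h2; apply: (is_derive_eq (is_deriveM h1 h2)); rewrite addrC [df * _]mulrC.
Qed.

Lemma is_derive_invr x (f : R -> R) df : f x != 0 -> is_derive x 1 f df ->
  is_derive x 1 (fun x => (f x)^-1) (- df / f x ^+ 2).
Proof.
move=> h1 h2; apply: (is_derive_eq (is_deriveV h1 h2)).
by rewrite -[LHS]/(- f x ^- 2 * df) mulrC mulrN mulNr.
Qed.

Definition half_chord r x : R := Num.sqrt (r ^+ 2 - x * x).

(** An antiderivative of the chord length, with [asin (x / r)] written as
    [2 atan (x / (r + half_chord r x))] to be continuous at the end points. *)
Definition chord_prim r x : R :=
  x * half_chord r x + r ^+ 2 * (2 * atan (x * (r + half_chord r x)^-1)).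

Lemma is_derive_half_chord r x : 0 < r ^+ 2 - x * x ->
  is_derive x 1 (half_chord r) (- x / half_chord r x).
Proof.
move=> h; have s0 : 0 < half_chord r x by rewrite sqrtr_gt0.
have d2 := is_derive_mulr (is_derive_id x 1) (is_derive_id x 1).
have d1 := is_deriveB (is_derive_cst (r ^+ 2) x 1) d2.
have d3 := @is_derive1_comp R Num.sqrt (fun x => r ^+ 2 - x * x) x _ _ (is_derive1_sqrt h) d1.
apply: (is_derive_eq d3).
by rewrite -/(half_chord r x) /=; field; rewrite gt_eqF.
Qed.

Lemma is_derive_chord_prim r x : 0 < r -> 0 < r ^+ 2 - x * x ->
  is_derive x 1 (chord_prim r) (2 * half_chord r x).
Proof.
move=> r0 h; have s0 : 0 < half_chord r x by rewrite sqrtr_gt0.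
have ss : half_chord r x ^+ 2 = r ^+ 2 - x * x by rewrite sqr_sqrtr// ltW.
have ds := is_derive_half_chord h.
have rs0 : 0 < r + half_chord r x by rewrite addr_gt0.
have drs : is_derive x 1 (fun y => r + half_chord r y) (0 + - x / half_chord r x).
  exact: (is_deriveD (is_derive_cst r x 1) ds).
have dV := @is_derive_invr x (fun y => r + half_chord r y) _ (lt0r_neq0 rs0) drs.
have dy := is_derive_mulr (is_derive_id x 1) dV.
have da := @is_derive1_comp R atan (fun x => x * (r + half_chord r x)^-1) x _ _
  (is_derive1_atan _) dy.
have d1 := is_derive_mulr (is_derive_id x 1) ds.
have d2 := is_derive_mulr (is_derive_cst (r ^+ 2 * 2) x 1) da.
have d3 := is_deriveD d1 d2.
have -> : chord_prim r = (fun x => x * half_chord r x) \+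
    (fun x => r ^+ 2 * 2 * atan (x * (r + half_chord r x)^-1)).
  by apply/funext => y; rewrite /chord_prim /= mulrA.
apply: (is_derive_eq d3) => /=.
set s := half_chord r x in s0 ss rs0 *.
have r2 : r ^+ 2 = s ^+ 2 + x * x by rewrite ss subrK.
have q0 : (r + s) ^+ 2 + x ^+ 2 != 0.
  by rewrite gt_eqF// ltr_wpDr ?sqr_ge0// exprn_gt0.
have q : 1 + (x / (r + s)) ^+ 2 = 2 * r / (r + s).
  have -> : 2 * r / (r + s) = (2 * r ^+ 2 + 2 * r * s) / (r + s) ^+ 2.
    by field; rewrite gt_eqF.
  rewrite {1}r2 [X in (X + _) / _](_ : _ = r ^+ 2 + s ^+ 2 + x * x); last by rewrite r2; ring.
  by field; rewrite gt_eqF.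
rewrite q.
have e : 1 * (r + s)^-1 + x * (- (0 + - x / s) / (r + s) ^+ 2) = r / (s * (r + s)).
  have -> : 1 * (r + s)^-1 + x * (- (0 + - x / s) / (r + s) ^+ 2) =
     (r * s + (s ^+ 2 + x * x)) / (s * (r + s) ^+ 2).
    by field; rewrite !gt_eqF.
  by rewrite -r2; field; rewrite !gt_eqF.
rewrite e.
transitivity ((s ^+ 2 - x * x + r ^+ 2) / s); first by field; rewrite !gt_eqF.
by rewrite r2; field; rewrite gt_eqF.
Qed.

Lemma continuous_half_chord r : continuous (half_chord r).
Proof.
move=> x; apply: (@continuous_comp _ _ _ (fun x : R => r ^+ 2 - x * x) Num.sqrt).
  by apply: cvgB; [exact: cvg_cst|apply: cvgM; exact: cvg_id].
exact: sqrt_continuous.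
Qed.

Lemma continuous_chord_prim r : 0 < r -> continuous (chord_prim r).
Proof.
move=> r0 x; have ch := @continuous_half_chord r.
have rs0 : r + half_chord r x != 0 by rewrite gt_eqF// ltr_wpDr ?sqrtr_ge0.
apply: cvgD; first by apply: cvgM; [exact: cvg_id|exact: ch].
apply: cvgM; first exact: cvg_cst.
apply: cvgM; first exact: cvg_cst.
apply: (@continuous_comp _ _ _ (fun x : R => x * (r + half_chord r x)^-1) atan).
  apply: cvgM; first exact: cvg_id.
  by apply: cvgV => //; apply: cvgD; [exact: cvg_cst|exact: ch].
exact: continuous_atan.
Qed.

Lemma integral_chord r (c : R) : 0 < r ->
  (\int[mu]_(x in [set` `[(c - r)%R, (c + r)%R]]) (2 * half_chord r (x - c))%:E =
    (pi * r ^+ 2)%:E)%E.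
Proof.
move=> r0; have lt : c - r < c + r by lra.
have csub (f : R -> R) : continuous f -> continuous (fun x => f (x - c)).
  move=> cf x; apply: (@continuous_comp _ _ _ (fun x : R => x - c) f); last exact: cf.
  by apply: cvgB; [exact: cvg_id|exact: cvg_cst].
have inside x : x \in `]c - r, c + r[ -> 0 < r ^+ 2 - (x - c) * (x - c).
  rewrite in_itv/= => /andP[h1 h2].
  have -> : r ^+ 2 - (x - c) * (x - c) = (r - (x - c)) * (r + (x - c)) by ring.
  by rewrite mulr_gt0//; lra.
have der x : x \in `]c - r, c + r[ ->
    is_derive x 1 (fun x => chord_prim r (x - c)) (2 * half_chord r (x - c)).
  move=> /inside h; have d1 := is_deriveB (is_derive_id x 1) (is_derive_cst c x 1).
  have := @is_derive1_comp R (chord_prim r) (fun x => x - c) x _ _ (is_derive_chord_prim r0 h) d1.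
  by rewrite subr0 mulr1.
rewrite (@continuous_FTC2 _ (fun x => 2 * half_chord r (x - c))
    (fun x => chord_prim r (x - c)))//.
- have h1 : c + r - c = r by ring. have h2 : c - r - c = - r by ring.
  rewrite h1 h2 -EFinB /chord_prim /half_chord mulrNN expr2 subrr sqrtr0 !addr0 !mulr0 !add0r.
  rewrite mulNr divff ?gt_eqF// atanN atan1; congr EFin; by field.
- apply: continuous_subspaceT => x; apply: cvgM; first exact: cvg_cst.
  exact: (csub _ (@continuous_half_chord r)).
- split=> [x /der[]//| |].
    by apply: cvg_at_right_filter; exact: (csub _ (continuous_chord_prim r0)).
  by apply: cvg_at_left_filter; exact: (csub _ (continuous_chord_prim r0)).
- by move=> x /der d; rewrite derive1E; exact: derive_val.
Qed.

Lemma disc_sectionE (b : C R) r x y : 0 < r ->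
  cabs ((x +i* y)%C - b) <= r <->
  `|x - Re b| <= r /\ `|y - Im b| <= half_chord r (x - Re b).
Proof.
move=> r0; have E : (cabs ((x +i* y)%C - b) <= r) =
    ((x - Re b) * (x - Re b) + (y - Im b) ^+ 2 <= r ^+ 2).
  rewrite -(@ler_pXn2r _ 2) ?nnegrE ?cabs_ge0 ?(ltW r0)// cabs_sqr.
  by rewrite ReD ReN ImD ImN /= -[(x - _) * _]expr2.
rewrite E; set u := x - Re b; set v := y - Im b.
have v0 : 0 <= v ^+ 2 by exact: sqr_ge0.
split=> [h|[h1 h2]].
  have uu : u ^+ 2 <= r ^+ 2 by rewrite expr2; move: h v0; lra.
  split; first by rewrite -(@ler_pXn2r _ 2) ?nnegrE ?(ltW r0)// real_normK ?num_real.
  by rewrite -sqrtr_sqr ler_wsqrtr//; move: h; lra.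
have uu : u ^+ 2 <= r ^+ 2.
  by rewrite -[u ^+ 2]real_normK ?num_real// lerXn2r ?nnegrE ?(ltW r0).
have ss : half_chord r u ^+ 2 = r ^+ 2 - u * u by rewrite sqr_sqrtr// -expr2; move: uu; lra.
have vv : v ^+ 2 <= half_chord r u ^+ 2.
  by rewrite -[v ^+ 2]real_normK ?num_real// lerXn2r ?nnegrE ?sqrtr_ge0.
by move: vv; rewrite ss; lra.
Qed.

Lemma area_disc (b : C R) r : 0 < r -> area (closed_disc b r) = (pi * r ^+ 2)%:E.
Proof.
move=> r0; rewrite /area /product_measure1 -(integral_chord (Re b) r0) [RHS]integral_mkcond.
apply: eq_integral => x _ /=; rewrite patchE.
have secE y : xsection (in_plane (closed_disc b r)) x y <->
    `|x - Re b| <= r /\ `|y - Im b| <= half_chord r (x - Re b).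
  rewrite -disc_sectionE//; split; first by rewrite /xsection/= inE.
  by rewrite /xsection/= inE.
have s0 : 0 <= half_chord r (x - Re b) by exact: sqrtr_ge0.
case: ifPn => [|/negP xD].
  rewrite inE/= in_itv/= => /andP[h1 h2].
  have xr : `|x - Re b| <= r by rewrite ler_norml; lra.
  have -> : xsection (in_plane (closed_disc b r)) x =
      `[Im b - half_chord r (x - Re b), Im b + half_chord r (x - Re b)]%classic.
    apply/seteqP; split=> y.
      by move=> /secE[_]; rewrite /= in_itv/= ler_norml; lra.
    by rewrite /= in_itv/= => /andP[k1 k2]; apply/secE; split=> //; rewrite ler_norml; lra.
  rewrite lebesgue_measure_itv/= lte_fin; case: ltP => k.
    by rewrite -EFinB; congr EFin; ring.
  have -> : half_chord r (x - Re b) = 0 by move: k s0; lra.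
  by rewrite mulr0.
have -> : xsection (in_plane (closed_disc b r)) x = set0.
  apply/seteqP; split=> // y /secE[xr _]; apply: xD; rewrite inE/= in_itv/=.
  by move: xr; rewrite ler_norml; lra.
by rewrite measure0.
Qed.

End DiscArea.

(** * A set of full density avoiding sets of density zero *)

Section DensityOne.
Context {R : realType}.
Implicit Types (b : C R) (E : set (C R)) (r : R).

Definition zero_density b (Z : set (C R)) := forall eps, 0 < eps -> exists2 r0 : R, 0 < r0 &
  forall r, 0 < r -> r < r0 -> rarea (in_plane (Z `&` closed_disc b r)) <= eps * r ^+ 2.

Lemma open_disc_open b r : open [set z : C R | cabs (z - b) < r].
Proof.
apply/open_cP => z /= zr; exists (r - cabs (z - b)); first by rewrite subr_gt0.
by move=> w wz; have := cdistD z w b; move: wz; lra.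
Qed.

(** Remove [Z n] from the [n]-th of a sequence of shells whose radii decrease so fast
    that, in a disc reaching into the [n]-th shell, everything beyond the next shell
    has negligible area; the two shells that matter lose a proportion [O(1/n)]. *)
Lemma avoid_zero_density b (Z : nat -> set (C R)) :
  (forall n, measurable (in_plane (Z n))) -> (forall n, Z n `<=` Z n.+1) ->
  (forall n, zero_density b (Z n)) ->
  exists E, [/\ measurable (in_plane E), full_area_density b E,
    E `<=` ~` Z 0%N, ~ E b &
    forall n, exists2 r0 : R, 0 < r0 & forall a, E a -> cabs (a - b) < r0 -> ~ Z n a].
Proof.
move=> mZ incZ dZ.
have inv0 n : 0 < n.+1%:R^-1 :> R by rewrite invr_gt0.
have rh n : exists r0 : R, 0 < r0 /\ forall r, 0 < r -> r < r0 ->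
    rarea (in_plane (Z n `&` closed_disc b r)) <= n.+1%:R^-1 * r ^+ 2.
  by have [r0 r00 H] := dZ n _ (inv0 n); exists r0.
have [rho Hrho] := choice rh.
pose r_ := fix r_ n := if n is m.+1 then Num.min (rho m.+1 / 2) (r_ m / m.+2%:R) else rho 0%N / 2.
have r_0 n : 0 < r_ n.
  elim: n => [|n IH] /=; first by rewrite divr_gt0//; case: (Hrho 0%N).
  by rewrite lt_min !divr_gt0//; case: (Hrho n.+1).
have r_rho n : r_ n < rho n.
  have h m : rho m / 2 < rho m.
    by rewrite ltr_pdivrMr// ltr_pMr ?ltr1n//; case: (Hrho m).
  by case: n => [|n] /=; rewrite ?gt_min h.
have r_S n : r_ n.+1 <= r_ n / n.+2%:R by rewrite /= ge_min lexx orbT.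
have r_S1 n : r_ n.+1 <= r_ n.
  by rewrite (le_trans (r_S n))// ler_pdivrMr// ler_peMr ?ler1n// ltW.
have r_dec m n : (m <= n)%N -> r_ n <= r_ m.
  by move=> /subnKC <-; elim: (n - m)%N => [|k IH]; rewrite ?addn0// addnS (le_trans (r_S1 _)).
have incZn m n : (m <= n)%N -> Z m `<=` Z n.
  move=> /subnKC <-; elim: (n - m)%N => [|k IH]; rewrite ?addn0// addnS.
  exact: subset_trans IH (incZ _).
pose shell n : set (C R) := [set a | r_ n.+1 <= cabs (a - b) < r_ n].
pose E := \bigcup_n (shell n `\` Z n).
have mshell n : measurable (in_plane (shell n)).
  have -> : shell n = ~` [set z | cabs (z - b) < r_ n.+1] `&` [set z | cabs (z - b) < r_ n].
    apply/seteqP; split=> a; first by move=> /andP[h1 h2]; split=> //=; apply/negP; rewrite -leNgt.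
    by move=> [/negP + h2]; rewrite -leNgt => h1; apply/andP.
  have m1 := measurable_notin_plane (@open_disc_open b (r_ n.+1)).
  have m3 := measurable_open_plane (@open_disc_open b (r_ n)).
  exact: (measurableI _ _ m1 m3).
have mE : measurable (in_plane E).
  have -> : in_plane E = \bigcup_n (in_plane (shell n) `\` in_plane (Z n)).
    by apply/seteqP; split=> p [n _ [h1 h2]]; exists n.
  by apply: bigcupT_measurable => n; apply: measurableD.
have small n a : E a -> cabs (a - b) < r_ n -> ~ Z n a.
  move=> [m _ [/andP[h1 h2] nZ]] an Zn; apply: nZ; apply: (incZn n m) => //.
  by rewrite leqNgt; apply/negP => mn; have := r_dec _ _ mn; move: h1 an; lra.
have r_small (e : R) : 0 < e -> exists n, r_ n < e.
  move=> e0; have q0 : 0 <= r_ 0%N / e by rewrite divr_ge0// ltW.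
  exists (Num.bound (r_ 0%N / e)).+1; set k := Num.bound _.
  rewrite (le_lt_trans (r_S k))// ltr_pdivrMr//.
  have h := archi_boundP q0; rewrite ltr_pdivrMr// in h.
  rewrite (le_lt_trans (r_dec 0%N k (leq0n _)))// (lt_trans h)// mulrC ltr_pM2l// ltr_nat.
  by rewrite ltnS ltnW.
have locate r : 0 < r -> r < r_ 0%N -> exists n, r_ n.+1 <= r < r_ n.
  move=> r0 rr; have ex : exists n, r_ n <= r by have [n /ltW] := r_small r r0; exists n.
  case: (ex_minnP ex) => -[|n] h mn; first by move: h rr; lra.
  by exists n; rewrite h ltNge; apply/negP => /mn; rewrite ltnn.
have gap n r : 0 < r -> r < r_ n ->
    rarea (in_plane (closed_disc b r) `\` in_plane E) <= n.+1%:R^-1 * (6 * r ^+ 2).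
  move=> r0 rn; have rr0 : r < r_ 0%N by rewrite (lt_le_trans rn)// r_dec.
  have [N /andP[N1 N2]] := locate r r0 rr0.
  have nN : (n <= N)%N.
    by rewrite leqNgt; apply/negP => Nn; have := r_dec _ _ Nn; move: N1 rn; lra.
  pose S1 := in_plane (Z N `&` closed_disc b r).
  pose S2 := in_plane (Z N.+1 `&` closed_disc b (r_ N.+1)).
  pose S3 := in_plane (closed_disc b (r_ N.+2)).
  have bx S s : S `<=` closed_disc b s -> in_box (in_plane S).
    by move=> h; apply: in_boxS (in_box_disc b s) => p; exact: h.
  have mS1 : measurable S1 := measurableI _ _ (mZ N) (measurable_disc b r).
  have mS2 : measurable S2 := measurableI _ _ (mZ N.+1) (measurable_disc b _).
  have mS3 : measurable S3 := measurable_disc b _.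
  have dle s : s <= r -> closed_disc b s `<=` closed_disc b r.
    by move=> sr a /= h; exact: le_trans h sr.
  have bS : in_box (S1 `|` S2 `|` S3).
    apply: (in_boxS _ (in_box_disc b r)) => p [[[_ h]|[_ h]]|h] => //; apply: dle h => //.
    exact: le_trans (r_S1 _) N1.
  have bS12 : in_box (S1 `|` S2) by apply: in_boxS bS => p; left.
  have bS1 : in_box S1 by apply: in_boxS bS12 => p; left.
  have bS2 : in_box S2 by apply: in_boxS bS12 => p; right.
  have bS3 : in_box S3 by apply: in_boxS bS => p; right.
  have cover : in_plane (closed_disc b r) `\` in_plane E `<=` S1 `|` S2 `|` S3.
    move=> p [pr pE]; set a : C R := (p.1 +i* p.2)%C.
    have [h2|h2] := ltP (cabs (a - b)) (r_ N.+2); first by right; exact: ltW.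
    left; have [h1|h1] := ltP (cabs (a - b)) (r_ N.+1).
      right; split; last exact: ltW.
      apply: contrapT => nZ; apply: pE; exists N.+1 => //; split=> //.
      exact/andP.
    left; split=> //; apply: contrapT => nZ; apply: pE; exists N => //; split=> //.
    by apply/andP; split=> //; exact: le_lt_trans pr N2.
  have mD : measurable (in_plane (closed_disc b r) `\` in_plane E).
    by apply: measurableD => //; exact: measurable_disc.
  have mU12 : measurable (S1 `|` S2) by exact: measurableU.
  have mU : measurable (S1 `|` S2 `|` S3) by exact: measurableU.
  rewrite (le_trans (rarea_le mD mU bS cover))//.
  rewrite (le_trans (rarea_subU mU12 mS3 bS12 bS3 bS))//.
  have u12 := rarea_subU mS1 mS2 bS1 bS2 bS12.
  have u1 : rarea S1 <= n.+1%:R^-1 * r ^+ 2.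
    have [_ H] := Hrho N; rewrite (le_trans (H r r0 (lt_trans N2 (r_rho N))))//.
    by rewrite ler_wpM2r ?sqr_ge0// lef_pV2 ?posrE// ler_nat ltnS.
  have rN1r : r_ N.+1 ^+ 2 <= r ^+ 2 by rewrite lerXn2r ?nnegrE ?(ltW r0) ?(ltW (r_0 _)).
  have u2 : rarea S2 <= n.+1%:R^-1 * r ^+ 2.
    have [_ H] := Hrho N.+1; rewrite (le_trans (H _ (r_0 _) (r_rho _)))//.
    by rewrite ler_pM ?invr_ge0 ?sqr_ge0// lef_pV2 ?posrE// ler_nat ltnS (leq_trans nN).
  have u3 : rarea S3 <= n.+1%:R^-1 * (4 * r ^+ 2).
    rewrite (le_trans (rarea_disc_le b (ltW (r_0 _))))// [leRHS]mulrCA ler_wpM2l//.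
    have h3 : r_ N.+2 <= r / N.+3%:R.
      by rewrite (le_trans (r_S _))// ler_pM2r ?invr_gt0.
    have h4 : r_ N.+2 ^+ 2 <= (r / N.+3%:R) ^+ 2.
      by rewrite lerXn2r ?nnegrE ?(ltW (r_0 _))// divr_ge0// ltW.
    rewrite (le_trans h4)// exprMn mulrC ler_wpM2r ?sqr_ge0//.
    rewrite expr2 (@le_trans _ _ (N.+3%:R^-1 * 1))//.
      by rewrite ler_wpM2l ?invr_ge0// invf_le1 ?ler1n.
    by rewrite mulr1 lef_pV2 ?posrE// ler_nat ltnS (leq_trans nN)// ltnW.
  have -> : n.+1%:R^-1 * (6 * r ^+ 2) =
      n.+1%:R^-1 * r ^+ 2 + n.+1%:R^-1 * r ^+ 2 + n.+1%:R^-1 * (4 * r ^+ 2) by ring.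
  by rewrite (le_trans (lerD u12 u3))// lerD2r lerD.
exists E; split=> //.
- move=> A [e /= e0 sA].
  have pi0 : 0 < pi :> R by exact: pi_gt0.
  have e6 : 0 <= 6 / pi / e by rewrite !divr_ge0// ltW.
  pose n := Num.bound (6 / pi / e).
  have hn : n.+1%:R^-1 * (6 / pi) < e.
    have h := archi_boundP e6; rewrite mulrC ltr_pdivrMr// -ltr_pdivrMl// mulrC.
    by rewrite (lt_trans h)// ltr_nat.
  have rn0 := r_0 n.
  apply/nbhs_ballP; exists (r_ n) => // r; rewrite /ball/= sub0r normrN => rn r0.
  rewrite gtr0_norm// in rn.
  have mD := measurable_disc b r; have bD := in_box_disc b r.
  have mED : measurable (in_plane (E `&` closed_disc b r)) := measurableI _ _ mE mD.
  have bED : in_box (in_plane (E `&` closed_disc b r)) by apply: in_boxS bD => p [].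
  have tot : rarea (in_plane (closed_disc b r)) = pi * r ^+ 2.
    by rewrite /rarea -/(area (closed_disc b r)) area_disc.
  have sp := @rarea_split R _ _ mD mE bD; rewrite tot setIC in sp.
  have g := gap n r r0 rn; set X := rarea (_ `\` _) in sp g.
  have X0 : 0 <= X by exact: rarea_ge0.
  have pr0 : 0 < pi * r ^+ 2 by rewrite mulr_gt0// exprn_gt0.
  rewrite /area -(rareaE mED bED) -EFinM; apply: sA => /=.
  have -> : rarea (in_plane (E `&` closed_disc b r)) = pi * r ^+ 2 - X by rewrite sp addrK.
  have -> : 1 - (pi * r ^+ 2 - X) / (pi * r ^+ 2) = X / (pi * r ^+ 2).
    by rewrite mulrBl divff ?gt_eqF// opprB addrCA subrr addr0.
  rewrite ger0_norm ?divr_ge0 ?(ltW pr0)// (le_lt_trans _ hn)//.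
  rewrite ler_pdivrMr// (le_trans g)//.
  have -> : n.+1%:R^-1 * (6 / pi) * (pi * r ^+ 2) = n.+1%:R^-1 * (6 * r ^+ 2).
    rewrite -mulrA; congr (_ * _); rewrite mulrA; congr (_ * _).
    by rewrite divfK ?gt_eqF.
  by [].
- move=> a [n _ [_ nZ]] /= Z0; apply: nZ; exact: (incZn 0%N n).
- move=> [n _ [/andP[h _] _]]; move: h; rewrite subrr cabs0 leNgt => /negP; apply.
  exact: r_0.
- by move=> n; exists (r_ n) => // a Ea; exact: small.
Qed.

End DensityOne.

(** * The theorem *)

Theorem theorem1p2 (R : realType) (alpha : R) (U : set (C R)) (b : C R)
  (alpha_gt0 : 0 < alpha) (alpha_lt1 : alpha < 1)
  (U_bounded : bounded_set U) (U_open : open U) (b_bd : boundary U b)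
  (admits : exists d0 : (C R -> C R) -> C R,
     [/\ point_derivation U alpha b d0, continuous_functional U alpha d0 &
         nonzero_functional U alpha d0])
  (d : (C R -> C R) -> C R)
  (d_der : point_derivation U alpha b d)
  (d_cont : continuous_functional U alpha d)
  (d_norm : normalised d) :
  exists E : set (C R),
    [/\ E `<=` U, measurable (in_plane E), full_area_density b E &
        forall f, A_ U alpha f ->
          (f z - ext_value U b f) / (z - b) @[z --> within E (nbhs b)] --> d f].
Proof.
have [T T0 U_T] := bounded_cP U_bounded.
have [b_cl b_int] := b_bd.
have b_notin : ~ U b by move=> Ub; apply: b_int; move: U_open; rewrite openE; apply.
have U_ne : U !=set0.
  by have [z [Uz _]] := b_cl setT filterT; exists z.
have a0 := alpha_gt0; have a1 := alpha_lt1.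
pose Z (n : nat) : set (C R) := bad_point alpha U b d n.+1%:R^-1 `|` ~` U.
have mZ n : measurable (in_plane (Z n)).
  have m1 := measurable_open_plane (@bad_open R alpha U b d U_open b_notin n.+1%:R^-1).
  exact: (measurableU _ _ m1 (measurable_notin_plane U_open)).
have inv0 n : 0 < n.+1%:R^-1 :> R by rewrite invr_gt0.
have incZ n : Z n `<=` Z n.+1.
  move=> a [[Ua [f [Af f1 fa]]]|nUa]; [left|by right].
  split=> //; exists f; split=> //; apply: le_lt_trans fa.
  by rewrite lef_pV2 ?posrE// ler_nat.
have [Q Q0 HQ] := complement_area alpha_gt0 alpha_lt1 U_open U_ne U_T b_cl d_der d_cont d_norm.
have dZ n : zero_density b (Z n).
  move=> eps eps0; have eps2 : 0 < eps / 2 by rewrite divr_gt0.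
  have [r1 r10 H1] := bad_density alpha_gt0 alpha_lt1 U_open U_ne U_T b_cl b_notin
    d_der d_cont d_norm (inv0 n) eps2.
  have Q1 : 0 < Q + 1 by rewrite ltr_wpDl.
  have a10 : 0 < 1 - alpha by rewrite subr_gt0.
  have [r2 r20 H2] := powR_lt_eps a10 (divr_gt0 eps2 Q1).
  exists (Num.min r1 r2) => [|r r0]; first by rewrite lt_min r10.
  rewrite lt_min => /andP[rr1 rr2]; have h1 := H1 r r0 rr1; have h2 := HQ r r0.
  have h3 : Q * r `^ (3 - alpha) <= eps / 2 * r ^+ 2.
    have -> : r `^ (3 - alpha) = r `^ (1 - alpha) * r ^+ 2.
      rewrite -(@powR_mulrn _ r 2) ?(ltW r0)// -powRD ?(gt_eqF r0) ?implybT//.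
      by congr (_ `^ _); ring.
    rewrite mulrA ler_wpM2r ?sqr_ge0//.
    rewrite (le_trans (ler_wpM2l Q0 (H2 r (ltW r0) rr2)))// mulrA ler_pdivrMr// mulrC.
    by rewrite ler_wpM2l ?(ltW eps2)// lerDl.
  pose S1 := in_plane (bad_point alpha U b d n.+1%:R^-1 `&` closed_disc b r).
  pose S2 := in_plane (~` U `&` closed_disc b r).
  have e : in_plane (Z n `&` closed_disc b r) = S1 `|` S2.
    apply/seteqP; split=> p; first by move=> [[h|h] hd]; [left|right].
    by move=> [[h hd]|[h hd]]; split => //; [left|right].
  have m1 := measurable_open_plane (@bad_open R alpha U b d U_open b_notin n.+1%:R^-1).
  have mS1 : measurable S1 := measurableI _ _ m1 (measurable_disc b r).
  have mS2 : measurable S2 := measurableI _ _ (measurable_notin_plane U_open) (measurable_disc b r).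
  have bS1 : in_box S1 by apply: in_boxS (in_box_disc b r) => p [].
  have bS2 : in_box S2 by apply: in_boxS (in_box_disc b r) => p [].
  have bS : in_box (S1 `|` S2) by rewrite -e; apply: in_boxS (in_box_disc b r) => p [].
  rewrite e (le_trans (rarea_subU mS1 mS2 bS1 bS2 bS))// (splitr eps) mulrDl lerD//.
  exact: le_trans h2 h3.
(* The complement of [U] is part of every [Z n], so that [E] lies in [U]. *)
have [E [mE fE EZ nEb Esmall]] := avoid_zero_density mZ incZ dZ.
exists E; have EU : E `<=` U.
  by move=> z /EZ nZ; apply: contrapT => nU; apply: nZ; right.
split; [exact: EU|exact: mE|exact: fE|move=> f Af].
have fFE : Filter (within E (nbhs b)) by exact: within_filter.
apply/cvg_cP => e e0.
have /A_P-/(_ U_open U_ne)[_ [k k0 fk] _] := Af.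
have k1 : 0 < k + 1 by rewrite ltr_wpDl.
have n1 : rc (k + 1) != 0 by rewrite -cabs_gt0 cabs_rc gtr0_norm.
(* Normalising [f] brings it into the unit ball used to define the bad points. *)
pose c := (rc (k + 1))^-1.
have cc : cabs c = (k + 1)^-1 by rewrite cabsV cabs_rc gtr0_norm.
pose g z := c * f z.
have AZ h : A_ U alpha h -> A_ U alpha (fun z => c * h z).
  exact: (A_scale alpha_gt0 alpha_lt1 U_open U_ne U_T).
have Ag : A_ U alpha g by exact: AZ.
have g1 : lip alpha U 1 g.
  move=> z w Uz Uw; rewrite -mulrBr cabsM cc ler_pdivrMl// mulrA mulr1.
  by rewrite (le_trans (fk z w Uz Uw))// ler_wpM2r ?powR_ge0// lerDl.
have dZc h : A_ U alpha h -> d (fun z => c * h z) = c * d h.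
  exact: (d_scale alpha_gt0 alpha_lt1 U_open U_ne U_T d_der).
have eg : ext_value U b g = c * ext_value U b f.
  have evd h : A_ U alpha h -> ext_value U b h = d (fun z => (z - b) * h z).
    exact: (ev_dE alpha_gt0 alpha_lt1 U_open U_ne U_T b_cl d_der d_norm).
  have Azb : A_ U alpha (fun z => z - b).
    exact: (A_addcst alpha_gt0 alpha_lt1 U_open U_ne U_T (- b)
      (A_id alpha_gt0 alpha_lt1 U_open U_ne U_T)).
  have AM h : A_ U alpha h -> A_ U alpha (fun z => (z - b) * h z).
    exact: (A_mul alpha_gt0 U_open U_ne U_T Azb).
  rewrite (evd _ Ag) (evd _ Af) -(dZc _ (AM _ Af)).
  by apply: (d_eq d_der (AM _ Ag) (AZ _ (AM _ Af))) => z _; rewrite mulrCA.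
have errE z : quot_err U b d f z = rc (k + 1) * quot_err U b d g z.
  rewrite /quot_err eg (dZc _ Af) -mulrBr -mulrA -mulrBr mulrA /c divff// mul1r//.
have e1 : 0 <= (k + 1) / e by rewrite divr_ge0// ltW.
pose n := Num.bound ((k + 1) / e).
have [r0 r00 Hr0] := Esmall n.
apply/nbhs_cP; exists r0 => // z zb Ez /=.
have := Hr0 z Ez zb => nZ.
have Uz := EU z Ez.
have hg : cabs (quot_err U b d g z) <= n.+1%:R^-1.
  rewrite leNgt; apply/negP => h; apply: nZ; left; split=> //.
  by exists g.
rewrite -/(quot_err U b d f z) errE cabsM cabs_rc gtr0_norm//.
rewrite (le_lt_trans (ler_wpM2l (ltW k1) hg))// ltr_pdivrMr// mulrC -ltr_pdivrMr//.
by rewrite (lt_trans (archi_boundP e1))// ltr_nat.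
Qed.
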